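(* Let $1<\beta<2$ and $\delta\in\mathbb{R}$. Let $\mathcal{H}$ be a separable Hilbert space and let $\mathfrak{L}:\mathrm{Dom}(\mathfrak{L})\subset\mathcal{H}\to\mathcal{H}$ be a densely defined positive linear operator with discrete spectrum $\sigma(\mathfrak{L})=\{\gamma_\zeta:\zeta\in I\}$ ($I$ countable), whose system of eigenfunctions $\{e_\zeta\}_{\zeta\in I}$ is an orthonormal basis of $\mathcal{H}$. Consider the $\mathfrak{L}$-wave type equation $$\,^{C}\partial_t^{\beta}w(t)+\mathfrak{L}w(t)=0,\quad t>0,\qquad w(t)|_{t=0}=w_0\in\mathcal{H},\quad \partial_tw(t)|_{t=0}=w_1\in\mathcal{H}. \qquad (\ast)$$ (1) If $0\in\sigma(\mathfrak{L})$ and $w_0,w_1\in\mathcal{H}_{\mathfrak{L}}^{\delta}$, then there exists a unique continuous solution $w$ of $(\ast)$ with $w(t)\in\mathcal{H}_{\mathfrak{L}}^{\delta}$ for any $t\in(0,+\infty)$, represented by $$w(t)=\sum_{\zeta\in I}\Big[(w_0,e_\zeta)_{\mathcal{H}}\,E_{\beta}(-t^{\beta}\gamma_\zeta)+t\,(w_1,e_\zeta)_{\mathcal{H}}\,E_{\beta,2}(-t^{\beta}\gamma_\zeta)\Big]e_\zeta,\qquad (\ast\ast)$$ and $$\|w(t)\|_{\mathcal{H}_{\mathfrak{L}}^{\delta}}\lesssim\|w_0\|_{\mathcal{H}_{\mathfrak{L}}^{\delta}}+t\|w_1\|_{\mathcal{H}_{\mathfrak{L}}^{\delta}},\quad t\geqslant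 0.$$ (2) If $0\notin\sigma(\mathfrak{L})$ and $w_0,w_1\in\mathcal{H}_{\mathfrak{L}}^{\delta}$, then there exists a unique continuous solution $w$ of $(\ast)$ with $w(t)\in\mathcal{H}_{\mathfrak{L}}^{\delta}$ for any $t\in(0,+\infty)$, given by $(\ast\ast)$, with $$\|w(t)\|_{\mathcal{H}_{\mathfrak{L}}^{\delta}}\lesssim(1+t^{\beta})^{-1}\|w_0\|_{\mathcal{H}_{\mathfrak{L}}^{\delta}}+t(1+t^{\beta})^{-1}\|w_1\|_{\mathcal{H}_{\mathfrak{L}}^{\delta}},\quad t\geqslant 0.$$ (3) If $w_0\in\mathcal{H}_{\mathfrak{L}}^{\delta}$ and $w_1\in\mathcal{H}_{\mathfrak{L}}^{\delta-\frac{2}{\beta}}$, then there exists a unique continuous solution $w$ of $(\ast)$ with $w(t)\in\mathcal{H}_{\mathfrak{L}}^{\delta}$ for any $t\in(0,+\infty)$, represented by $(\ast\ast)$, such that $$\|w(t)\|_{\mathcal{H}_{\mathfrak{L}}^{\delta}}\lesssim\|w_0\|_{\mathcal{H}_{\mathfrak{L}}^{\delta}}+(1+t)\|w_1\|_{\mathcal{H}_{\mathfrak{L}}^{\delta-\frac{2}{\beta}}},\quad t\geqslant 0.$$ (4) If $w_0\in\mathcal{H}_{\mathfrak{L}}^{\delta}$ and $w_1\in\mathcal{H}_{\mathfrak{L}}^{\delta-2}$, then there exists a unique continuous solution $w$ of $(\ast)$ with $w(t)\in\mathcal{H}_{\mathfrak{L}}^{\delta}$ for any $t\in(0,+\infty)$,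 given by $(\ast\ast)$, and $$\|w(t)\|_{\mathcal{H}_{\mathfrak{L}}^{\delta}}\lesssim\|w_0\|_{\mathcal{H}_{\mathfrak{L}}^{\delta}}+t(1+t^{-\beta})\|w_1\|_{\mathcal{H}_{\mathfrak{L}}^{\delta-2}},\quad t>0.$$
   Context: Positivity of $\mathfrak{L}$ means $\gamma_\zeta\geqslant 0$ for all $\zeta$ (the value $0$ is allowed); $\mathfrak{L}e_\zeta=\gamma_\zeta e_\zeta$. The notation $A\lesssim B$ means $A\leqslant CB$ with a constant $C>0$ independent of $t$ and of the initial data. Dzhrbashyan–Caputo derivative for $1<\beta<2$: $\,^{C}\partial_t^{\beta}f(t)=\frac{1}{\Gamma(2-\beta)}\int_0^t(t-s)^{1-\beta}f''(s)\,ds$. Mittag-Leffler functions: $E_{\beta,\rho}(z)=\sum_{k=0}^{\infty}\frac{z^k}{\Gamma(\beta k+\rho)}$, $z\in\mathbb{C}$, and $E_\beta=E_{\beta,1}$. $\mathfrak{L}$-Fourier coefficients: $\widehat f(\zeta)=(f,e_\zeta)_{\mathcal{H}}$. For $\delta\in\mathbb{R}$, the Sobolev space $\mathcal{H}_{\mathfrak{L}}^{\delta}$ consists of those $f$ (identified with its expansion $\sum_\zeta\widehat f(\zeta)e_\zeta$) for which $(I+\mathfrak{L})^{\delta/2}f\in\mathcal{H}$, with norm $\|f\|_{\mathcal{H}_{\mathfrak{L}}^{\delta}}=\|(I+\mathfrak{L})^{\delta/2}f\|_{\mathcal{H}}=\big(\sum_{\zeta\in I}(1+\gamma_\zeta)^{\delta}|\widehat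 f(\zeta)|^2\big)^{1/2}$; for $\delta<0$ this is the completion of $\mathcal{H}$ in this norm. Solutions are understood through the $\mathfrak{L}$-Fourier transform: $w(t)=\sum_\zeta w_\zeta(t)e_\zeta$ is a solution if for each $\zeta\in I$ the coefficient $w_\zeta(t)=(w(t),e_\zeta)_{\mathcal{H}}$ solves the scalar problem $\,^{C}\partial_t^{\beta}w_\zeta(t)+\gamma_\zeta w_\zeta(t)=0$, $t>0$, $w_\zeta(0)=(w_0,e_\zeta)_{\mathcal{H}}$, $w_\zeta'(0)=(w_1,e_\zeta)_{\mathcal{H}}$. Continuous means continuous in $t$ with values in $\mathcal{H}$. *)

(* Defs.v *)
From HB Require Import structures.
From mathcomp Require Import all_boot all_order all_algebra complex.
From mathcomp Require Import all_classical all_reals all_analysis.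
From mathcomp Require summability.
Set Implicit Arguments.
Unset Strict Implicit.
Unset Printing Implicit Defensive.
Import Order.TTheory GRing.Theory Num.Theory ComplexField.
Import numFieldNormedType.Exports.
Local Open Scope classical_set_scope.
Local Open Scope ring_scope.

Section special_functions.
Context {R : realType}.

Definition Gamma (x : R) : R :=
  \int[lebesgue_measure]_(s in `]0, +oo[) (s `^ (x - 1) * expR (- s)).

Definition mittag_leffler (beta rho : R) (z : R[i]) : R[i] :=
  limn (series (fun k => z ^+ k / ((Gamma (beta * k%:R + rho))%:C)%C) : nat -> R[i]^o).

End special_functions.

Section caputo.
Context {R : realType}.
Implicit Types (f : R -> R) (u : R -> R[i]).
Local Notation mu := (@lebesgue_measure R).

Definition caputo_integrand (beta : R) f (t s : R) : R :=
  (t - s) `^ (1 - beta) * derive1n 2 f s.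

(* The Dzhrbashyan-Caputo derivative of order [beta], for 1 < beta < 2. *)
Definition caputo (beta : R) f (t : R) : R :=
  (Gamma (2 - beta))^-1 * \int[mu]_(s in `]0, t[) caputo_integrand beta f t s.

(* [f] is C^1 on [0, +oo[ with (right) derivative [b] at 0, and f' is locally
   absolutely continuous on [0, +oo[, i.e. f' is the primitive of its a.e.
   derivative f'' which is Lebesgue integrable on each ]0, t[; f'' itself may
   be singular at 0, as happens for t |-> E_beta(- gamma t^beta). Nothing is
   required of [f] at negative times. *)
Definition caputo_regular (b : R) f : Prop :=
  [/\ {within `[0, +oo[, continuous f},
      h^-1 * (f h - f 0) @[h --> 0^'+] --> b,
      (forall t, 0 < t -> derivable f t 1),
      (forall t, 0 < t -> mu.-integrable `]0, t[ (EFin \o derive1n 2 f)) &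
      (forall t, 0 < t -> derive1 f t = b + \int[mu]_(s in `]0, t[) derive1n 2 f s)].

Definition real_scalar_solution (beta gamma a b : R) f : Prop :=
  [/\ caputo_regular b f,
      f 0 = a,
      (forall t, 0 < t ->
         mu.-integrable `]0, t[ (EFin \o caputo_integrand beta f t)) &
      (forall t, 0 < t -> caputo beta f t + gamma * f t = 0)].

(* As [gamma] is real, a complex-valued function solves the scalar problem iff
   its real and imaginary parts do. *)
Definition scalar_solution (beta gamma : R) (a b : R[i]) u : Prop :=
  real_scalar_solution beta gamma (complex.Re a) (complex.Re b)
    (fun t => complex.Re (u t)) /\
  real_scalar_solution beta gamma (complex.Im a) (complex.Im b)
    (fun t => complex.Im (u t)).

End caputo.

Definition separable_space (T : topologicalType) : Prop :=
  exists2 A : set T, countable A & dense A.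

Section hilbert.
Context {R : realType} {H : completeNormedModType R[i]}.
Variable dot : {dot H for @conjc R}.

Definition hilbert_space : Prop := forall x : H, `|x| ^+ 2 = dot x x.

(* Unconditional convergence: the net of finite partial sums tends to [x]. *)
Definition has_sum (I : countType) (f : I -> H) (x : H) : Prop :=
  summability.partial_sum f @ summability.totally --> x.

Definition orthonormal_basis (I : countType) (e : I -> H) : Prop :=
  (forall i j, dot (e i) (e j) = (i == j)%:R) /\
  (forall x, has_sum (fun i => dot x (e i) *: e i) x).

(* An operator with domain [D]; the values of [L] outside [D] are irrelevant. *)
Definition linear_operator (D : set H) (L : H -> H) : Prop :=
  D 0 /\ forall (a : R[i]) x y, D x -> D y ->
    D (a *: x + y) /\ L (a *: x + y) = a *: L x + L y.

Definition resolvent_set (D : set H) (L : H -> H) : set R[i] :=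
  [set l | exists B : {linear H -> H},
    [/\ continuous B,
        (forall y, D (B y) /\ l *: B y - L (B y) = y) &
        (forall x, D x -> B (l *: x - L x) = x)]].

Definition spectrum (D : set H) (L : H -> H) : set R[i] :=
  ~` resolvent_set D L.

(* Every point of the spectrum is isolated ([R[i]^o] carries the usual topology
   of the complex plane); eigenvalues of infinite multiplicity are allowed. *)
Definition discrete_spectrum (D : set H) (L : H -> H) : Prop :=
  spectrum D L `<=` isolated (spectrum D L : set R[i]^o).

Definition positive_discrete_operator (D : set H) (L : H -> H)
    (I : countType) (gamma : I -> R) (e : I -> H) : Prop :=
  [/\ linear_operator D L /\ dense D,
      forall i, 0 <= gamma i,
      forall i, D (e i) /\ L (e i) = ((gamma i)%:C)%C *: e i,
      spectrum D L = [set ((gamma i)%:C)%C | i in [set: I]]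
        /\ discrete_spectrum D L &
      orthonormal_basis e].

Definition fourier (I : countType) (e : I -> H) (f : H) : I -> R[i] :=
  fun i => dot f (e i).

End hilbert.

(* The scale of Sobolev spaces, as spaces of families of Fourier coefficients:
   for negative [delta] this realizes the completion of H. *)
Section sobolev.
Context {R : realType} {I : countType}.
Variables (gamma : I -> R) (delta : R).
Implicit Type c : I -> R[i].

Definition sobolev_sqnorm c : \bar R :=
  \esum_(i in [set: I]) ((1 + gamma i) `^ delta * Normc.normc (c i) ^+ 2)%:E.

Definition in_sobolev c : Prop := (sobolev_sqnorm c < +oo)%E.

Definition sobolev_norm c : R := Num.sqrt (fine (sobolev_sqnorm c)).

End sobolev.

Section wave.
Context {R : realType} {H : completeNormedModType R[i]}.
Variables (dot : {dot H for @conjc R}) (I : countType).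
Variables (gamma : I -> R) (e : I -> H) (beta : R).

Definition wave_solution (w0 w1 : H) (w : R -> H) : Prop :=
  forall i, scalar_solution beta (gamma i) (fourier dot e w0 i)
    (fourier dot e w1 i) (fun t => fourier dot e (w t) i).

Definition continuous_sobolev_solution (delta : R) (w0 w1 : H) (w : R -> H) :=
  [/\ wave_solution w0 w1 w,
      {within `[0, +oo[, continuous w} &
      forall t, 0 < t -> in_sobolev gamma delta (fourier dot e (w t))].

Definition wave_coefficient (w0 w1 : H) (t : R) (i : I) : R[i] :=
  let z : R[i] := ((- (t `^ beta * gamma i))%:C)%C in
  fourier dot e w0 i * mittag_leffler beta 1 z
  + (t%:C)%C * fourier dot e w1 i * mittag_leffler beta 2 z.

(* [w] is only determined on [0, +oo[. *)
Definition unique_represented_solution (delta : R) (w0 w1 : H) (w : R -> H) :=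
  [/\ continuous_sobolev_solution delta w0 w1 w,
      (forall v, continuous_sobolev_solution delta w0 w1 v ->
         forall t, 0 <= t -> v t = w t) &
      (forall t, 0 <= t ->
         has_sum (fun i => wave_coefficient w0 w1 t i *: e i) (w t))].

End wave.

(* Main.v *)
(* In the eigenbasis the equation decouples into scalar problems, solved by
   t^(rho - 1) E_{beta,rho}(- gamma t^beta), rho = 1, 2. Applying the fractional
   integral of order beta - 1 turns the scalar problem into a Volterra equation,
   whence uniqueness. All the estimates, as well as the convergence of the series
   and the continuity of its sum, then reduce to |E_{beta,rho}(- x)| <= C / (1 + x)
   for x >= 0 and rho = 1, 2.

   This decay is read off the integral
     F(t) = int_0^oo Im (e^(lambda t) w / (w + 1)) dr / r,
       lambda = r e^(i theta), w = lambda^beta, pi/2 < theta < pi/beta,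
   which is O(t^(-beta)) at once. Writing lambda^(1 - beta) as a Stieltjes integral
   over 1 / (lambda + x) and the kernel (t - s)^(beta - 2) as a Laplace integral
   over e^(- x (t - s)), Fubini's theorem gives F' = - I^(beta - 1) F, so that
   F(t) = C E_beta(- t^beta) by uniqueness, with C <> 0. The only trace of Cauchy's
   theorem is the fact that int_0^oo h(r e^(i phi)) dr / r does not depend on phi:
   its phi-derivative is i times the integral of the r-derivative of h. *)
Require Import Defs.
From HB Require Import structures.
From mathcomp Require Import all_boot all_order all_algebra complex.
From mathcomp Require Import all_classical all_reals all_analysis.
From mathcomp Require Import measurable_realfun.
From mathcomp Require Import ring lra.
Set Implicit Arguments.
Unset Strict Implicit.
Unset Printing Implicit Defensive.
Import Order.TTheory GRing.Theory Num.Theory.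
Import numFieldNormedType.Exports.
Local Open Scope classical_set_scope.
Local Open Scope ring_scope.

(** F is half of a Hankel integral: E_beta(- t^beta) is 1 / (2 pi i) times the integral of e^(lambda
    t) lambda^(beta - 1) / (lambda^beta + 1) over two conjugate rays, which combine into an
    imaginary part; on a ray, d lambda / lambda = dr / r. So C is in fact pi, but no residue is
    computed. The angle exceeds pi/2 so that e^(lambda t) decays, and stays below pi/beta so that
    the zeros of lambda^beta + 1 lie to the left of the contour. The obstacle is t = 0: the density
    of F is of order 1 / r at infinity, so dominated convergence does not give F(0+). Subtracting
    the density that belongs to e^(- t), which behaves alike at infinity, leaves integrable
    functions lambda^p / ((lambda^s + c) (lambda^s' + c')). Rotated to the positive axis they become
    real, hence contribute nothing at t = 0, and C is the constant of e^(- t). It is nonzero because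
    another ray integral P, bounded and with P' = P + C e^(- t), would vanish if C = 0, against its
    sign at 0. The case rho = 2 follows by dividing the density by lambda, that is, by integrating
    in t. *)

Section measurability.
Context d (T : measurableType d) (R : realType).
Implicit Types f g : T -> R.

Lemma measurable_powR_comp f (p : R) : measurable_fun setT f ->
  measurable_fun setT (fun x => f x `^ p).
Proof. by move=> mf; exact: (measurableT_comp (measurable_powR p) mf). Qed.

Lemma measurable_expR_comp f : measurable_fun setT f ->
  measurable_fun setT (fun x => expR (f x)).
Proof. by move=> mf; exact: (measurableT_comp (@measurable_expR R) mf). Qed.

Lemma measurable_opp_comp f : measurable_fun setT f ->
  measurable_fun setT (fun x => - f x).
Proof. by move=> mf; exact: (measurableT_comp (@oppr_measurable R _) mf). Qed.

Lemma measurable_cos_comp f : measurable_fun setT f ->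
  measurable_fun setT (fun x => cos (f x)).
Proof.
move=> mf; apply: (measurableT_comp (f := @cos R) _ mf).
by apply: continuous_measurable_fun; exact: continuous_cos.
Qed.

Lemma measurable_sin_comp f : measurable_fun setT f ->
  measurable_fun setT (fun x => sin (f x)).
Proof.
move=> mf; apply: (measurableT_comp (f := @sin R) _ mf).
by apply: continuous_measurable_fun; exact: continuous_sin.
Qed.

Lemma measurable_norm_comp f : measurable_fun setT f ->
  measurable_fun setT (fun x => `|f x|).
Proof. by move=> mf; exact: (measurableT_comp (@normr_measurable R _) mf). Qed.

Lemma measurable_if_lt f g (h : T -> R) : measurable_fun setT f ->
  measurable_fun setT g -> measurable_fun setT h ->
  measurable_fun setT (fun x => if f x < g x then h x else 0).
Proof.
move=> mf mg mh; apply: measurable_fun_ifT => //.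
by apply: measurable_fun_ltr.
Qed.

(** Real powers are measurable, but they represent the inverse only at nonnegative arguments; hence
    1 / f = f |f|^(-2), where both sides are 0 at the zeros of f. *)
Lemma measurable_inv_comp f : measurable_fun setT f ->
  measurable_fun setT (fun x => (f x)^-1).
Proof.
move=> mf; have -> : (fun x => (f x)^-1) = (fun x => f x * (`|f x| `^ (- 1) * `|f x| `^ (- 1))).
  apply/funext => x; rewrite powR_inv1//.
  have [->|fx0] := eqVneq (f x) 0; first by rewrite invr0 mul0r.
  rewrite -invfM -normrM ger0_norm -?expr2 ?sqr_ge0//; field; exact: fx0.
apply: measurable_funM => //; apply: measurable_funM;
by apply: measurable_powR_comp; exact: measurable_norm_comp.
Qed.
End measurability.

Lemma gt0_powRD (R : realType) (x r s : R) : 0 < x -> x `^ (r + s) = x `^ r * x `^ s.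
Proof. by move=> x0; rewrite powRD// (gt_eqF x0) implybT. Qed.

Ltac meas := try apply: measurable_funTS; try apply: (iffRL (measurable_EFinP _ _));
  repeat first
  [ assumption | exact: measurable_cst | exact: measurable_id
  | exact: measurable_fst | exact: measurable_snd
  | apply: measurable_funM | apply: measurable_funD | apply: measurable_funB
  | apply: measurable_opp_comp | apply: measurable_powR_comp
  | apply: measurable_expR_comp | apply: measurable_cos_comp
  | apply: measurable_sin_comp | apply: measurable_norm_comp
  | apply: measurable_if_lt | apply: measurable_inv_comp ].

(** * Affine change of variables in Lebesgue integrals *)

Section affine.
Context {R : realType}.
Local Notation mu := (@lebesgue_measure R).
Local Open Scope ereal_scope.

Lemma measurable_affine (a b : R) :
  measurable_fun [set: measurableTypeR R] (fun x : measurableTypeR R => (a * x + b)%R : measurableTypeR R).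
Proof. by apply: measurable_funD => //; apply: measurable_funM. Qed.

(** The image of Lebesgue measure under x -> a x + b, multiplied by a, gives each half-open interval
    its length, so it is Lebesgue measure by uniqueness. *)
Lemma ge0_integral_affine (a b : R) (f : R -> \bar R) : (0 < a)%R ->
  measurable_fun [set: R] f -> (forall x, 0 <= f x) ->
  \int[mu]_x f x = a%:E * \int[mu]_x f (a * x + b)%R.
Proof.
move=> a0 mf f0.
have am : (0 <= a)%R by exact: ltW.
pose phi := (fun x : measurableTypeR R => (a * x + b)%R : measurableTypeR R).
have mphi : measurable_fun setT phi := measurable_affine a b.
pose nu0 := (pushforward mu phi : measure (measurableTypeR R) R).
pose nu : measure (measurableTypeR R) R := mscale (NngNum am) (nu0 mphi).
rewrite (@eq_measure_integral _ _ _ setT nu).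
  rewrite /nu ge0_integral_mscale//= ge0_integral_pushforward//.
move=> A mA _; apply: lebesgue_measure_unique => //.
move=> X [[u v] _ <-] /=.
rewrite /nu /mscale /= /pushforward /=.
have -> : phi @^-1` `]u, v]%classic = `]((u - b) / a)%R, ((v - b) / a)%R]%classic.
  apply/seteqP; split => x /=; rewrite !in_itv/= /phi ltr_pdivrMr// ler_pdivlMr//;
  by rewrite ltrBlDr lerBrDr mulrC.
rewrite !lebesgue_measure_itv/= !lte_fin ltr_pM2r ?invr_gt0// ltrD2r.
case: ifPn => uv; last by rewrite mule0.
rewrite -!EFinD -EFinM; congr (_%:E).
by field; rewrite gt_eqF.
Qed.

Lemma ge0_integral_affine_in (a b : R) (f : R -> \bar R) (D E : set R) : (0 < a)%R ->
  measurable D -> measurable E -> (forall x, E x <-> D (a * x + b)%R) ->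
  measurable_fun D f -> (forall x, D x -> 0 <= f x) ->
  \int[mu]_(x in D) f x = a%:E * \int[mu]_(x in E) f (a * x + b)%R.
Proof.
move=> a0 mD mE ED mf f0.
rewrite integral_mkcond (ge0_integral_affine b a0); last 2 first.
- exact/(measurable_restrictT _ mD).
- by move=> x; apply: erestrict_ge0.
congr (_ * _); rewrite [RHS]integral_mkcond; apply: eq_integral => x _.
rewrite /patch; case: ifPn => [/set_mem Dx|/negP Dx].
  by rewrite mem_set//; exact/ED.
by rewrite memNset// => Ex; apply: Dx; exact/mem_set/ED.
Qed.
End affine.

(** * Fundamental theorem of calculus on open intervals, possibly unbounded *)

Section improper_FTC.
Context {R : realType}.
Local Notation mu := (@lebesgue_measure R).
Variables (f F : R -> R) (D : set R) (u v : nat -> R) (A B : R).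
Hypotheses (oD : open D) (uv : forall n, u n < v n)
  (uvD : forall n, `[u n, v n] `<=` D)
  (Duv : forall x, D x -> \forall n \near \oo, u n <= x <= v n)
  (dF : forall x, D x -> is_derive x 1 F (f x))
  (cf : forall x, D x -> {for x, continuous f})
  (FA : F (u n) @[n --> \oo] --> A) (FB : F (v n) @[n --> \oo] --> B).

Let integral_uv n : (\int[mu]_(x in `[u n, v n]) (f x)%:E = (F (v n) - F (u n))%:E)%E.
Proof.
have dFx x : x \in `[u n, v n] -> derivable F x 1.
  by move=> /uvD xD; apply: (@ex_derive _ _ _ _ _ _ _ (dF xD)).
rewrite (@continuous_FTC2 _ f F) ?EFinB//.
- apply: continuous_in_subspaceT => x /set_mem/uvD xD; exact: cf.
- split.
  + by move=> x xuv; apply: dFx; apply: subset_itv_oo_cc xuv.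
  + apply: cvg_at_right_filter; apply: differentiable_continuous.
    by apply/derivable1_diffP; apply: dFx; rewrite /= in_itv/= lexx ltW.
  + apply: cvg_at_left_filter; apply: differentiable_continuous.
    by apply/derivable1_diffP; apply: dFx; rewrite /= in_itv/= lexx ltW.
- move=> x /subset_itv_oo_cc/uvD xD; rewrite derive1E.
  by apply: (@derive_val _ _ _ _ _ _ _ (dF xD)).
Qed.

Let fn n x := ((f \_ `[u n, v n]) x)%:E.

Let int_fn n : (\int[mu]_(x in D) fn n x = (F (v n) - F (u n))%:E)%E.
Proof.
rewrite -integral_uv [RHS]integral_mkcond [LHS]integral_mkcond.
apply: eq_integral => x _; rewrite /fn !patchE.
case: (boolP (x \in `[u n, v n]%classic)) => Ex; last by case: ifPn.
by rewrite ifT//; exact/mem_set/(uvD (n := n))/set_mem.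
Qed.

Let mD : measurable D := open_measurable oD.

Let mf : measurable_fun D f.
Proof. by apply: open_continuous_measurable_fun => // x /set_mem; exact: cf. Qed.

Let mfn n : measurable_fun D (fn n).
Proof.
apply/measurable_EFinP; apply/measurable_restrict => //.
by apply: measurable_funS mf => //; exact: subIsetl.
Qed.

Let cfn x : D x -> fn n x @[n --> \oo] --> (f x)%:E.
Proof.
move=> Dx; apply: cvg_near_cst; near=> n.
rewrite /fn patchE ifT//; apply/mem_set; rewrite /= in_itv/=.
by near: n; exact: Duv.
Unshelve. all: end_near. Qed.

(** The integrals over the compact intervals [[u n, v n]] are those of f cut off outside them, and
    |f| itself dominates the cut-offs. *)
Lemma improper_FTC : mu.-integrable D (EFin \o f) -> \int[mu]_(x in D) f x = B - A.
Proof.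
move=> intf.
have : (F (v n) - F (u n))%:E @[n --> \oo] --> (\int[mu]_(x in D) (f x)%:E)%E.
  rewrite (_ : (fun n => _) = (fun n => \int[mu]_(x in D) fn n x)%E); last first.
    by apply/funext => n; rewrite int_fn.
  apply: (@dominated_cvg _ _ _ mu D mD fn _ (fun x => `|f x|%:E)) => //.
  - exact: (integrable_abse intf).
  - move=> n x Dx; rewrite /fn patchE; case: ifPn => //= _.
    by rewrite lee_fin normr0.
move=> h.
have h2 : (F (v n) - F (u n))%:E @[n --> \oo] --> (B - A)%:E.
  by apply: cvg_EFin; [exact: nearW|exact: cvgB].
by rewrite /Rintegral (cvg_unique _ h h2).
Qed.

(** Positivity replaces integrability: Fatou's lemma bounds the integral by the limit B - A of the
    integrals over compact intervals, after which the dominated version applies. *)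
Lemma ge0_improper_FTC : (forall x, D x -> 0 <= f x) ->
  (\int[mu]_(x in D) (f x)%:E = (B - A)%:E)%E.
Proof.
move=> f0.
have fn0 n x : D x -> (0 <= fn n x)%E.
  by move=> Dx; rewrite /fn patchE; case: ifPn => // _; rewrite lee_fin f0.
have h2 : (F (v n) - F (u n))%:E @[n --> \oo] --> (B - A)%:E.
  by apply: cvg_EFin; [exact: nearW|exact: cvgB].
have le1 : (\int[mu]_(x in D) (f x)%:E <= (B - A)%:E)%E.
  have := fatou mu mD mfn fn0.
  rewrite (_ : (fun n => (\int[mu]_(x in D) fn n x)%E) =
    (fun n => (F (v n) - F (u n))%:E)); last by apply/funext => n; rewrite int_fn.
  rewrite (is_cvg_limn_einfE (cvgP _ h2)) (cvg_lim _ h2)//.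
  apply: le_trans; rewrite le_eqVlt; apply/orP; left; apply/eqP.
  apply: eq_integral => x /set_mem Dx.
  by rewrite (is_cvg_limn_einfE (cvgP _ (cfn Dx))) (cvg_lim _ (cfn Dx)).
have intf : mu.-integrable D (EFin \o f).
  apply/integrableP; split; first exact/measurable_EFinP.
  under eq_integral => x /set_mem Dx do rewrite /= ger0_norm ?f0//.
  by rewrite (le_lt_trans le1) ?ltry.
by rewrite -(improper_FTC intf) /Rintegral fineK//; exact: integrable_fin_num.
Qed.
End improper_FTC.

Lemma cvg_invnS (R : realType) k : ((n + k).+1%:R^-1 : R) @[n --> \oo] --> (0 : R).
Proof. by have := @cvg_harmonic R; rewrite -(cvg_shiftn k). Qed.

Section FTC_intervals.
Context {R : realType}.
Local Notation mu := (@lebesgue_measure R).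
Variables (f F : R -> R).

Section bounded.
Variables (a b A B : R).
Hypotheses (ab : a < b)
  (dF : forall x, a < x < b -> is_derive x 1 F (f x))
  (cf : forall x, a < x < b -> {for x, continuous f})
  (FA : F x @[x --> a^'+] --> A) (FB : F x @[x --> b^'-] --> B).

(** With a denominator of at least 3, the interval from a + d n to b - d n is nondegenerate already
    at n = 0. *)
Let d n : R := (b - a) / n.+3%:R.

Let d_bnd n : 0 < d n < (b - a) / 2.
Proof.
have ba : 0 < b - a by rewrite subr_gt0.
apply/andP; split; first by rewrite divr_gt0.
by rewrite ltr_pM2l// ltf_pV2 ?posrE// ltr_nat.
Qed.

Let cvg_d : d n @[n --> \oo] --> 0.
Proof.
rewrite -(mulr0 (b - a)); apply: cvgMr.
by under eq_fun do rewrite -addn2; exact: cvg_invnS.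
Qed.

Let uvD n : `[a + d n, b - d n] `<=` `]a, b[.
Proof.
move=> x /=; rewrite !in_itv/= => /andP[h1 h2].
by have := d_bnd n; move=> /andP[? ?]; apply/andP; split; lra.
Qed.

Let uv n : a + d n < b - d n.
Proof. by have := d_bnd n; move=> /andP[? ?]; lra. Qed.

Let Duv x : `]a, b[%classic x -> \forall n \near \oo, a + d n <= x <= b - d n.
Proof.
move=> /=; rewrite in_itv/= => /andP[ax xb].
have h : 0 < Num.min (x - a) (b - x) by rewrite lt_min; apply/andP; split; lra.
near=> n.
have : `|d n| < Num.min (x - a) (b - x).
  by near: n; move/cvgr0_norm_lt : cvg_d; apply.
have /andP[d0 _] := d_bnd n.
rewrite gtr0_norm// lt_min => /andP[h1 h2].
by apply/andP; split; lra.
Unshelve. all: end_near. Qed.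

Let cvgu : F (a + d n) @[n --> \oo] --> A.
Proof.
move/cvg_at_rightP : FA; apply; split.
  by move=> n; rewrite ltrDl; case/andP: (d_bnd n).
by rewrite -{2}(addr0 a); apply: cvgD => //; exact: cvg_cst.
Qed.

Let cvgv : F (b - d n) @[n --> \oo] --> B.
Proof.
move/cvg_at_leftP : FB; apply; split.
  by move=> n; rewrite ltrBlDr ltrDl; case/andP: (d_bnd n).
by rewrite -{2}(subr0 b); apply: cvgB => //; exact: cvg_cst.
Qed.

Lemma FTC_oo : mu.-integrable `]a, b[ (EFin \o f) ->
  \int[mu]_(x in `]a, b[) f x = B - A.
Proof.
apply: (@improper_FTC _ f F `]a, b[ (fun n => a + d n) (fun n => b - d n)) => //.
Qed.

Lemma ge0_FTC_oo : (forall x, a < x < b -> 0 <= f x) ->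
  (\int[mu]_(x in `]a, b[) (f x)%:E = (B - A)%:E)%E.
Proof.
move=> f0; apply: (@ge0_improper_FTC _ f F `]a, b[ (fun n => a + d n) (fun n => b - d n)) => //.
Qed.
End bounded.

Section unbounded.
Variables (A B : R).
Hypotheses (dF : forall x : R, 0 < x -> is_derive x 1 F (f x))
  (cf : forall x : R, 0 < x -> {for x, continuous f})
  (FA : F x @[x --> 0^'+] --> A) (FB : F x @[x --> +oo] --> B).

Let u n : R := n.+2%:R^-1.
Let v n : R := n.+1%:R.

Let u_bnd n : 0 < u n < 1.
Proof. by rewrite /u invr_gt0 ltr0n/= invf_lt1// ltr1n. Qed.

Let v_bnd n : 1 <= v n. Proof. by rewrite /v ler1n. Qed.

Let cvg_u : u n @[n --> \oo] --> 0.
Proof.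
by rewrite /u; under eq_fun do rewrite -addn1; exact: cvg_invnS.
Qed.

Let cvg_v : v n @[n --> \oo] --> +oo.
Proof.
apply/cvgryPge => M; near=> n; rewrite /v -natr1 -[M]addr0 lerD//.
by near: n; exact: nbhs_infty_ger.
Unshelve. all: end_near. Qed.

Let uvD n : `[u n, v n] `<=` `]0, +oo[.
Proof.
move=> x /=; rewrite !in_itv/= => /andP[h1 h2].
by have := u_bnd n; move=> /andP[? ?]; apply/andP; split => //; lra.
Qed.

Let uv n : u n < v n.
Proof. by have /andP[? ?] := u_bnd n; have := v_bnd n; lra. Qed.

Let Duv x : `]0, +oo[%classic x -> \forall n \near \oo, u n <= x <= v n.
Proof.
move=> /=; rewrite in_itv/= andbT => x0; near=> n.
apply/andP; split.
  have : `|u n| < x by near: n; move/cvgr0_norm_lt : cvg_u; apply.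
  by have /andP[? ?] := u_bnd n; rewrite gtr0_norm// => /ltW.
by near: n; move/cvgryPge : cvg_v; apply.
Unshelve. all: end_near. Qed.

Let cvgu : F (u n) @[n --> \oo] --> A.
Proof. by move/cvg_at_rightP : FA; apply; split=> // n; case/andP: (u_bnd n). Qed.

Let cvgv : F (v n) @[n --> \oo] --> B.
Proof. exact: (cvg_comp _ _ cvg_v FB). Qed.

Lemma FTC_0y : mu.-integrable `]0, +oo[ (EFin \o f) ->
  \int[mu]_(x in `]0, +oo[) f x = B - A.
Proof.
apply: (@improper_FTC _ f F `]0, +oo[ u v) => //.
- by move=> x /=; rewrite in_itv/= andbT => /dF.
- by move=> x /=; rewrite in_itv/= andbT => /cf.
Qed.

Lemma ge0_FTC_0y : (forall x : R, 0 < x -> 0 <= f x) ->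
  (\int[mu]_(x in `]0%R, +oo[) (f x)%:E = (B - A)%:E)%E.
Proof.
move=> f0; apply: (@ge0_improper_FTC _ f F `]0, +oo[ u v) => //.
- by move=> x /=; rewrite in_itv/= andbT => /dF.
- by move=> x /=; rewrite in_itv/= andbT => /cf.
- by move=> x /=; rewrite in_itv/= andbT => /f0.
Qed.
End unbounded.
End FTC_intervals.

(** * Theorems of Tonelli and Fubini on products of subsets of the line *)

Section fubini_in.
Context {R : realType}.
Local Notation mu := (@lebesgue_measure R).
Local Notation RT := (measurableTypeR R).
Variables (D E : set RT).
Hypotheses (mD : measurable D) (mE : measurable E).

Let patch2 (f : R -> R -> \bar R) (z : RT * RT) : \bar R :=
  ((fun z => f z.1 z.2) \_ (D `*` E)) z.

Let mpatch2 f : measurable_fun [set: RT * RT] (fun z => f z.1 z.2) ->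
  measurable_fun [set: RT * RT] (patch2 f).
Proof.
move=> mf; apply/(measurable_restrictT _ _).1; first exact: measurableX.
by apply: measurable_funS mf.
Qed.

Let patch21 f : (\int[mu]_x \int[mu]_y patch2 f (x, y) =
  \int[mu]_(x in D) \int[mu]_(y in E) f x y)%E.
Proof.
rewrite [RHS]integral_mkcond; apply: eq_integral => x _.
rewrite patchE; case: ifPn => Dx.
  rewrite [RHS]integral_mkcond; apply: eq_integral => y _.
  by rewrite /patch2 !patchE in_setX Dx.
by rewrite integral0_eq// => y _; rewrite /patch2 patchE in_setX (negbTE Dx).
Qed.

Let patch22 f : (\int[mu]_y \int[mu]_x patch2 f (x, y) =
  \int[mu]_(y in E) \int[mu]_(x in D) f x y)%E.
Proof.
rewrite [RHS]integral_mkcond; apply: eq_integral => y _.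
rewrite patchE; case: ifPn => Dy.
  rewrite [RHS]integral_mkcond; apply: eq_integral => x _.
  by rewrite /patch2 !patchE in_setX Dy andbT.
by rewrite integral0_eq// => x _; rewrite /patch2 patchE in_setX (negbTE Dy) andbF.
Qed.

Lemma tonelli_in (f : R -> R -> \bar R) :
  measurable_fun [set: RT * RT] (fun z => f z.1 z.2) ->
  (forall x y, D x -> E y -> 0 <= f x y)%E ->
  (\int[mu]_(x in D) \int[mu]_(y in E) f x y =
   \int[mu]_(y in E) \int[mu]_(x in D) f x y)%E.
Proof.
move=> mf f0; rewrite -patch21 -patch22.
apply: (@fubini_tonelli _ _ _ _ _ mu mu); first exact: mpatch2.
by move=> z; apply: erestrict_ge0 => -[x y] /= [Dx Ey]; exact: f0.
Qed.

Variable f : R -> R -> R.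
Hypotheses (mf : measurable_fun [set: RT * RT] (fun z => f z.1 z.2))
  (fin : (\int[mu]_(x in D) \int[mu]_(y in E) `|f x y|%:E < +oo)%E).

Let g := patch2 (fun x y => (f x y)%:E).

Let ig : (mu \x mu)%E.-integrable [set: RT * RT] g.
Proof.
have mg : measurable_fun [set: RT * RT] g by apply: mpatch2; exact/measurable_EFinP.
apply/(integrable12ltyP mu mu mg).
move: fin; rewrite -patch21; apply: le_lt_trans.
rewrite le_eqVlt; apply/orP; left; apply/eqP.
apply: eq_integral => x _; apply: eq_integral => y _.
by rewrite /g /patch2 !patchE; case: ifPn => //; rewrite abse0.
Qed.

Lemma fubini_integrable : mu.-integrable D (fun x => \int[mu]_(y in E) (f x y)%:E)%E.
Proof.
have := integrable_fubini_F ig => ig1.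
apply/integrable_mkcond => //.
apply: eq_integrable ig1 => // x _; rewrite /fubini_F patchE.
case: ifPn => Dx.
  rewrite [RHS]integral_mkcond; apply: eq_integral => y _.
  by rewrite /g /patch2 !patchE in_setX Dx.
by rewrite integral0_eq// => y _; rewrite /g /patch2 patchE in_setX (negbTE Dx).
Qed.

Lemma fubini_in_ereal :
  (\int[mu]_(x in D) \int[mu]_(y in E) (f x y)%:E =
   \int[mu]_(y in E) \int[mu]_(x in D) (f x y)%:E)%E.
Proof. by rewrite -patch21 -patch22; exact: (Fubini ig). Qed.
End fubini_in.

Section fubini_R.
Context {R : realType}.
Local Notation mu := (@lebesgue_measure R).
Local Notation RT := (measurableTypeR R).

(** An integrable function is infinite only on a null set, and elsewhere [fine] does not change it.
    This allows the inner integrals of Fubini's theorem to be taken as real numbers. *)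
Lemma integral_fine (D : set RT) (F : R -> \bar R) : measurable D ->
  mu.-integrable D F ->
  (\int[mu]_(x in D) (fine (F x))%:E = \int[mu]_(x in D) F x)%E.
Proof.
move=> mD iF; apply: ae_eq_integral => //.
- have /measurable_int mF := iF.
  by apply/measurable_EFinP; apply: measurableT_comp mF => //; exact: fine_measurable.
- exact: measurable_int iF.
- have [N [mN N0 sub]] := integrable_ae mD iF.
  exists N; split => //; apply: subset_trans sub => x /= nh h.
  by apply: nh => Dx; rewrite fineK// h.
Qed.

Lemma integrable_fine (D : set RT) (F : R -> \bar R) : measurable D ->
  mu.-integrable D F -> mu.-integrable D (EFin \o (fine \o F)).
Proof.
move=> mD iF; have mF := measurable_int _ iF.
apply: (le_integrable mD _ _ iF).
  by apply/measurable_EFinP; apply: measurableT_comp mF => //; exact: fine_measurable.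
by move=> x _; rewrite /=; case: (F x) => [r||] /=; rewrite ?lexx// normr0 leey.
Qed.

Lemma fubini_in (D E : set RT) (f : R -> R -> R) : measurable D -> measurable E ->
  measurable_fun [set: RT * RT] (fun z => f z.1 z.2) ->
  (\int[mu]_(x in D) \int[mu]_(y in E) `|f x y|%:E < +oo)%E ->
  mu.-integrable E (EFin \o (fun y => \int[mu]_(x in D) f x y)) /\
  \int[mu]_(x in D) \int[mu]_(y in E) f x y =
  \int[mu]_(y in E) \int[mu]_(x in D) f x y.
Proof.
move=> mD mE mf fin.
have mf' : measurable_fun [set: RT * RT] (fun z : RT * RT => f z.2 z.1).
  have sw : measurable_fun [set: RT * RT] (fun z : RT * RT => (z.2, z.1) : RT * RT).
    by apply: measurable_fun_pair; [exact: measurable_snd|exact: measurable_fst].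
  have := measurableT_comp mf sw.
  by apply.
have h1 := fubini_integrable mD mE mf fin.
have h2 : mu.-integrable E (fun y => \int[mu]_(x in D) (f x y)%:E)%E.
  apply: (@fubini_integrable _ E D mE mD (fun y x => f x y) mf').
  rewrite -(tonelli_in mD mE (f := fun x y => `|f x y|%:E))//.
  by apply/measurable_EFinP; exact: measurableT_comp.
split; first exact: integrable_fine h2.
by rewrite /Rintegral (integral_fine mD h1) (integral_fine mE h2) fubini_in_ereal.
Qed.
End fubini_R.

(** * Gamma and Beta integrals *)
Section gamma_integral.
Context {R : realType}.
Local Notation mu := (@lebesgue_measure R).
Local Notation RT := (measurableTypeR R).
Implicit Types p q t x : R.

Lemma ge0_integralZ (D : set RT) (c : R) (f : R -> R) : measurable D ->
  measurable_fun D f -> (forall x, D x -> 0 <= f x) -> 0 <= c ->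
  (\int[mu]_(x in D) (c * f x)%:E = c%:E * \int[mu]_(x in D) (f x)%:E)%E.
Proof.
move=> mD mf f0 c0; under eq_integral do rewrite EFinM.
rewrite (ge0_integralZl mu mD); [by []|exact/measurable_EFinP| |by rewrite lee_fin].
by move=> x Dx; rewrite lee_fin f0.
Qed.

Lemma ge0_le_integralR (D : set RT) (f g : R -> R) : measurable D ->
  measurable_fun D f -> measurable_fun D g -> (forall x, D x -> 0 <= f x) ->
  (forall x, D x -> f x <= g x) ->
  (\int[mu]_(x in D) (f x)%:E <= \int[mu]_(x in D) (g x)%:E)%E.
Proof.
move=> mD mf mg f0 fg; by apply: ge0_le_integral => //; exact/measurable_EFinP.
Qed.

Lemma ge0_subset_integralR (D E : set RT) (f : R -> R) : measurable D -> measurable E ->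
  measurable_fun E f -> (forall x, E x -> 0 <= f x) -> D `<=` E ->
  (\int[mu]_(x in D) (f x)%:E <= \int[mu]_(x in E) (f x)%:E)%E.
Proof.
by move=> mD mE mf f0 DE; apply: ge0_subset_integral => //; exact/measurable_EFinP.
Qed.

Lemma powR_cvg_at (p x : R) : 0 < x -> y `^ p @[y --> x] --> x `^ p.
Proof.
move=> x0; apply: (@differentiable_continuous _ _ _ x (fun y : R => y `^ p)).
by apply/derivable1_diffP; apply: derivable_powR; rewrite in_itv/= andbT.
Qed.

Lemma ge0_integral_powR t q : 0 < t -> 0 < q ->
  (\int[mu]_(s in `]0%R, t[) (s `^ (q - 1))%:E = (t `^ q / q)%:E)%E.
Proof.
move=> t0 q0; rewrite -[RHS]/((_)%:E) -[t `^ q / q]subr0.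
apply: (@ge0_FTC_oo _ (fun s => s `^ (q - 1)) (fun s => s `^ q / q)) => //.
- move=> x /andP[x0 _]; have h := @is_derive1_powR _ q x x0; apply: is_derive_eq.
  rewrite /GRing.scale/=; field; exact: lt0r_neq0.
- by move=> x /andP[x0 _]; exact: powR_cvg_at.
- rewrite -[X in _ --> X](mul0r q^-1); apply: cvgMl; exact: (powR_cvg0 q0).
- by apply: cvgMl; apply: cvg_at_left_filter; exact: powR_cvg_at.
- by move=> x _; exact: powR_ge0.
Qed.

(** For a > 0, multiply ln y < y by a at y = (eps / a) s and exponentiate. *)
Lemma powR_le_expR (a eps : R) : 0 <= a -> 0 < eps ->
  exists2 K, 0 < K & forall s, 0 < s -> s `^ a <= K * expR (eps * s).
Proof.
rewrite le_eqVlt => /predU1P[<- e0|a0 e0].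
  by exists 1 => // s s0; rewrite powRr0 mul1r -expR0 ler_expR mulr_ge0// ltW.
pose d := eps / a; have d0 : 0 < d by rewrite divr_gt0.
exists (expR (- a * ln d)); first exact: expR_gt0.
move=> s s0; rewrite /powR gt_eqF// -expRD ler_expR.
have := ln_sublinear (mulr_gt0 d0 s0).
rewrite lnM ?posrE// -(ltr_pM2l a0) => h.
have -> : eps * s = a * (d * s) by rewrite /d; field; rewrite gt_eqF.
lra.
Qed.

Let g (p s : R) : R := s `^ (p - 1) * expR (- s).

Lemma measurable_gamma_integrand p : measurable_fun [set: RT] (g p).
Proof.
apply: measurable_funM; first exact: measurable_powR.
by apply: measurableT_comp => //; exact: measurableT_comp.
Qed.

Lemma ge0_integral_expR (a : R) : 0 < a ->
  (\int[mu]_(s in `]0%R, +oo[) (expR (- (a * s)))%:E = (a^-1)%:E)%E.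
Proof.
move=> a0; have -> : a^-1 = 0 - (- a^-1) * expR (- (a * 0)).
  by rewrite mulr0 oppr0 expR0; ring.
have dF (x : R) : is_derive x 1 (fun s : R => - a^-1 * expR (- (a * s))) (expR (- (a * x))).
  apply: is_derive_eq; rewrite /GRing.scale/=; field; exact: lt0r_neq0.
apply: (@ge0_FTC_0y _ (fun s => expR (- (a * s))) (fun s => - a^-1 * expR (- (a * s)))) => //.
- move=> x x0; apply: differentiable_continuous; apply/derivable1_diffP.
  exact: ex_derive.
- apply: cvg_at_right_filter.
  apply: (@differentiable_continuous _ _ _ 0 (fun s : R => - a^-1 * expR (- (a * s)))).
  by apply/derivable1_diffP; exact: ex_derive.
- rewrite -[X in _ --> X](mulr0 (- a^-1)); apply: cvgMr.
  have h : a * s @[s --> +oo] --> +oo.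
    by under eq_cvg do rewrite mulrC; apply: gt0_cvgMly => //; exact: cvg_id.
  exact: (cvg_comp _ _ h (@cvgr_expR R)).
Qed.

Lemma ge0_integral_split1 (f : R -> \bar R) : measurable_fun [set: RT] f ->
  (forall x, 0 <= f x)%E ->
  (\int[mu]_(s in `]0%R, +oo[) f s =
   \int[mu]_(s in `]0%R, 1%R[) f s + \int[mu]_(s in `[1%R, +oo[) f s)%E.
Proof.
move=> mf f0; rewrite (@itv_bndbnd_setU _ _ (BRight (0 : R)) (BLeft 1) +oo%O) ?bnd_simp//.
rewrite ge0_integral_setU//=; first exact: measurable_funTS.
apply/disj_setPS => x [/=]; rewrite !in_itv/= => /andP[_ x1] /andP[].
by rewrite leNgt x1.
Qed.

Lemma gamma_integral_fin p : 0 < p ->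
  (\int[mu]_(s in `]0%R, +oo[) (g p s)%:E < +oo)%E.
Proof.
move=> p0; rewrite ge0_integral_split1; last 2 first.
- by apply/measurable_EFinP; exact: measurable_gamma_integrand.
- by move=> x; rewrite lee_fin mulr_ge0 ?powR_ge0 ?expR_ge0.
apply: lte_add_pinfty.
- apply: (@le_lt_trans _ _ (\int[mu]_(s in `]0%R, 1%R[) (s `^ (p - 1))%:E)%E).
    apply: ge0_le_integral => //=.
    + by move=> x _; rewrite lee_fin mulr_ge0 ?powR_ge0 ?expR_ge0.
    + by rewrite /g; meas.
    + by apply/measurable_EFinP; apply: measurable_funTS; exact: measurable_powR.
    + move=> x; rewrite in_itv/= => /andP[x0 _].
      by rewrite lee_fin ler_piMr ?powR_ge0// expR_le1 oppr_le0 ltW.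
  by rewrite ge0_integral_powR// ltry.
(* Beyond 1, s^(p - 1) <= s^p <= K e^(s / 2), and the other half of the exponential remains
   integrable. *)
have [K K0 hK] := @powR_le_expR p 2^-1 (ltW p0) ltac:(by []).
have h2 : (0 : R) < 2^-1 by [].
apply: (@le_lt_trans _ _ (\int[mu]_(s in `[1%R, +oo[) (K%:E * (expR (- (2^-1 * s)))%:E))%E).
  apply: ge0_le_integral => //=.
  + by move=> x _; rewrite lee_fin mulr_ge0 ?powR_ge0 ?expR_ge0.
  + by rewrite /g; meas.
  + meas.
  + move=> x; rewrite in_itv/= andbT => x1.
    have x0 : 0 < x by exact: lt_le_trans x1.
    rewrite -EFinM lee_fin /g.
    apply: (@le_trans _ _ (x `^ p * expR (- x))).
      by rewrite ler_pM2r ?expR_gt0// ler_powR// gerBl.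
    apply: (@le_trans _ _ (K * expR (2^-1 * x) * expR (- x))).
      by rewrite ler_pM2r ?expR_gt0// hK.
    rewrite -mulrA -expRD ler_pM2l// ler_expR; lra.
rewrite ge0_integralZl//=; last 2 first.
- apply/measurable_EFinP; apply: measurable_funTS.
  meas.
- by rewrite lee_fin ltW.
apply: lte_mul_pinfty; rewrite ?lee_fin ?(ltW K0)//.
apply: (@le_lt_trans _ _ (\int[mu]_(s in `]0%R, +oo[) (expR (- (2^-1 * s)))%:E)%E).
  apply: ge0_subset_integral => //=.
  - apply/measurable_EFinP; apply: measurable_funTS.
    meas.
  - by move=> x /=; rewrite !in_itv/= !andbT; exact: lt_le_trans.
by rewrite ge0_integral_expR// ltry.
Qed.

Lemma GammaE p : 0 < p ->
  (\int[mu]_(s in `]0%R, +oo[) (s `^ (p - 1) * expR (- s))%:E = (Gamma p)%:E)%E.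
Proof.
move=> p0; rewrite /Gamma /Rintegral fineK// ge0_fin_numE ?gamma_integral_fin//.
by apply: integral_ge0 => x _; rewrite lee_fin mulr_ge0 ?powR_ge0 ?expR_ge0.
Qed.

Lemma Gamma_scale p a : 0 < p -> 0 < a ->
  (\int[mu]_(s in `]0%R, +oo[) (s `^ (p - 1) * expR (- (a * s)))%:E =
   (Gamma p * a `^ (- p))%:E)%E.
Proof.
move=> p0 a0; set I := LHS.
suff h : (Gamma p)%:E = ((a `^ p)%:E * I)%E.
  by rewrite EFinM h muleAC -EFinM powRN mulfV ?mul1e// gt_eqF// powR_gt0.
rewrite -GammaE//.
rewrite (@ge0_integral_affine_in _ a 0 _ `]0, +oo[ `]0, +oo[ a0 _ _); last 5 first.
- exact: measurable_itv.
- exact: measurable_itv.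
- by move=> x /=; rewrite !in_itv/= !andbT addr0 pmulr_rgt0.
- by rewrite /g; meas.
- by move=> x _; rewrite lee_fin mulr_ge0 ?powR_ge0 ?expR_ge0.
rewrite /I -!ge0_integralZ.
- apply: eq_integral => x; rewrite inE/= in_itv/= andbT => x0.
  rewrite addr0 powRM ?ltW//; congr EFin.
  by rewrite -(mulr_powRB1 (ltW a0) p0) !mulrA.
- exact: measurable_itv.
- meas.
- by move=> x _; rewrite mulr_ge0 ?powR_ge0 ?expR_ge0.
- exact: powR_ge0.
- exact: measurable_itv.
- meas.
- by move=> x _; rewrite mulr_ge0 ?powR_ge0 ?expR_ge0.
- exact: ltW.
Qed.

(** Only the part of the integral over []a, a + 1[] is kept. As a is free, Gamma outgrows every
    exponential, which makes the Mittag-Leffler series entire. *)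
Lemma Gamma_lower p a : 1 <= p -> 0 < a -> a `^ (p - 1) * expR (- (a + 1)) <= Gamma p.
Proof.
move=> p1 a0; rewrite -lee_fin -GammaE ?(lt_le_trans _ p1)//.
apply: (@le_trans _ _ (\int[mu]_(s in `]a, (a + 1)%R[) (a `^ (p - 1) * expR (- (a + 1)))%:E)%E).
  rewrite integral_cst//= lebesgue_measure_itv/= lte_fin ltrDl ltr01.
  by rewrite -EFinD addrAC subrr add0r mule1.
apply: (@le_trans _ _ (\int[mu]_(s in `]a, (a + 1)%R[) (s `^ (p - 1) * expR (- s))%:E)%E).
  apply: ge0_le_integral => //=.
  - by move=> x _; rewrite lee_fin mulr_ge0 ?powR_ge0 ?expR_ge0.
  - by rewrite /g; meas.
  - move=> x; rewrite in_itv/= => /andP[ax xa]; rewrite lee_fin.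
    apply: ler_pM; rewrite ?powR_ge0 ?expR_ge0//.
      by rewrite ge0_ler_powR ?nnegrE ?subr_ge0// ltW// (lt_trans a0).
    by rewrite ler_expR lerN2 ltW.
apply: ge0_subset_integralR; [exact: measurable_itv|exact: measurable_itv|by meas| |].
- by move=> x _; rewrite mulr_ge0 ?powR_ge0 ?expR_ge0.
- by move=> x /=; rewrite !in_itv/= andbT => /andP[/(lt_trans a0)].
Qed.

Lemma Gamma1 : Gamma (1 : R) = 1.
Proof.
apply: EFin_inj; rewrite -GammaE//.
under eq_integral do rewrite subrr powRr0 mul1r -[X in expR (- X)]mul1r.
by rewrite ge0_integral_expR// invr1.
Qed.

Lemma Gamma_gt0 p : 0 < p -> 0 < Gamma p.
Proof.
move=> p0; rewrite -lte_fin -GammaE//.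
(* On []1, 2[] the power s^(p - 1) is at least 1 / s >= 1 / 2 for every p > 0. *)
apply: (@lt_le_trans _ _ (\int[mu]_(s in `]1%R, 2%R[) (2^-1 * expR (- 2))%:E)%E).
  rewrite integral_cst//= lebesgue_measure_itv/= lte_fin ltr1n.
  by rewrite -EFinD -EFinM lte_fin !mulr_gt0 ?expR_gt0//; lra.
apply: (@le_trans _ _ (\int[mu]_(s in `]1%R, 2%R[) (s `^ (p - 1) * expR (- s))%:E)%E).
  apply: ge0_le_integral => //=.
  - by rewrite /g; meas.
  - move=> x; rewrite in_itv/= => /andP[x1 x2]; rewrite lee_fin.
    apply: ler_pM; rewrite ?expR_ge0 ?ler_expR//; last lra.
    apply: (@le_trans _ _ (x `^ (- 1))).
      by rewrite powR_inv1 ?lef_pV2 ?posrE; lra.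
    by apply: ler_powR; lra.
apply: ge0_subset_integralR; [exact: measurable_itv|exact: measurable_itv|by meas| |].
- by move=> x _; rewrite mulr_ge0 ?powR_ge0 ?expR_ge0.
- by move=> x /=; rewrite !in_itv/= andbT => /andP[/(lt_trans ltr01)].
Qed.
End gamma_integral.

Section beta_integral.
Context {R : realType}.
Local Notation mu := (@lebesgue_measure R).
Local Notation RT := (measurableTypeR R).
Implicit Types p q t x y z : R.

Lemma integral_if (D E : set RT) (b : R -> bool) (f : R -> \bar R) :
  (forall x, E x <-> D x /\ b x) ->
  (\int[mu]_(x in D) (if b x then f x else 0) = \int[mu]_(x in E) f x)%E.
Proof.
move=> DE; rewrite [LHS]integral_mkcond [RHS]integral_mkcond.
apply: eq_integral => x _; rewrite !patchE.
case: ifPn => [/set_mem Dx|/negP Dx]; last first.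
  by rewrite memNset// => /DE[/mem_set].
case: ifPn => bx; first by rewrite ifT//; exact/mem_set/DE.
by rewrite memNset// => /DE[_]; exact/negP.
Qed.

Section beta.
Variables p q : R.
Hypotheses (p0 : 0 < p) (q0 : 0 < q).

Let B : \bar R := (\int[mu]_(s in `]0%R, 1%R[) ((1 - s) `^ (p - 1) * s `^ (q - 1))%:E)%E.

Let B_ge0 : (0 <= B)%E.
Proof. by apply: integral_ge0 => x _; rewrite lee_fin mulr_ge0 ?powR_ge0. Qed.

Let scaleB z : 0 < z ->
  (\int[mu]_(s in `]0%R, z[) ((z - s) `^ (p - 1) * s `^ (q - 1))%:E =
   (z `^ (p + q - 1))%:E * B)%E.
Proof.
move=> z0; rewrite (@ge0_integral_affine_in _ z 0 _ `]0, z[ `]0, 1[ z0); last 5 first.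
- exact: measurable_itv.
- exact: measurable_itv.
- by move=> x /=; rewrite !in_itv/= addr0 pmulr_rgt0// gtr_pMr.
- meas.
- by move=> x _; rewrite lee_fin mulr_ge0 ?powR_ge0.
rewrite /B -!ge0_integralZ; last 8 first.
- exact: measurable_itv.
- meas.
- by move=> x _; rewrite mulr_ge0 ?powR_ge0.
- exact: powR_ge0.
- exact: measurable_itv.
- meas.
- by move=> x _; rewrite mulr_ge0 ?powR_ge0.
- exact: ltW.
apply: eq_integral => x; rewrite inE/= in_itv/= => /andP[x0 x1].
rewrite addr0 -[X in X - z * x]mulr1 -mulrBr !powRM ?ltW// ?subr_gt0//; congr EFin.
have -> : z `^ (p + q - 1) = z * z `^ (p - 1) * z `^ (q - 1).
  by rewrite mulr_powRB1 ?ltW// -gt0_powRD// addrA.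
ring.
Qed.

(** The integrand of the double integral for Gamma p Gamma q, after the shift z = s + y in the first
    factor. *)
Let h y z : R := if y < z then (z - y) `^ (p - 1) * expR (- z) * y `^ (q - 1) else 0.

Let h_ge0 y z : 0 <= h y z.
Proof. by rewrite /h; case: ifPn => // _; rewrite !mulr_ge0 ?powR_ge0 ?expR_ge0. Qed.

Let int_hz y : 0 < y -> (\int[mu]_(z in `]0%R, +oo[) (h y z)%:E =
  (Gamma p * (y `^ (q - 1) * expR (- y)))%:E)%E.
Proof.
move=> y0; under eq_integral do rewrite /h fun_if.
rewrite (@integral_if _ `]y, +oo[); last first.
  move=> x; rewrite /= !in_itv/= !andbT; split=> [yx|[]//]; split=> //.
  exact: lt_trans yx.
rewrite (@ge0_integral_affine_in _ 1 y _ `]y, +oo[ `]0, +oo[); last 6 first.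
- by [].
- exact: measurable_itv.
- exact: measurable_itv.
- by move=> x /=; rewrite !in_itv/= !andbT mul1r ltrDr.
- meas.
- by move=> x _; rewrite lee_fin !mulr_ge0 ?powR_ge0 ?expR_ge0.
rewrite mul1e mulrC EFinM -GammaE// -ge0_integralZ.
- apply: eq_integral => x _; congr EFin.
  rewrite mul1r addrK opprD expRD; ring.
- exact: measurable_itv.
- meas.
- by move=> x _; rewrite !mulr_ge0 ?powR_ge0 ?expR_ge0.
- by rewrite !mulr_ge0 ?powR_ge0 ?expR_ge0.
Qed.

Let int_hy z : 0 < z -> (\int[mu]_(y in `]0%R, +oo[) (h y z)%:E =
  (z `^ (p + q - 1) * expR (- z))%:E * B)%E.
Proof.
move=> z0; under eq_integral do rewrite /h fun_if.
rewrite (@integral_if _ `]0, z[); last first.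
  move=> x; rewrite /= !in_itv/= !andbT; split=> [/andP[]//|[-> ->]//].
rewrite mulrC EFinM -muleA -scaleB// -ge0_integralZ.
- apply: eq_integral => x _; congr EFin; ring.
- exact: measurable_itv.
- meas.
- by move=> x _; rewrite !mulr_ge0 ?powR_ge0 ?expR_ge0.
- exact: expR_ge0.
Qed.

(** The double integral of [h] in both orders: over z first it is Gamma p Gamma q, over y first it
    is B Gamma (p + q), by homogeneity of the Beta integrand. *)
Lemma betaE : B = (Gamma p * Gamma q / Gamma (p + q))%:E.
Proof.
have pq0 : 0 < p + q by exact: addr_gt0.
have : (\int[mu]_(y in `]0%R, +oo[) \int[mu]_(z in `]0%R, +oo[) (h y z)%:E)%E =
       (Gamma p * Gamma q)%:E.
  rewrite EFinM -(GammaE q0) -ge0_integralZ.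
  - by apply: eq_integral => y; rewrite inE/= in_itv/= andbT => /int_hz.
  - exact: measurable_itv.
  - meas.
  - by move=> x _; rewrite !mulr_ge0 ?powR_ge0 ?expR_ge0.
  - exact/ltW/Gamma_gt0.
rewrite tonelli_in; last 4 first.
- exact: measurable_itv.
- exact: measurable_itv.
- by rewrite /h; meas.
- by move=> x y _ _; rewrite lee_fin.
have -> : (\int[mu]_(z in `]0%R, +oo[) \int[mu]_(y in `]0%R, +oo[) (h y z)%:E =
    B * (Gamma (p + q))%:E)%E.
  rewrite -GammaE// -ge0_integralZl; last 4 first.
  - exact: measurable_itv.
  - meas.
  - by move=> x _; rewrite lee_fin mulr_ge0 ?powR_ge0 ?expR_ge0.
  - exact: B_ge0.
  apply: eq_integral => z; rewrite inE/= in_itv/= andbT => z0.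
  by rewrite int_hy// muleC.
have G0 := Gamma_gt0 pq0.
(* Finiteness of B is not known beforehand: an infinite B would make the product with Gamma (p + q)
   infinite. *)
case: B B_ge0 => [b _|_|//].
  by move=> [] <-; congr EFin; field; rewrite gt_eqF.
by rewrite gt0_mulye ?lte_fin.
Qed.

Lemma ge0_integral_beta t : 0 < t ->
  (\int[mu]_(s in `]0%R, t[) ((t - s) `^ (p - 1) * s `^ (q - 1))%:E =
   (Gamma p * Gamma q / Gamma (p + q) * t `^ (p + q - 1))%:E)%E.
Proof. by move=> t0; rewrite scaleB// betaE -EFinM mulrC. Qed.
End beta.

(** For p = 1 the Beta integral over []0, 1[] is elementary, equal to 1 / q, and Gamma 1 = 1. *)
Lemma GammaS q : 0 < q -> Gamma (q + 1) = q * Gamma q.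
Proof.
move=> q0; have := @ge0_integral_beta 1 q ltr01 q0 1 ltr01.
under eq_integral do rewrite subrr powRr0 mul1r.
rewrite ge0_integral_powR// !powR1 Gamma1 !mul1r mulr1 (addrC 1) => -[h].
have G0 := Gamma_gt0 (addr_gt0 q0 ltr01).
by rewrite -[Gamma q](divfK (lt0r_neq0 G0)) -h mulrA mulfV ?mul1r// gt_eqF.
Qed.

(** Write 1 / (r + x) as the integral of e^(- (r + x) t) over t > 0 and exchange by Tonelli: the
    x-integral gives Gamma p t^(- p) e^(- r t), and the t-integral then Gamma (1 - p) r^(p - 1). *)
Lemma ge0_integral_stieltjes p r : 0 < p -> p < 1 -> 0 < r ->
  (\int[mu]_(x in `]0%R, +oo[) (x `^ (p - 1) / (r + x))%:E =
   (Gamma p * Gamma (1 - p) * r `^ (p - 1))%:E)%E.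
Proof.
move=> p0 p1 r0; have p10 : 0 < 1 - p by rewrite subr_gt0.
transitivity (\int[mu]_(x in `]0%R, +oo[) \int[mu]_(t in `]0%R, +oo[)
    (x `^ (p - 1) * expR (- ((r + x) * t)))%:E)%E.
  apply: eq_integral => x; rewrite inE/= in_itv/= andbT => x0.
  rewrite ge0_integralZ.
  - by rewrite ge0_integral_expR ?addr_gt0.
  - exact: measurable_itv.
  - meas.
  - by move=> t _; exact: expR_ge0.
  - exact: powR_ge0.
rewrite tonelli_in; last 4 first.
- exact: measurable_itv.
- exact: measurable_itv.
- meas.
- by move=> x y _ _; rewrite lee_fin mulr_ge0 ?powR_ge0 ?expR_ge0.
rewrite -mulrA -[X in r `^ X]opprB EFinM -Gamma_scale// -ge0_integralZ.
- apply: eq_integral => t; rewrite inE/= in_itv/= andbT => t0.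
  transitivity ((expR (- (r * t)))%:E * (Gamma p * t `^ (- p))%:E)%E; last first.
    by rewrite -EFinM; congr EFin; rewrite [1 - p - 1]addrAC subrr add0r; ring.
  rewrite -Gamma_scale// -ge0_integralZ.
  - apply: eq_integral => x _; congr EFin.
    by rewrite mulrDl opprD expRD [t * x]mulrC; ring.
  - exact: measurable_itv.
  - meas.
  - by move=> x _; rewrite !mulr_ge0 ?powR_ge0 ?expR_ge0.
  - exact: expR_ge0.
- exact: measurable_itv.
- meas.
- by move=> x _; rewrite !mulr_ge0 ?powR_ge0 ?expR_ge0.
- exact/ltW/Gamma_gt0.
Qed.
End beta_integral.

(** * Fractional integrals and Mittag-Leffler functions *)
(** The Riemann-Liouville fractional integral I^a based at 0. *)
HB.lock Definition RL {R : realType} (a : R) (f : R -> R) (t : R) : R :=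
  (Gamma a)^-1 * \int[@lebesgue_measure R]_(s in `]0, t[) ((t - s) `^ (a - 1) * f s).

Lemma RLE (R : realType) (a t : R) (f : R -> R) : RL a f t =
  (Gamma a)^-1 * \int[@lebesgue_measure R]_(s in `]0, t[) ((t - s) `^ (a - 1) * f s).
Proof. by rewrite unlock. Qed.

Definition ml_coef {R : realType} (beta rho : R) (k : nat) : R :=
  (Gamma (beta * k%:R + rho))^-1.

HB.lock Definition ml {R : realType} (beta rho x : R) : R :=
  limn (pseries (ml_coef beta rho) x).

Lemma mlE (R : realType) (beta rho x : R) : ml beta rho x = limn (pseries (ml_coef beta rho) x).
Proof. by rewrite unlock. Qed.

(* [t^(rho-1) E_{beta,rho}(-g t^beta)], on which fractional integration acts by
   shifting [rho]. *)
HB.lock Definition mlf {R : realType} (beta rho g t : R) : R :=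
  t `^ (rho - 1) * ml beta rho (- (g * t `^ beta)).

Lemma mlfE (R : realType) (beta rho g t : R) :
  mlf beta rho g t = t `^ (rho - 1) * ml beta rho (- (g * t `^ beta)).
Proof. by rewrite unlock. Qed.

Lemma mlf_funE (R : realType) (beta rho g : R) :
  mlf beta rho g = fun t => t `^ (rho - 1) * ml beta rho (- (g * t `^ beta)).
Proof. by apply/funext => t; rewrite mlfE. Qed.

Section riemann_liouville.
Context {R : realType}.
Local Notation mu := (@lebesgue_measure R).
Local Notation RT := (measurableTypeR R).
Implicit Types (a q t : R) (f g : R -> R).

Lemma ge0_integrable_Rintegral (D : set RT) f (v : R) : measurable D ->
  measurable_fun D f -> (forall x, D x -> 0 <= f x) ->
  (\int[mu]_(x in D) (f x)%:E = v%:E)%E ->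
  mu.-integrable D (EFin \o f) /\ \int[mu]_(x in D) f x = v.
Proof.
move=> mD mf f0 fv; split; last by rewrite /Rintegral fv.
apply/integrableP; split; first exact/measurable_EFinP.
have -> : (\int[mu]_(x in D) `|(EFin \o f) x| = \int[mu]_(x in D) (f x)%:E)%E.
  by apply: eq_integral => x /set_mem Dx; rewrite /= ger0_norm// f0.
by rewrite fv ltry.
Qed.

Lemma eq_integrableR (D : set RT) f g : measurable D -> (forall x, D x -> f x = g x) ->
  mu.-integrable D (EFin \o f) -> mu.-integrable D (EFin \o g).
Proof.
move=> mD fg; apply: eq_integrable => // x /set_mem Dx.
by rewrite /= fg.
Qed.

Lemma integrableRZ (D : set RT) f (c : R) : measurable D ->
  mu.-integrable D (EFin \o f) -> mu.-integrable D (EFin \o (fun x => c * f x)).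
Proof. by move=> mD h; have := integrableZl mD c h. Qed.

Lemma integrableRD (D : set RT) f g : measurable D ->
  mu.-integrable D (EFin \o f) -> mu.-integrable D (EFin \o g) ->
  mu.-integrable D (EFin \o (fun x => f x + g x)).
Proof. by move=> mD hf hg; have := integrableD mD hf hg. Qed.

Lemma le_integrableR (D : set RT) f g : measurable D -> measurable_fun D f ->
  (forall x, D x -> `|f x| <= g x) ->
  mu.-integrable D (EFin \o g) -> mu.-integrable D (EFin \o f).
Proof.
move=> mD mf fg ig; apply: (le_integrable mD _ _ ig).
  exact/measurable_EFinP.
move=> x Dx; rewrite /= lee_fin; apply: le_trans (fg x Dx) _.
exact: ler_norm.
Qed.

Lemma measurable_itv0 t : measurable (`]0, t[ : set RT).
Proof. exact: measurable_itv. Qed.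

Definition RL_integrable a f t : Prop :=
  mu.-integrable `]0, t[ (EFin \o (fun s => (t - s) `^ (a - 1) * f s)).

Lemma RL_powR a q t : 0 < a -> 0 < q -> 0 < t ->
  RL_integrable a (fun s => s `^ (q - 1)) t /\
  RL a (fun s => s `^ (q - 1)) t = Gamma q / Gamma (a + q) * t `^ (a + q - 1).
Proof.
move=> a0 q0 t0; rewrite /RL_integrable RLE.
have mf : measurable_fun (`]0, t[ : set RT) (fun s => (t - s) `^ (a - 1) * s `^ (q - 1)).
  by meas.
have f0 x : `]0, t[%classic x -> 0 <= (t - x) `^ (a - 1) * x `^ (q - 1).
  by move=> _; rewrite mulr_ge0 ?powR_ge0.
have [h1 h2] := ge0_integrable_Rintegral (measurable_itv0 t) mf f0 (ge0_integral_beta a0 q0 t0).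
split=> //; rewrite h2.
by rewrite !mulrA mulVf ?mul1r ?gt_eqF ?Gamma_gt0.
Qed.

Lemma eq_RL a f g t : (forall s, 0 < s < t -> f s = g s) -> RL a f t = RL a g t.
Proof.
move=> fg; rewrite !RLE; congr (_ * _); apply: eq_Rintegral => s; rewrite inE/= in_itv/= => st.
by rewrite fg.
Qed.

Lemma eq_RL_integrable a f g t : (forall s, 0 < s < t -> f s = g s) ->
  RL_integrable a f t -> RL_integrable a g t.
Proof.
move=> fg; apply: eq_integrableR; first exact: measurable_itv0.
by move=> s; rewrite /= in_itv/= => st; rewrite fg.
Qed.

Lemma RL_integrableZ a f t (c : R) : RL_integrable a f t ->
  RL_integrable a (fun s => c * f s) t.
Proof.
move=> /(integrableRZ c (measurable_itv0 t)).
apply: eq_integrableR; first exact: measurable_itv0.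
by move=> s _; rewrite mulrCA.
Qed.

Lemma RL_integrableD a f g t : RL_integrable a f t -> RL_integrable a g t ->
  RL_integrable a (fun s => f s + g s) t.
Proof.
move=> hf hg; apply: eq_integrableR (integrableRD (measurable_itv0 t) hf hg).
- exact: measurable_itv0.
- by move=> s _; rewrite mulrDr.
Qed.

Lemma RLZ a f t (c : R) : RL_integrable a f t ->
  RL a (fun s => c * f s) t = c * RL a f t.
Proof.
move=> h; rewrite !RLE mulrCA -(RintegralZl _ (measurable_itv0 t) h); congr (_ * _).
by apply: eq_Rintegral => s _; rewrite mulrCA.
Qed.

Lemma RLD a f g t : RL_integrable a f t -> RL_integrable a g t ->
  RL a (fun s => f s + g s) t = RL a f t + RL a g t.
Proof.
move=> hf hg; rewrite !RLE -mulrDr -(RintegralD (measurable_itv0 t) hf hg); congr (_ * _).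
by apply: eq_Rintegral => s _; rewrite mulrDr.
Qed.

Lemma RL_integrable_sum a t (F : nat -> R -> R) n : 0 < t ->
  (forall k, RL_integrable a (F k) t) ->
  RL_integrable a (fun s => \sum_(0 <= k < n) F k s) t /\
  RL a (fun s => \sum_(0 <= k < n) F k s) t = \sum_(0 <= k < n) RL a (F k) t.
Proof.
move=> t0 hF; elim: n => [|n [IH1 IH2]].
  have h : RL_integrable a (fun s => 0 * F 0%N s) t by exact: RL_integrableZ.
  split.
    by apply: eq_RL_integrable h => s _; rewrite big_nil mul0r.
  rewrite [RHS]big_nil -[RHS](mul0r (RL a (F 0%N) t)) -RLZ//; apply: eq_RL => s _.
  by rewrite big_nil mul0r.
split.
  apply: eq_RL_integrable (RL_integrableD IH1 (hF n)) => s _.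
  by rewrite big_nat_recr.
rewrite big_nat_recr//= -IH2 -RLD//; apply: eq_RL => s _.
by rewrite big_nat_recr.
Qed.

End riemann_liouville.

Section mittag_leffler_real.
Context {R : realType}.
Local Notation mu := (@lebesgue_measure R).
Local Notation RT := (measurableTypeR R).
Variable beta : R.
Hypothesis beta1 : 1 < beta.
Implicit Types rho x t g : R.

Lemma ml_arg_gt0 rho k : 0 < rho -> 0 < beta * k%:R + rho.
Proof.
by move=> r0; rewrite ltr_wpDl// mulr_ge0// ltW// (lt_trans ltr01).
Qed.

Lemma ml_coef_gt0 rho k : 0 < rho -> 0 < ml_coef beta rho k.
Proof. by move=> r0; rewrite invr_gt0 Gamma_gt0// ml_arg_gt0. Qed.

(** The free parameter of [Gamma_lower] is the A with A^beta = y = 2 (x + 1), so that Gamma (beta k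
    + rho) is at least a constant times y^k, while (x / y)^k <= 2^(- k). That lemma needs an
    argument of at least 1, which k >= 1 ensures; the coefficient of index 0 is added to the
    constant by hand. *)
Lemma ml_coef_bound rho x : 0 < rho -> 0 <= x ->
  exists2 M, 0 < M & forall k, ml_coef beta rho k * x ^+ k <= M / 2 ^+ k.
Proof.
move=> r0 x0; have b0 : 0 < beta by exact: lt_trans beta1.
pose y := 2 * (x + 1); have y0 : 0 < y by rewrite mulr_gt0// ltr_wpDl.
pose A := y `^ beta^-1; have A0 : 0 < A by exact: powR_gt0.
pose M := (A `^ (rho - 1) * expR (- (A + 1)))^-1.
have M0 : 0 < M by rewrite invr_gt0 mulr_gt0 ?powR_gt0 ?expR_gt0.
have AM : A `^ beta = y by rewrite /A -powRrM mulVf ?powRr1 ?gt_eqF// ltW.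
exists (M + ml_coef beta rho 0) => [|[|k]]; first by rewrite addr_gt0 ?ml_coef_gt0.
  by rewrite !expr0 mulr1 divr1 lerDr ltW.
rewrite mulrDl -[leLHS]addr0 lerD//; last first.
  by rewrite divr_ge0 ?exprn_ge0// ltW// ml_coef_gt0.
have z1 : 1 <= beta * k.+1%:R + rho.
  have : 1 <= k.+1%:R :> R by rewrite ler1n.
  move=> k1; rewrite -[leLHS]addr0 lerD ?(ltW r0)//.
  by rewrite -[leLHS]mulr1 ler_pM// ltW.
have := Gamma_lower z1 A0; rewrite -addrA gt0_powRD// powRrM AM => h.
have e1 : y `^ k.+1%:R = y ^+ k.+1 by rewrite powR_mulrn// ltW.
rewrite e1 in h.
have yx : x ^+ k.+1 <= y ^+ k.+1 / 2 ^+ k.+1.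
  rewrite -expr_div_n /y mulrAC mulfV// mul1r.
  by rewrite lerXn2r ?nnegrE// ?addr_ge0// lerDl.
have G0 := Gamma_gt0 (ml_arg_gt0 k.+1 r0).
rewrite /ml_coef ler_pdivrMl// /M.
apply: le_trans yx _.
rewrite mulrA ler_pM2r ?invr_gt0 ?exprn_gt0//.
rewrite ler_pdivlMr ?mulr_gt0 ?powR_gt0 ?expR_gt0//.
by rewrite mulrA.
Qed.

Lemma is_cvg_ml_norm rho x : 0 < rho -> cvgn (pseries (ml_coef beta rho) `|x|).
Proof.
move=> r0; have [M M0 hM] := ml_coef_bound r0 (normr_ge0 x).
apply: (@series_le_cvg _ _ (geometric M 2^-1)).
- by move=> k; rewrite /= mulr_ge0 ?exprn_ge0// ltW// ml_coef_gt0.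
- by move=> k; rewrite /= mulr_ge0// ltW.
- by move=> k; rewrite /= exprVn; exact: hM.
- apply: is_cvg_geometric_series; rewrite ger0_norm//; lra.
Qed.

Lemma is_cvg_ml rho x : 0 < rho -> cvgn (pseries (ml_coef beta rho) x).
Proof.
move=> r0; apply: (@is_cvg_pseries_inside _ _ (`|x| + 1)).
  by have := @is_cvg_ml_norm rho (`|x| + 1) r0; rewrite ger0_norm// addr_ge0.
by rewrite [ltRHS]ger0_norm ?addr_ge0// ltrDl.
Qed.

Lemma cvg_ml rho x : 0 < rho -> pseries (ml_coef beta rho) x @ \oo --> ml beta rho x.
Proof. by move=> r0; rewrite mlE; exact: is_cvg_ml. Qed.

Lemma ml_rec rho x : 0 < rho -> ml beta rho x = (Gamma rho)^-1 + x * ml beta (rho + beta) x.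
Proof.
move=> r0; have b0 : 0 < beta by exact: lt_trans beta1.
rewrite [LHS]mlE; apply/cvg_lim => //; rewrite -(cvg_shiftn 1).
have -> : (fun n => pseries (ml_coef beta rho) x (n + 1)%N) =
    (fun n => (Gamma rho)^-1 + x * pseries (ml_coef beta (rho + beta)) x n).
  apply/funext => n; rewrite /pseries /series/= addn1 big_nat_recl// expr0 mulr1.
  rewrite /ml_coef mulr0 add0r mulr_sumr; congr (_ + _); apply: eq_bigr => i _.
  have -> : beta * i.+1%:R + rho = beta * i%:R + (rho + beta).
    by rewrite -natr1 mulrDr mulr1 -addrA (addrC beta rho).
  by rewrite exprS mulrCA.
apply: cvgD; first exact: cvg_cst.
by apply: cvgMr; apply: cvg_ml; exact: addr_gt0.
Qed.
Lemma ml0 rho : 0 < rho -> ml beta rho 0 = (Gamma rho)^-1.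
Proof. by move=> r0; rewrite ml_rec// mul0r addr0. Qed.
End mittag_leffler_real.

(** * Power series with rapidly decreasing coefficients *)

Section entire_series.
Context {R : realType}.
Implicit Types c : nat -> R.

(** Infinite radius of convergence, in a quantitative form that passes directly to the derived
    series. *)
Definition entire c : Prop := (forall k, 0 <= c k) /\
  forall x : R, 0 <= x -> exists2 M, 0 < M & forall k, c k * x ^+ k <= M / 2 ^+ k.

Lemma entire_diffs c : entire c -> entire (pseries_diffs c).
Proof.
move=> [c0 hc]; split; first by move=> k; rewrite /pseries_diffs mulr_ge0.
move=> x x0; have y0 : 0 <= 2 * (x + 1) by rewrite mulr_ge0// addr_ge0.
have [M M0 hM] := hc _ y0; exists M => // k; rewrite /pseries_diffs.
(* The factor k + 1 from differentiation is absorbed by 2^(- (k + 1)), at the price of using the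
   hypothesis at 2 (x + 1) instead of x. *)
have hk : k.+1%:R * 2 ^- k.+1 <= 1 :> R.
  by rewrite ler_pdivrMr ?exprn_gt0// mul1r -natrX ler_nat ltnW// ltn_expl.
have -> : k.+1%:R * c k.+1 * x ^+ k = (k.+1%:R * 2 ^- k.+1) * (c k.+1 * (2 ^+ k.+1 * x ^+ k)).
  by field; rewrite expf_neq0.
apply: (@le_trans _ _ (1 * (c k.+1 * (2 * (x + 1)) ^+ k.+1))).
  apply: ler_pM => //.
  - by rewrite !mulr_ge0// exprn_ge0.
  - rewrite ler_wpM2l// exprMn ler_wpM2l ?exprn_ge0//.
    apply: (@le_trans _ _ ((x + 1) ^+ k)).
      by rewrite lerXn2r ?nnegrE ?addr_ge0// lerDl.
    by rewrite exprS ler_peMl ?exprn_ge0 ?addr_ge0// lerDr.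
rewrite mul1r; apply: le_trans (hM _) _.
rewrite ler_pM2l// lef_pV2 ?posrE ?exprn_gt0//.
by rewrite exprS ler_peMl ?exprn_ge0// ler1n.
Qed.

Lemma entire_cvg c : entire c -> forall x, cvgn (pseries c x).
Proof.
move=> [c0 hc] x; have y0 : 0 <= `|x| + 1 by rewrite addr_ge0.
apply: (@is_cvg_pseries_inside _ _ (`|x| + 1)); last first.
  by rewrite [ltRHS]ger0_norm ?ltrDl.
have [M M0 hM] := hc _ y0.
apply: (@series_le_cvg _ _ (geometric M 2^-1)).
- by move=> k; rewrite /= mulr_ge0 ?exprn_ge0.
- by move=> k; rewrite /= mulr_ge0// ltW.
- by move=> k; rewrite /= exprVn; exact: hM.
- apply: is_cvg_geometric_series; rewrite ger0_norm//; lra.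
Qed.

Lemma entire_continuous c : entire c -> continuous (fun x => limn (pseries c x)).
Proof.
move=> ec x; apply: differentiable_continuous; apply/derivable1_diffP.
have e1 := entire_diffs ec; have e2 := entire_diffs e1.
have xK : `|x| < `|(`|x| + 1)| by rewrite [ltRHS]ger0_norm ?addr_ge0// ltrDl.
have h0 := @entire_cvg _ ec (`|x| + 1); have h1 := @entire_cvg _ e1 (`|x| + 1).
have h2 := @entire_cvg _ e2 (`|x| + 1).
by have [] := pseries_snd_diffs h0 h1 h2 xK.
Qed.
End entire_series.

Section ml_function.
Context {R : realType}.
Local Notation mu := (@lebesgue_measure R).
Local Notation RT := (measurableTypeR R).
Variable beta : R.
Hypothesis beta1 : 1 < beta.
Implicit Types rho x t g a s : R.

Let beta0 : 0 < beta. Proof. exact: lt_trans beta1. Qed.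

Lemma entire_ml_coef rho : 0 < rho -> entire (ml_coef beta rho).
Proof.
move=> r0; split; first by move=> k; exact/ltW/ml_coef_gt0.
by move=> x x0; exact: ml_coef_bound.
Qed.

Lemma continuous_ml rho : 0 < rho -> continuous (ml beta rho).
Proof.
move=> r0; rewrite (_ : ml beta rho = fun x => limn (pseries (ml_coef beta rho) x)).
  exact/entire_continuous/entire_ml_coef.
by apply/funext => x; rewrite mlE.
Qed.

Lemma measurable_ml rho : 0 < rho -> measurable_fun [set: RT] (ml beta rho).
Proof. by move=> r0; apply: continuous_measurable_fun; exact: continuous_ml. Qed.

Lemma measurable_mlf rho g : 0 < rho -> measurable_fun [set: RT] (mlf beta rho g).
Proof.
move=> r0; rewrite mlf_funE; apply: measurable_funM; first exact: measurable_powR.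
apply: (measurableT_comp (measurable_ml r0)); meas.
Qed.

Let term rho g k s : R := (ml_coef beta rho k * (- g) ^+ k) * s `^ ((beta * k%:R + rho) - 1).

Let sum_term rho g n s : 0 < s -> \sum_(0 <= k < n) term rho g k s =
  s `^ (rho - 1) * pseries (ml_coef beta rho) (- (g * s `^ beta)) n.
Proof.
move=> s0; rewrite /pseries /series/= mulr_sumr; apply: eq_bigr => k _.
rewrite /term -addrA (@gt0_powRD _ s _ (rho - 1) s0) powRrM powR_mulrn ?powR_ge0// -mulNr exprMn; ring.
Qed.

Let RL_term a rho g k t : 0 < a -> 0 < rho -> 0 < t ->
  RL_integrable a (term rho g k) t /\
  RL a (term rho g k) t = term (rho + a) g k t.
Proof.
move=> a0 r0 t0; have q0 := ml_arg_gt0 beta1 k r0.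
have [h1 h2] := RL_powR a0 q0 t0.
split; first exact: RL_integrableZ.
rewrite RLZ// h2 /term /ml_coef.
have -> : beta * k%:R + (rho + a) = a + (beta * k%:R + rho).
  by rewrite addrA addrC.
have G0 := lt0r_neq0 (Gamma_gt0 q0).
have alg (G X P T : R) : G != 0 -> G^-1 * P * (G * X * T) = X * P * T.
  by move=> G1; field.
exact: alg.
Qed.

(** The series at the positive argument g t^beta has nonnegative terms, so its sum bounds every
    partial sum at arguments of smaller modulus. This is the majorant for termwise integration. *)
Let pseries_bound rho g s t n : 0 < rho -> 0 <= g -> 0 < s < t ->
  `|pseries (ml_coef beta rho) (- (g * s `^ beta)) n| <= ml beta rho (g * t `^ beta).
Proof.
move=> r0 g0 /andP[s0 st]; have t0 := lt_trans s0 st.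
have c0 k : 0 <= ml_coef beta rho k by exact/ltW/ml_coef_gt0.
apply: le_trans (_ : pseries (ml_coef beta rho) (g * t `^ beta) n <= _).
  rewrite /pseries /series/=; apply: le_trans (ler_norm_sum _ _ _) _.
  apply: ler_sum => k _; rewrite normrM ger0_norm// ler_wpM2l//.
  rewrite normrX normrN lerXn2r ?nnegrE ?mulr_ge0 ?powR_ge0//.
  rewrite ger0_norm ?mulr_ge0 ?powR_ge0// ler_wpM2l//.
  by rewrite ge0_ler_powR ?nnegrE ?(ltW beta0)// ltW.
rewrite mlE; apply: nondecreasing_cvgn_le; last exact: is_cvg_ml.
apply: nondecreasing_series => k _ _.
by rewrite mulr_ge0// exprn_ge0// mulr_ge0// powR_ge0.
Qed.

(** Termwise, with q = beta k + rho, I^a takes s^(q - 1) to Gamma q / Gamma (a + q) t^(a + q - 1),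
    which turns the coefficient 1 / Gamma (beta k + rho) into 1 / Gamma (beta k + rho + a).
    Dominated convergence carries this over to the sum. *)
Lemma RL_mlf a rho g t : 0 < a -> 0 < rho -> 0 <= g -> 0 < t ->
  RL_integrable a (mlf beta rho g) t /\ RL a (mlf beta rho g) t = mlf beta (rho + a) g t.
Proof.
move=> a0 r0 g0 t0; set K := ml beta rho (g * t `^ beta).
pose f n s := (t - s) `^ (a - 1) * \sum_(0 <= k < n) term rho g k s.
pose G s := K * ((t - s) `^ (a - 1) * s `^ (rho - 1)).
have mt : measurable (`]0, t[ : set RT) by exact: measurable_itv0.
have mf n : measurable_fun (`]0, t[ : set RT) (f n).
  rewrite /f; apply: measurable_funTS; apply: measurable_funM; first by meas.
  by apply: measurable_sum => k; rewrite /term; meas.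
have iG : mu.-integrable (`]0, t[ : set RT) (EFin \o G).
  by apply: integrableRZ => //; have [] := RL_powR a0 r0 t0.
have fG n s : `]0, t[%classic s -> `|f n s| <= G s.
  rewrite /= in_itv/= => /andP[s0 st].
  rewrite /f /G sum_term// normrM ger0_norm ?powR_ge0// mulrCA ler_wpM2l ?powR_ge0//.
  rewrite normrM ger0_norm ?powR_ge0// mulrC ler_wpM2r ?powR_ge0//.
  by apply: pseries_bound => //; rewrite s0.
have cf s : `]0, t[%classic s -> f n s @[n --> \oo] --> (t - s) `^ (a - 1) * mlf beta rho g s.
  rewrite /= in_itv/= => /andP[s0 st].
  have -> : f ^~ s = fun n => (t - s) `^ (a - 1) * (s `^ (rho - 1) *
      pseries (ml_coef beta rho) (- (g * s `^ beta)) n).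
    by apply/funext => n; rewrite /f sum_term.
  by rewrite mlfE; apply: cvgMr; apply: cvgMr; exact: cvg_ml.
have mh : measurable_fun (`]0, t[ : set RT) (fun s => (t - s) `^ (a - 1) * mlf beta rho g s).
  by apply: measurable_funTS; apply: measurable_funM; [meas|exact: measurable_mlf].
have fl s : `]0, t[%classic s -> `|(t - s) `^ (a - 1) * mlf beta rho g s| <= G s.
  move=> st; have := cf s st => /cvg_norm h.
  apply: (cvgr_to_le h); apply: nearW => n; exact: fG.
have iL : RL_integrable a (mlf beta rho g) t by exact: le_integrableR iG.
split => //.
have lim1 : RL a (fun s => \sum_(0 <= k < n) term rho g k s) t @[n --> \oo] --> RL a (mlf beta rho g) t.
  rewrite RLE; under eq_fun do rewrite RLE.
  apply: cvgMr; rewrite /Rintegral.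
  apply: fine_cvg; rewrite fineK; last exact: integrable_fin_num.
  apply: (@dominated_cvg _ _ _ mu _ mt (fun n s => (f n s)%:E) _ (EFin \o G)) => //.
  - by move=> n; exact/measurable_EFinP.
  - by move=> s st; apply: cvg_EFin; [exact: nearW|exact: cf].
have lim2 : RL a (fun s => \sum_(0 <= k < n) term rho g k s) t @[n --> \oo] --> mlf beta (rho + a) g t.
  have -> : (fun n => RL a (fun s => \sum_(0 <= k < n) term rho g k s) t) =
     (fun n => t `^ (rho + a - 1) * pseries (ml_coef beta (rho + a)) (- (g * t `^ beta)) n).
    apply/funext => n; rewrite -sum_term//.
    have hF k : RL_integrable a (term rho g k) t by have [] := RL_term g k a0 r0 t0.
    have [_ ->] := RL_integrable_sum n t0 hF.
    by apply: eq_bigr => k _; have [] := RL_term g k a0 r0 t0.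
  by rewrite mlfE; apply: cvgMr; apply: cvg_ml => //; exact: addr_gt0.
exact: cvg_unique lim1 lim2.
Qed.

Lemma mlf_rec rho g t : 0 < rho -> 0 < t ->
  mlf beta rho g t = t `^ (rho - 1) / Gamma rho - g * mlf beta (rho + beta) g t.
Proof.
move=> r0 t0; rewrite !mlfE ml_rec//.
have -> : rho + beta - 1 = (rho - 1) + beta by ring.
by rewrite (@gt0_powRD _ t (rho - 1) beta t0); ring.
Qed.

Lemma mlf_bound rho g t s : 0 < rho -> 0 <= g -> 0 < s < t ->
  `|mlf beta rho g s| <= s `^ (rho - 1) * ml beta rho (g * t `^ beta).
Proof.
move=> r0 g0 st; rewrite !mlfE normrM ger0_norm ?powR_ge0// ler_wpM2l ?powR_ge0//.
have /cvg_norm h := @cvg_ml _ _ beta1 rho (- (g * s `^ beta)) r0.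
by apply: (cvgr_to_le h); apply: nearW => n; exact: pseries_bound.
Qed.

Lemma continuous_mlf rho g t : 0 < rho -> 0 < t -> {for t, continuous (mlf beta rho g)}.
Proof.
move=> r0 t0; rewrite mlf_funE; apply: cvgM; first exact: powR_cvg_at.
apply: (@cvg_comp _ _ _ (fun s => - (g * s `^ beta)) (ml beta rho)); last exact: continuous_ml.
by apply: cvgN; apply: cvgMr; exact: powR_cvg_at.
Qed.
End ml_function.

(** * Comparison of functions by their derivatives, derivatives of primitives *)

Section derivative_tools.
Context {R : realType}.
Local Notation mu := (@lebesgue_measure R).
Local Notation RT := (measurableTypeR R).
Implicit Types (f g h : R -> R) (p q t s x : R).

Lemma is_derive_continuous f (l x : R) : is_derive x 1 f l -> {for x, continuous f}.
Proof.
move=> [df _]; apply: differentiable_continuous; exact/derivable1_diffP.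
Qed.

Lemma within_0y_continuous f (df : R -> R) :
  (forall s, 0 < s -> is_derive s 1 f (df s)) -> f s @[s --> 0^'+] --> f 0 ->
  {within `[0, +oo[, continuous f}.
Proof.
move=> hf f0; apply/continuous_within_itvcyP; split => // x.
by rewrite in_itv/= andbT => /hf; exact: is_derive_continuous.
Qed.

Lemma le_of_derive f g (df dg : R -> R) t : 0 < t ->
  (forall s, 0 < s -> is_derive s 1 f (df s)) ->
  (forall s, 0 < s -> is_derive s 1 g (dg s)) ->
  f s @[s --> 0^'+] --> f 0 -> g s @[s --> 0^'+] --> g 0 ->
  (forall s, 0 < s <= t -> df s <= dg s) -> f 0 <= g 0 -> f t <= g t.
Proof.
move=> t0 hf hg f0 g0 dfg fg0.
have hd s : 0 < s -> is_derive s 1 (g - f) (dg s - df s).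
  by move=> s0; have := is_deriveB (hg s s0) (hf s s0).
have h0 : (g - f) s @[s --> 0^'+] --> (g - f) 0 by apply: cvgB.
have cd : {within `[0, t], continuous (g - f)}.
  apply: continuous_subspaceW (within_0y_continuous hd h0).
  by move=> x /=; rewrite !in_itv/= => /andP[->].
have : (g - f) 0 <= (g - f) t.
  apply: (ger0_derive1_ndecr _ _ cd) => //; last exact: ltW.
  - by move=> x; rewrite in_itv/= => /andP[x0 _]; have [] := hd x x0.
  - move=> x; rewrite in_itv/= => /andP[x0 xt]; rewrite derive1E.
    have [_ ->] := hd x x0; rewrite subr_ge0 dfg// x0; exact: ltW.
rewrite !fctE/= => h; rewrite -subr_ge0; apply: le_trans h.
by rewrite subr_ge0.
Qed.

Lemma RL1 f t : RL 1 f t = \int[mu]_(s in `]0, t[) f s.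
Proof.
rewrite RLE Gamma1 invr1 mul1r; apply: eq_Rintegral => s _.
by rewrite subrr powRr0 mul1r.
Qed.

Lemma RL1_integrable f t : RL_integrable 1 f t -> mu.-integrable `]0, t[ (EFin \o f).
Proof.
apply: eq_integrableR; first exact: measurable_itv0.
by move=> s _; rewrite subrr powRr0 mul1r.
Qed.

Lemma is_derive_primitive f t :
  0 < t -> (forall s, 0 < s -> mu.-integrable `]0, s[ (EFin \o f)) ->
  {for t, continuous f} ->
  is_derive t 1 (fun s => \int[mu]_(r in `]0, s[) f r) (f t).
Proof.
move=> t0 hf cf.
have it1 : mu.-integrable [set` Interval (BRight 0) (BRight (t + 1))] (EFin \o f).
  have t2 : 0 < t + 2 by rewrite addr_gt0.
  apply: (integrableS (measurable_itv0 _) _ _ (hf _ t2)); first exact: measurable_itv.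
  by move=> x /=; rewrite !in_itv/= => /andP[-> h]/=; apply: le_lt_trans h _; lra.
have tt1 : t < t + 1 by rewrite ltrDl.
have [d1 d2] := continuous_FTC1 tt1 it1 (a := BRight 0) t0 cf.
have d : is_derive t 1 (fun s => \int[mu]_(r in [set` Interval (BRight 0) (BRight s)]) f r) (f t).
  by apply: DeriveDef; [exact: d1|rewrite -derive1E; exact: d2].
apply: near_eq_is_derive d; near=> s.
have s0 : 0 < s by near: s; exact: lt_nbhsr.
by rewrite -(Rintegral_itv_bndo_bndc (hf _ s0)).
Unshelve. all: end_near. Qed.
End derivative_tools.

(** * Semigroup law for fractional integrals whose orders add up to 1 *)

Section semigroup.
Context {R : realType}.
Local Notation mu := (@lebesgue_measure R).
Local Notation RT := (measurableTypeR R).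
Variables (p q t : R) (h : R -> R).
Hypotheses (p0 : 0 < p) (q0 : 0 < q) (pq : p + q = 1).
Hypothesis ih : mu.-integrable `]0, t[ (EFin \o h).
Hypothesis iqh : forall s, 0 < s -> RL_integrable q h s.

(** [h] is known to be measurable only on []0, t[]; the extension by 0 is measurable on the whole
    line, as [fubini_in] demands. *)
Let h' := h \_ `]0, t[.

Let mh' : measurable_fun [set: RT] h'.
Proof.
apply/(measurable_restrictT _ (measurable_itv0 t)).
by apply/measurable_EFinP; exact: measurable_int ih.
Qed.

Let F (r s : R) : R := if r < s then (t - s) `^ (p - 1) * (s - r) `^ (q - 1) * h' r else 0.

Let mF : measurable_fun [set: RT * RT] (fun z => F z.1 z.2).
Proof.
rewrite /F; apply: measurable_if_lt; [by meas|by meas|].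
apply: measurable_funM; first by meas.
by apply: (measurableT_comp mh'); exact: measurable_fst.
Qed.

Let beta_shift r : 0 < r < t ->
  (\int[mu]_(s in `]r, t[) ((t - s) `^ (p - 1) * (s - r) `^ (q - 1))%:E =
   (Gamma p * Gamma q)%:E)%E.
Proof.
move=> /andP[r0 rt].
rewrite (@ge0_integral_affine_in _ 1 r _ `]r, t[ `]0, (t - r)[); last 6 first.
- by [].
- exact: measurable_itv.
- exact: measurable_itv.
- by move=> x /=; rewrite !in_itv/= mul1r ltrDr ltrBrDr.
- meas.
- by move=> x _; rewrite lee_fin mulr_ge0 ?powR_ge0.
rewrite mul1e; have tr0 : 0 < t - r by rewrite subr_gt0.
have := ge0_integral_beta p0 q0 tr0.
rewrite pq subrr powRr0 Gamma1 divr1 mulr1 => <-.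
apply: eq_integral => x _; congr (_ `^ _ * _ `^ _)%:E; ring.
Qed.

Let int_s r : 0 < r < t ->
  mu.-integrable (`]0, t[ : set RT) (EFin \o F r) /\
  \int[mu]_(s in `]0, t[) F r s = (Gamma p * Gamma q) * h r /\
  (\int[mu]_(s in `]0%R, t[) `|F r s|%:E = (Gamma p * Gamma q * `|h r|)%:E)%E.
Proof.
move=> rt; have rt' : r \in `]0, t[%classic by rewrite inE/= in_itv.
pose F1 s : R := if r < s then (t - s) `^ (p - 1) * (s - r) `^ (q - 1) else 0.
have F1_ge0 s : 0 <= F1 s.
  by rewrite /F1; case: ifPn => // _; rewrite mulr_ge0 ?powR_ge0.
have mF1 : measurable_fun (`]0, t[ : set RT) F1 by rewrite /F1; meas.
have FE s : F r s = h r * F1 s.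
  by rewrite /F /F1 /h' patchE rt'; case: ifPn; rewrite ?mulr0// mulrC.
have iF1 : (\int[mu]_(s in `]0%R, t[) (F1 s)%:E = (Gamma p * Gamma q)%:E)%E.
  rewrite -(beta_shift rt); under eq_integral do rewrite /F1 fun_if.
  apply: integral_if => x; rewrite /= !in_itv/=.
  case/andP: rt => r0 _; split=> [/andP[rx ->]|[/andP[_ ->] ->]//].
  by rewrite rx (lt_trans r0).
have [h1 h2] := ge0_integrable_Rintegral (measurable_itv0 t) mF1 (fun x _ => F1_ge0 x) iF1.
split.
  apply: eq_integrableR (integrableRZ (h r) (measurable_itv0 t) h1).
    exact: measurable_itv0.
  by move=> x _; rewrite FE.
split.
  rewrite mulrC -h2 -(RintegralZl _ (measurable_itv0 t) h1).
  by apply: eq_Rintegral => s _; rewrite FE.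
rewrite mulrC EFinM -iF1 -ge0_integralZ.
- by apply: eq_integral => s _; rewrite FE normrM (ger0_norm (F1_ge0 s)).
- exact: measurable_itv0.
- exact: mF1.
- by move=> x _; exact: F1_ge0.
- by [].
Qed.

(** Fubini on the triangle r < s < t. Since p + q = 1, the integral of (t - s)^(p - 1) (s - r)^(q -
    1) over s is Gamma p Gamma q, whatever r and t are, so that h alone remains. *)
Lemma RL_semigroup1 : RL p (RL q h) t = \int[mu]_(s in `]0, t[) h s.
Proof.
have Gp := Gamma_gt0 p0; have Gq := Gamma_gt0 q0.
have GG : Gamma p * Gamma q != 0 := mulf_neq0 (lt0r_neq0 Gp) (lt0r_neq0 Gq).
have GG0 : 0 <= Gamma p * Gamma q := mulr_ge0 (ltW Gp) (ltW Gq).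
have fin : (\int[mu]_(r in `]0%R, t[) \int[mu]_(s in `]0%R, t[) `|F r s|%:E < +oo)%E.
  rewrite (_ : (\int[mu]_(r in `]0%R, t[) _)%E =
      (\int[mu]_(r in `]0%R, t[) (Gamma p * Gamma q * `|h r|)%:E)%E); last first.
    by apply: eq_integral => r; rewrite inE/= in_itv/= => /int_s[_ []].
  rewrite ge0_integralZ.
  - apply: lte_mul_pinfty; [by rewrite lee_fin|by []|].
    by move/integrableP : ih => [_]; rewrite /comp/=.
  - exact: measurable_itv0.
  - apply: measurableT_comp => //.
    by apply/measurable_EFinP; exact: measurable_int ih.
  - by [].
  - exact: GG0.
have [iE] := fubini_in (measurable_itv0 t) (measurable_itv0 t) mF fin.
rewrite [LHS](_ : _ = \int[mu]_(r in `]0, t[) (Gamma p * Gamma q * h r)); last first.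
  by apply: eq_Rintegral => r; rewrite inE/= in_itv/= => /int_s[_ []].
rewrite (RintegralZl _ (measurable_itv0 t) ih) => E.
have Fr s : `]0, t[%classic s ->
    \int[mu]_(r in `]0, t[) F r s = Gamma q * ((t - s) `^ (p - 1) * RL q h s).
  rewrite /= in_itv/= => /andP[s0 st]; rewrite RLE (mulrCA _ (Gamma q)^-1) (mulVKf (lt0r_neq0 Gq)).
  rewrite -(RintegralZl _ (measurable_itv0 s) (iqh s0)) /Rintegral; congr fine.
  rewrite -(@integral_if _ (`]0, t[ : set RT) (`]0, s[ : set RT) (fun r => r < s)
     (fun r => ((t - s) `^ (p - 1) * ((s - r) `^ (q - 1) * h r))%:E)); last first.
    move=> x; rewrite /= !in_itv/=; split=> [/andP[-> xs]|[/andP[-> _] ->]//].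
    by rewrite xs (lt_trans xs).
  apply: eq_integral => r rt; rewrite /F; case: ifPn => // rs.
  by rewrite /h' patchE rt mulrA.
have iE2 : mu.-integrable (`]0, t[ : set RT) (EFin \o (fun s => (t - s) `^ (p - 1) * RL q h s)).
  apply: eq_integrableR (integrableRZ (Gamma q)^-1 (measurable_itv0 t) iE).
    exact: measurable_itv0.
  by move=> s st; rewrite (Fr s st) (mulKf (lt0r_neq0 Gq)).
have E3 : \int[mu]_(s in `]0, t[) \int[mu]_(r in `]0, t[) F r s =
    Gamma q * \int[mu]_(s in `]0, t[) ((t - s) `^ (p - 1) * RL q h s).
  rewrite -(RintegralZl _ (measurable_itv0 t) iE2).
  by apply: eq_Rintegral => s /set_mem; exact: Fr.
rewrite -[RHS](mulKf GG) E E3 [LHS]RLE invfM -mulrA.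
congr (_ * _); apply/esym; exact: (mulKf (lt0r_neq0 Gq)).
Qed.
End semigroup.

(** * Uniqueness for the Volterra equation *)

Section volterra_uniqueness.
Context {R : realType}.
Local Notation mu := (@lebesgue_measure R).
Local Notation RT := (measurableTypeR R).
Implicit Types (f d : R -> R) (t s a b g : R).

Lemma continuous_0y_measurable d : {within `[0, +oo[, continuous d} ->
  measurable_fun (`]0, +oo[ : set RT) d.
Proof.
move=> /continuous_within_itvcyP[cd _]; apply: open_continuous_measurable_fun => //.
by move=> x /set_mem/= x0; apply: cd.
Qed.

Lemma continuous_0y_bounded d t : {within `[0, +oo[, continuous d} ->
  exists2 M, 0 <= M & forall s, 0 <= s <= t -> `|d s| <= M.
Proof.
move=> cd; have [t0|t0] := leP 0 t; last first.
  exists 0 => // s /andP[s0 st]; have := le_lt_trans st t0.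
  by rewrite ltNge s0.
have cd' : {within `[0, t], continuous (fun s => `|d s|)}.
  have c1 : {within `[0, t], continuous d}.
    apply: continuous_subspaceW cd; by move=> x /=; rewrite !in_itv/= => /andP[->].
  by move=> x; apply: cvg_norm; exact: c1.
have [c _ hc] := EVT_max t0 cd'.
exists `|d c| => // s st; apply: hc; by rewrite in_itv.
Qed.

Lemma RL_integrable_continuous a d t : 0 < a -> 0 < t ->
  {within `[0, +oo[, continuous d} -> RL_integrable a d t.
Proof.
move=> a0 t0 cd; have [M M0 hM] := continuous_0y_bounded t cd.
have [h _] := RL_powR a0 ltr01 t0.
apply: le_integrableR (RL_integrableZ M h); first exact: measurable_itv0.
- apply: measurable_funM; first by meas.
  apply: measurable_funS (continuous_0y_measurable cd); first exact: measurable_itv.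
  by move=> x /=; rewrite !in_itv/= => /andP[->].
- move=> s; rewrite /= in_itv/= => /andP[s0 st].
  rewrite subrr powRr0 mulr1 normrM ger0_norm ?powR_ge0// ler_wpM2l ?powR_ge0//.
  by apply: hM; rewrite !ltW.
Qed.

Lemma RL_norm_le a d t (e : R -> R) : 0 < a -> 0 < t ->
  {within `[0, +oo[, continuous d} -> RL_integrable a e t ->
  (forall s, 0 < s < t -> `|d s| <= e s) -> `|RL a d t| <= RL a e t.
Proof.
move=> a0 t0 cd ie de; have id := RL_integrable_continuous a0 t0 cd.
have G0 := Gamma_gt0 a0.
rewrite !RLE normrM (ger0_norm (_ : 0 <= (Gamma a)^-1)) ?invr_ge0 ?(ltW G0)//.
rewrite ler_wpM2l ?invr_ge0 ?(ltW G0)//.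
apply: le_trans (le_normr_Rintegral (measurable_itv0 t) id) _.
apply: (le_Rintegral (measurable_itv0 t) _ ie).
  by apply: integrable_norm => //; exact: measurable_itv0.
move=> s; rewrite /= in_itv/= => st.
by rewrite normrM (ger0_norm (powR_ge0 _ _)) ler_wpM2l ?powR_ge0// de.
Qed.

(** Picard iteration: from |d| <= M on [0, t], each use of the equation improves the bound, to M g^n
    s^(beta n) / Gamma (beta n + 1) after n uses, and this tends to 0 with n. Derivatives are
    compared instead of iterating integrals: the bound of index n + 1 has as derivative g I^(beta -
    1) of the bound of index n. *)
Lemma volterra_unique beta g d : 1 < beta -> 0 <= g ->
  {within `[0, +oo[, continuous d} -> d 0 = 0 ->
  (forall t, 0 < t -> is_derive t 1 d (- g * RL (beta - 1) d t)) ->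
  forall t, 0 <= t -> d t = 0.
Proof.
move=> b1 g0 cd d0 hd t t0.
move: t0; rewrite le_eqVlt => /predU1P[<-//|t0].
have b0 : 0 < beta by exact: lt_trans b1.
have b10 : 0 < beta - 1 by rewrite subr_gt0.
have [M M0 hM] := continuous_0y_bounded t cd.
have d0' : d s @[s --> 0^'+] --> d 0 by have /continuous_within_itvcyP[] := cd.
pose e n s : R := M * (g ^+ n * ml_coef beta 1 n) * s `^ ((beta * n%:R + 1) - 1).
have He n s : 0 <= s <= t -> `|d s| <= e n s.
  elim: n s => [|n IHn] s.
    move=> /hM; rewrite /e expr0 mul1r /ml_coef mulr0 add0r Gamma1 invr1 mulr1.
    by rewrite subrr powRr0 mulr1.
  move=> /andP[s0 st].
  move: s0; rewrite le_eqVlt => /predU1P[<-|s0].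
    rewrite d0 normr0 /e !mulr_ge0 ?powR_ge0 ?exprn_ge0//.
    by rewrite ltW// ml_coef_gt0.
  have q0 := ml_arg_gt0 b1 n (@ltr01 R).
  pose c : R := M * (g ^+ n.+1 * ml_coef beta 1 n.+1).
  have c0 : 0 <= c.
    by rewrite /c !mulr_ge0 ?exprn_ge0// ltW// ml_coef_gt0.
  pose m : R := beta * n.+1%:R.
  have m0 : 0 < m by rewrite mulr_gt0.
  have e1E r : e n.+1 r = c * r `^ m by rewrite /e addrK.
  have he1 (r : R) : 0 < r -> is_derive r 1 (e n.+1) (c * (m * r `^ (m - 1))).
    move=> r0; have h := @is_derive1_powR _ m r r0.
    have -> : e n.+1 = fun r => c * r `^ m by apply/funext => ?; exact: e1E.
    by apply: is_derive_eq.
  have e10 : e n.+1 r @[r --> 0^'+] --> e n.+1 0.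
    rewrite e1E powR0 ?gt_eqF//; under eq_fun do rewrite e1E.
    by apply: cvgMr; exact: powR_cvg0.
  have bound (r : R) : 0 < r <= s -> `|- g * RL (beta - 1) d r| <= c * (m * r `^ (m - 1)).
    move=> /andP[r0 rs]; rewrite normrM normrN (ger0_norm g0).
    have [h1 h2] := RL_powR b10 q0 r0.
    have ie : RL_integrable (beta - 1) (e n) r by exact: RL_integrableZ.
    apply: (@le_trans _ _ (g * RL (beta - 1) (e n) r)).
      rewrite ler_wpM2l//; apply: RL_norm_le => // x /andP[x0 xr]; apply: IHn.
      by rewrite (ltW x0)/= (le_trans (ltW xr))// (le_trans rs).
    rewrite RLZ// h2.
    have mE : beta - 1 + (beta * n%:R + 1) = m.
      by rewrite /m -natr1 mulrDr mulr1; ring.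
    rewrite mE /c exprS /ml_coef -/m (GammaS m0).
    have G1 := lt0r_neq0 (Gamma_gt0 q0); have G2 := lt0r_neq0 (Gamma_gt0 m0).
    have m1 := lt0r_neq0 m0.
    have alg (G G' P T : R) : G != 0 -> G' != 0 ->
       g * (M * (P * G^-1) * (G / G' * T)) = M * (g * P * (m * G')^-1) * (m * T).
      by move=> h h'; field; rewrite ?h ?h' ?m1.
    by rewrite (alg _ _ _ _ G1 G2).
  (* The comparison is made for d and for - d, which both vanish at 0. *)
  have := @le_of_derive _ d (e n.+1) _ _ s s0 hd he1 d0' e10.
  have hNd (r : R) : 0 < r -> is_derive r 1 (- d) (- (- g * RL (beta - 1) d r)).
    by move=> r0; have := is_deriveN (hd r r0).
  have := @le_of_derive _ (- d) (e n.+1) _ _ s s0 hNd he1 _ e10.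
  rewrite !fctE d0 oppr0 e1E powR0 ?gt_eqF// mulr0 => h1 h2.
  rewrite ler_norml; apply/andP; split; last first.
    by apply: h2 => // r /bound; apply: le_trans; exact: ler_norm.
  rewrite lerNl; apply: h1 => //.
    by have h := cvgN d0'; rewrite d0 oppr0 in h; exact: h.
  by move=> r /bound; apply: le_trans; rewrite -normrN; exact: ler_norm.
apply/eqP; rewrite -normr_le0.
(* The bounds at time t are M times the terms of the series of E_beta at g t^beta, hence at most M K
   2^(- n). *)
have [K K0 hK] := @ml_coef_bound _ _ b1 1 (g * t `^ beta) ltr01 (mulr_ge0 g0 (powR_ge0 _ _)).
have lim : M * K * 2^-1 ^+ n @[n --> \oo] --> M * K * 0.
  apply: cvgMr; apply: cvg_expr; rewrite ger0_norm//; lra.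
rewrite mulr0 in lim; apply: (cvgr_to_ge lim); apply: nearW => n.
apply: le_trans (He n t _) _; first by rewrite lexx ltW.
rewrite /e addrK powRrM powR_mulrn ?powR_ge0// -!mulrA ler_wpM2l//.
by rewrite mulrCA -exprMn exprVn.
Qed.
End volterra_uniqueness.

(** * The scalar problem *)
Section scalar_problem.
Context {R : realType}.
Local Notation mu := (@lebesgue_measure R).
Local Notation RT := (measurableTypeR R).
Variable beta : R.
Hypotheses (beta1 : 1 < beta) (beta2 : beta < 2).
Implicit Types (f : R -> R) (t s a b g rho : R).
Local Notation mlf := (mlf beta).

Let beta0 : 0 < beta. Proof. exact: lt_trans beta1. Qed.
Let b10 : 0 < beta - 1. Proof. by rewrite subr_gt0. Qed.
Let b20 : 0 < 2 - beta. Proof. by rewrite subr_gt0. Qed.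

Lemma mlf_integrable rho g t : 0 < rho -> 0 <= g -> 0 < t ->
  mu.-integrable `]0, t[ (EFin \o mlf rho g) /\
  \int[mu]_(s in `]0, t[) mlf rho g s = mlf (rho + 1) g t.
Proof.
move=> r0 g0 t0; have [h1 h2] := RL_mlf beta1 ltr01 r0 g0 t0.
by split; [exact: RL1_integrable|rewrite -RL1].
Qed.

(** Integration of order 1 takes [mlf (rho - 1)] to [mlf rho], so the fundamental theorem of
    calculus suffices and no series is differentiated. *)
Lemma is_derive_mlf rho g t : 1 < rho -> 0 <= g -> 0 < t ->
  is_derive t 1 (mlf rho g) (mlf (rho - 1) g t).
Proof.
move=> r1 g0 t0; have r0 : 0 < rho - 1 by rewrite subr_gt0.
have hi s : 0 < s -> mu.-integrable `]0, s[ (EFin \o mlf (rho - 1) g).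
  by move=> s0; have [] := mlf_integrable r0 g0 s0.
have := is_derive_primitive t0 hi (continuous_mlf beta1 r0 t0).
apply: near_eq_is_derive; near=> s.
have s0 : 0 < s by near: s; exact: lt_nbhsr.
by have [_ ->] := mlf_integrable r0 g0 s0; rewrite subrK.
Unshelve. all: end_near. Qed.

Lemma cvg_mlf_arg g : - (g * s `^ beta) @[s --> 0^'+] --> - (g * 0).
Proof. by apply: cvgN; apply: cvgMr; exact: powR_cvg0. Qed.

Lemma cvg_ml_right0 rho g : 0 < rho ->
  ml beta rho (- (g * s `^ beta)) @[s --> 0^'+] --> (Gamma rho)^-1.
Proof.
move=> r0; rewrite -(ml0 beta1 r0).
have := @cvg_mlf_arg g; rewrite mulr0 oppr0 => h.
exact: (cvg_comp _ _ h (@continuous_ml _ _ beta1 rho r0 0)).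
Qed.

Lemma cvg_mlf_right0 rho g : 1 < rho -> mlf rho g s @[s --> 0^'+] --> 0.
Proof.
move=> r1; have r0 : 0 < rho by exact: lt_trans r1.
rewrite mlf_funE -[X in _ --> X](mul0r (Gamma rho)^-1); apply: cvgM; last exact: cvg_ml_right0.
by apply: powR_cvg0; rewrite subr_gt0.
Qed.

Lemma mlf_at0 rho g : 1 < rho -> mlf rho g 0 = 0.
Proof. by move=> r1; rewrite !mlfE powR0 ?mul0r// subr_eq0 gt_eqF. Qed.

Lemma mlf1_at0 g : mlf 1 g 0 = 1.
Proof. by rewrite !mlfE subrr powRr0 mul1r powR0 ?gt_eqF// mulr0 oppr0 ml0// Gamma1 invr1. Qed.

Lemma cvg_mlf1_right0 g : mlf 1 g s @[s --> 0^'+] --> (1 : R).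
Proof.
have := @cvg_ml_right0 1 g ltr01; rewrite Gamma1 invr1; apply: cvg_trans.
apply: near_eq_cvg; near=> s.
by rewrite !mlfE subrr powRr0 mul1r.
Unshelve. all: end_near. Qed.

Section solution.
Variables (g a b : R) (f : R -> R).
Hypotheses (g0 : 0 <= g)
  (fE : forall t, 0 <= t -> f t = a * mlf 1 g t + b * mlf 2 g t).

Let fp t := b - g * (a * mlf beta g t + b * mlf (1 + beta) g t).
Let fpp t := - g * (a * mlf (beta - 1) g t + b * mlf beta g t).

Let f0 : f 0 = a.
Proof. by rewrite fE// mlf1_at0 mlf_at0 ?ltr1n// mulr1 mulr0 addr0. Qed.

Let Gamma2 : Gamma 2 = 1 :> R.
Proof. by rewrite (_ : 2 = 1 + 1)// GammaS// Gamma1 mulr1. Qed.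

(** [is_derive_mlf] does not apply at rho = 1, where it would produce rho = 0. Peeling the first
    term off both series raises rho by beta, after which f can be differentiated twice. *)
Let fE2 t : 0 < t -> f t = a + b * t - g * (a * mlf (1 + beta) g t + b * mlf (2 + beta) g t).
Proof.
move=> t0; rewrite fE ?ltW// (@mlf_rec _ _ beta1 1)// (@mlf_rec _ _ beta1 2)//.
rewrite Gamma1 Gamma2 subrr powRr0 (_ : 2 - 1 = 1); last by ring.
rewrite powRr1 ?ltW// !divr1.
move: (mlf (1 + beta) g t) (mlf (2 + beta) g t) => X Y; ring.
Qed.

Let derive_f t : 0 < t -> is_derive t 1 f (fp t).
Proof.
move=> t0.
have h1 : is_derive t 1 (mlf (1 + beta) g) (mlf beta g t).
  have lt1 : 1 < 1 + beta by rewrite ltrDl.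
  by have := is_derive_mlf lt1 g0 t0; rewrite (_ : 1 + beta - 1 = beta)// addrC addKr.
have h2 : is_derive t 1 (mlf (2 + beta) g) (mlf (1 + beta) g t).
  have lt1 : 1 < 2 + beta by rewrite ltr_wpDr ?ltr1n// ltW.
  have := is_derive_mlf lt1 g0 t0; rewrite (_ : 2 + beta - 1 = 1 + beta)//; ring.
have h3 : is_derive t 1
    (fun t => a + b * t - g * (a * mlf (1 + beta) g t + b * mlf (2 + beta) g t)) (fp t).
  rewrite /fp; move: h1 h2.
  move: (mlf beta g) (mlf (1 + beta) g) (mlf (2 + beta) g) => X U V h1 h2.
  apply: is_derive_eq; rewrite /GRing.scale/=; ring.
apply: near_eq_is_derive h3; near=> s.
by rewrite fE2//; near: s; exact: lt_nbhsr.
Unshelve. all: end_near. Qed.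

Let derive_fp t : 0 < t -> is_derive t 1 fp (fpp t).
Proof.
move=> t0.
have h1 : is_derive t 1 (mlf beta g) (mlf (beta - 1) g t) by exact: is_derive_mlf.
have h2 : is_derive t 1 (mlf (1 + beta) g) (mlf beta g t).
  have lt1 : 1 < 1 + beta by rewrite ltrDl.
  by have := is_derive_mlf lt1 g0 t0; rewrite (_ : 1 + beta - 1 = beta)// addrC addKr.
rewrite /fp /fpp; move: h1 h2.
move: (mlf beta g) (mlf (beta - 1) g) (mlf (1 + beta) g) => X U V h1 h2.
apply: is_derive_eq; rewrite /GRing.scale/=; ring.
Qed.

Let derive1f t : 0 < t -> derive1 f t = fp t.
Proof. by move=> t0; rewrite derive1E; have [_ ->] := derive_f t0. Qed.

Let derive1n2f t : 0 < t -> derive1n 2 f t = fpp t.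
Proof.
move=> t0; rewrite /derive1n/= derive1E.
have := derive_fp t0 => h.
have : is_derive t 1 (derive1 f) (fpp t).
  apply: near_eq_is_derive h; near=> s.
  by rewrite derive1f//; near: s; exact: lt_nbhsr.
by move=> [_ ->].
Unshelve. all: end_near. Qed.

(** Order q = 1 recovers f' - b from f''; order q = 2 - beta turns f'' into - g f, which is the
    equation itself. *)
Let fpp_RL q t : 0 < q -> 0 < t ->
  RL_integrable q (derive1n 2 f) t /\
  RL q (derive1n 2 f) t = - g * (a * mlf (beta - 1 + q) g t + b * mlf (beta + q) g t).
Proof.
move=> q0 t0; have E s : 0 < s < t -> fpp s = derive1n 2 f s.
  by move=> /andP[s0 _]; rewrite derive1n2f.
have [h1 h1'] := RL_mlf beta1 q0 b10 g0 t0.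
have [h2 h2'] := RL_mlf beta1 q0 beta0 g0 t0.
have i1 := RL_integrableZ a h1; have i2 := RL_integrableZ b h2.
split.
  by apply: (@eq_RL_integrable _ q _ _ t E); apply: RL_integrableZ; exact: RL_integrableD.
rewrite -(@eq_RL _ q _ _ t E) /fpp (RLZ _ (RL_integrableD i1 i2)).
rewrite (RLD i1 i2).
rewrite [X in X + _](RLZ a h1).
rewrite [X in _ + X](RLZ b h2).
by rewrite h1' h2'.
Qed.

Lemma mlf_caputo_regular : caputo_regular b f.
Proof.
split.
- apply: (within_0y_continuous derive_f); rewrite f0.
  have : a * mlf 1 g t + b * mlf 2 g t @[t --> 0^'+] --> a * 1 + b * 0.
    apply: cvgD; apply: cvgMr; first exact: cvg_mlf1_right0.
    by apply: cvg_mlf_right0; rewrite ltr1n.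
  rewrite mulr1 mulr0 addr0; apply: cvg_trans; apply: near_eq_cvg.
  near=> t; rewrite fE// ltW//; near: t; exact: nbhs_right_gt.
(* In the difference quotient at 0, one factor t cancels against the powers of t in [fE2]; the
   remaining exponents beta - 1 and beta are positive, so only b survives in the limit. *)
- have : b - g * (a * (t `^ (1 + beta - 1 - 1) * ml beta (1 + beta) (- (g * t `^ beta)))
        + b * (t `^ (2 + beta - 1 - 1) * ml beta (2 + beta) (- (g * t `^ beta)))) @[t --> 0^'+]
       --> b - g * (a * (0 * (Gamma (1 + beta))^-1) + b * (0 * (Gamma (2 + beta))^-1)).
    apply: cvgB; first exact: cvg_cst.
    apply: cvgMr; apply: cvgD; apply: cvgMr; apply: cvgM.
    - by apply: powR_cvg0; rewrite [1 + beta]addrC addrK subr_gt0.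
    - by apply: cvg_ml_right0; rewrite addr_gt0.
    - by apply: powR_cvg0; rewrite (_ : 2 + beta - 1 - 1 = beta)//; ring.
    - by apply: cvg_ml_right0; rewrite addr_gt0.
  rewrite !mul0r !mulr0 addr0 mulr0 subr0; apply: cvg_trans; apply: near_eq_cvg.
  near=> t; have t0 : 0 < t by near: t; exact: nbhs_right_gt.
  rewrite f0 fE2// !mlfE.
  have E r : t `^ (r - 1) = t * t `^ (r - 1 - 1).
    by rewrite -{2}(powRr1 (ltW t0)) -gt0_powRD//; congr (_ `^ _); ring.
  rewrite (E (1 + beta)) (E (2 + beta)).
  move: (t `^ (1 + beta - 1 - 1)) (t `^ (2 + beta - 1 - 1)) => X Y.
  move: (ml _ _ _) (ml _ _ _) => U V.
  by field; rewrite gt_eqF.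
- by move=> t t0; have [] := derive_f t0.
- by move=> t t0; have [/RL1_integrable] := fpp_RL ltr01 t0.
- move=> t t0; have [_] := fpp_RL ltr01 t0.
  rewrite RL1 => ->; rewrite derive1f// subrK /fp (addrC beta 1).
  by rewrite mulNr.
Unshelve. all: end_near. Qed.

Lemma mlf_real_scalar_solution : real_scalar_solution beta g a b f.
Proof.
have E : 2 - beta - 1 = 1 - beta by ring.
split; first exact: mlf_caputo_regular.
- exact: f0.
- move=> t t0; have [+ _] := fpp_RL b20 t0.
  by rewrite /RL_integrable E.
- move=> t t0; have [_] := fpp_RL b20 t0; rewrite RLE E /caputo /caputo_integrand => ->.
  rewrite (_ : beta - 1 + (2 - beta) = 1); last by ring.
  rewrite (_ : beta + (2 - beta) = 2); last by ring.
  by rewrite fE ?ltW// mulNr addNr.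
Qed.
End solution.

(** The Caputo derivative is I^(2 - beta) f'', and the orders beta - 1 and 2 - beta add up to 1:
    applying I^(beta - 1) leaves the plain integral of f'', that is f' - b. *)
Lemma real_scalar_solution_volterra g a b f : real_scalar_solution beta g a b f ->
  forall t, 0 < t -> is_derive t 1 f (b - g * RL (beta - 1) f t).
Proof.
have E : 1 - beta = 2 - beta - 1 by ring.
move=> [[cf _ df i2 hf] f0 ic eqc] t t0; apply: DeriveDef; first exact: df.
rewrite -derive1E hf//.
have iq s : 0 < s -> RL_integrable (2 - beta) (derive1n 2 f) s.
  by move=> s0; have := ic s s0; rewrite /caputo_integrand E.
have pq : beta - 1 + (2 - beta) = 1 by ring.
rewrite -(RL_semigroup1 b10 b20 pq (i2 t t0) iq).
have E2 s : 0 < s < t -> RL (2 - beta) (derive1n 2 f) s = - g * f s.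
  move=> /andP[s0 _]; have := eqc s s0; rewrite /caputo /caputo_integrand E -RLE.
  by move/eqP; rewrite addr_eq0 => /eqP ->; rewrite mulNr.
rewrite (@eq_RL _ _ _ _ t E2) RLZ ?mulNr//; exact: RL_integrable_continuous.
Qed.

Lemma real_scalar_solution_unique g a b f1 f2 : 0 <= g ->
  real_scalar_solution beta g a b f1 -> real_scalar_solution beta g a b f2 ->
  forall t, 0 <= t -> f1 t = f2 t.
Proof.
move=> g0 h1 h2 t t0; apply/eqP; rewrite -subr_eq0; apply/eqP.
have d1 := real_scalar_solution_volterra h1; have d2 := real_scalar_solution_volterra h2.
have [[c1 _ _ _ _] z1 _ _] := h1; have [[c2 _ _ _ _] z2 _ _] := h2.
have cd : {within `[0, +oo[, continuous (fun t => f1 t - f2 t)}.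
  by move=> x; apply: cvgB; [exact: c1|exact: c2].
apply: (volterra_unique beta1 g0 cd) => //; first by rewrite z1 z2 subrr.
move=> s s0; have := is_deriveB (d1 s s0) (d2 s s0).
move=> h; apply: is_derive_eq h _.
have i1 := RL_integrable_continuous b10 s0 c1.
have i2 := RL_integrable_continuous b10 s0 c2.
have -> : RL (beta - 1) (fun t => f1 t - f2 t) s = RL (beta - 1) f1 s - RL (beta - 1) f2 s.
  rewrite -[X in _ = _ + X]mulN1r -(RLZ (-1) i2) -(RLD i1 (RL_integrableZ (-1) i2)).
  by apply: eq_RL => r _; rewrite mulN1r.
move: (RL _ f1 s) (RL _ f2 s) => X Y; ring.
Qed.
End scalar_problem.

(** * Rotation of the ray of integration *)
Section complex_tools.
Context {R : realType}.
Implicit Types (z w : R[i]) (x y p q r s t phi c : R).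

Lemma ReD z w : complex.Re (z + w) = complex.Re z + complex.Re w.
Proof. by case: z; case: w. Qed.
Lemma ImD z w : complex.Im (z + w) = complex.Im z + complex.Im w.
Proof. by case: z; case: w. Qed.
Lemma ReN z : complex.Re (- z) = - complex.Re z. Proof. by case: z. Qed.
Lemma ImN z : complex.Im (- z) = - complex.Im z. Proof. by case: z. Qed.
Lemma ReM z w : complex.Re (z * w) =
  complex.Re z * complex.Re w - complex.Im z * complex.Im w.
Proof. by case: z; case: w. Qed.
Lemma ImM z w : complex.Im (z * w) =
  complex.Re z * complex.Im w + complex.Im z * complex.Re w.
Proof. by case: z; case: w. Qed.
Lemma Re_realM x z : complex.Re (x%:C%C * z) = x * complex.Re z.
Proof. by rewrite ReM /= mul0r subr0. Qed.
Lemma Im_realM x z : complex.Im (x%:C%C * z) = x * complex.Im z.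
Proof. by rewrite ImM /= mul0r addr0. Qed.
Lemma ReV z : complex.Re z^-1 =
  complex.Re z / (complex.Re z ^+ 2 + complex.Im z ^+ 2).
Proof. by case: z. Qed.
Lemma ImV z : complex.Im z^-1 =
  - complex.Im z / (complex.Re z ^+ 2 + complex.Im z ^+ 2).
Proof. by case: z => a b /=; rewrite mulNr. Qed.

Definition cis x : R[i] := Complex (cos x) (sin x).

Lemma cisD x y : cis (x + y) = cis x * cis y.
Proof. by apply/eqP; rewrite eq_complex ReM ImM /= cosD sinD (addrC (cos x * sin y)) !eqxx. Qed.

Lemma cis0 : cis 0 = 1.
Proof. by rewrite /cis cos0 sin0. Qed.

Lemma normcE2 z : Normc.normc z = Num.sqrt (complex.Re z ^+ 2 + complex.Im z ^+ 2).
Proof. by case: z. Qed.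

Lemma normc_ge0 z : 0 <= Normc.normc z.
Proof. by rewrite normcE2 sqrtr_ge0. Qed.

Lemma normc_cis x : Normc.normc (cis x) = 1.
Proof. by rewrite normcE2 /= cos2Dsin2 sqrtr1. Qed.

Lemma normc_real x : Normc.normc (x%:C)%C = `|x|.
Proof. by rewrite normcE2 /= expr0n addr0 sqrtr_sqr. Qed.

Lemma Re_le_normc z : `|complex.Re z| <= Normc.normc z.
Proof. by rewrite normcE2 -sqrtr_sqr ler_sqrt ?addr_ge0 ?sqr_ge0// lerDl sqr_ge0. Qed.

Lemma Im_le_normc z : `|complex.Im z| <= Normc.normc z.
Proof. by rewrite normcE2 -sqrtr_sqr ler_sqrt ?addr_ge0 ?sqr_ge0// lerDr sqr_ge0. Qed.

Lemma normc_eq0 z : (Normc.normc z == 0) = (z == 0).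
Proof.
apply/eqP/eqP => [|->]; first exact: Normc.eq0_normc.
by rewrite normcE2 /= expr0n addr0 sqrtr0.
Qed.

Lemma normc_gt0 z : (0 < Normc.normc z) = (z != 0).
Proof. by rewrite lt_def normc_eq0 normc_ge0 andbT. Qed.

(* [polar p r phi] is [lambda^p] for [lambda = r e^(i phi)]. *)
Definition polar p r phi : R[i] := ((r `^ p)%:C)%C * cis (p * phi).

Lemma normc_polar p r phi : Normc.normc (polar p r phi) = r `^ p.
Proof. by rewrite Normc.normcM normc_real normc_cis mulr1 ger0_norm// powR_ge0. Qed.

Lemma polarD p q r phi : 0 < r -> polar (p + q) r phi = polar p r phi * polar q r phi.
Proof.
by move=> r0; rewrite /polar gt0_powRD// mulrDl cisD rmorphM mulrACA.
Qed.

Lemma polar_phi0 p r : polar p r 0 = ((r `^ p)%:C)%C.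
Proof. by rewrite /polar mulr0 cis0 mulr1. Qed.

Lemma polar0 r phi : polar 0 r phi = 1.
Proof. by rewrite /polar mul0r cis0 powRr0 mulr1. Qed.

Lemma polar1 r phi : 0 <= r -> polar 1 r phi = (r%:C)%C * cis phi.
Proof. by move=> r0; rewrite /polar mul1r powRr1. Qed.

(** The constant is cos (A / 2). With x = r^p and psi = p phi, |x e^(i psi) + c|^2 - cos^2 (A / 2)
    (x + c)^2 = sin^2 (A / 2) (x - c)^2 + 2 x c (cos psi - cos A), which is nonnegative for |psi| <=
    A. For A < pi this keeps the denominators lambda^p + c away from 0 uniformly in a sector. *)
Lemma normc_polarD p r phi c (A : R) : 0 <= c -> 0 <= A <= pi -> `|p * phi| <= A ->
  Num.sqrt ((1 + cos A) / 2) * (r `^ p + c) <= Normc.normc (polar p r phi + (c%:C)%C).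
Proof.
move=> c0 /andP[A0 Api] pA; set x := r `^ p; have x0 : 0 <= x by exact: powR_ge0.
have hc : cos A <= cos (p * phi).
  have [h|h] := leP 0 (p * phi).
    rewrite (ger0_norm h) in pA; rewrite leNgt ltr_cos ?in_itv/= ?h ?A0 ?Api ?(le_trans pA)//.
    by rewrite -leNgt.
  rewrite (ltr0_norm h) in pA; rewrite -(cosN (p * phi)) leNgt.
  rewrite ltr_cos ?in_itv/= ?A0 ?Api ?(le_trans pA)// ?oppr_ge0 ?(ltW h)//.
  by rewrite -leNgt.
have cA : -1 <= cos A by exact: cos_geN1.
rewrite normcE2 ReD ImD /polar ReM ImM /= !mul0r subr0 addr0 !addr0.
rewrite -[x + c](ger0_norm (addr_ge0 x0 c0)) -sqrtr_sqr -sqrtrM; last by rewrite divr_ge0//; lra.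
rewrite ler_wsqrtr// -/x.
have cs := cos2Dsin2 (p * phi).
rewrite -subr_ge0.
have -> : (x * cos (p * phi) + c) ^+ 2 + (x * sin (p * phi)) ^+ 2 -
    (1 + cos A) / 2 * (x + c) ^+ 2 =
    (1 - cos A) / 2 * (x - c) ^+ 2 + 2 * (x * c) * (cos (p * phi) - cos A).
  have -> : (x * cos (p * phi) + c) ^+ 2 + (x * sin (p * phi)) ^+ 2 =
     x ^+ 2 * (cos (p * phi) ^+ 2 + sin (p * phi) ^+ 2) + 2 * (x * c) * cos (p * phi) + c ^+ 2.
    by ring.
  by rewrite cs; field.
have cA1 : cos A <= 1 by exact: cos_le1.
by rewrite addr_ge0// mulr_ge0 ?sqr_ge0 ?subr_ge0 ?divr_ge0 ?subr_ge0// ?mulr_ge0.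
Qed.

Definition is_cder (f : R -> R[i]) x (df : R[i]) : Prop :=
  is_derive x 1 (fun x => complex.Re (f x)) (complex.Re df) /\
  is_derive x 1 (fun x => complex.Im (f x)) (complex.Im df).

Lemma cder_eq f x df df' : is_cder f x df -> df = df' -> is_cder f x df'.
Proof. by move=> h <-. Qed.

Lemma cder_cst z x : is_cder (fun=> z) x 0.
Proof. by split; exact: is_derive_cst. Qed.

Lemma cderD f g x df dg : is_cder f x df -> is_cder g x dg ->
  is_cder (fun x => f x + g x) x (df + dg).
Proof.
move=> [f1 f2] [g1 g2]; split.
  rewrite (_ : (fun x => _) = (fun x => complex.Re (f x) + complex.Re (g x))).
    by apply: is_derive_eq; rewrite ReD.
  by apply/funext => ?; rewrite ReD.
rewrite (_ : (fun x => _) = (fun x => complex.Im (f x) + complex.Im (g x))).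
  by apply: is_derive_eq; rewrite ImD.
by apply/funext => ?; rewrite ImD.
Qed.

Lemma cderM f g x df dg : is_cder f x df -> is_cder g x dg ->
  is_cder (fun x => f x * g x) x (df * g x + f x * dg).
Proof.
move=> [f1 f2] [g1 g2]; split.
  rewrite (_ : (fun x => _) = (fun x => complex.Re (f x) * complex.Re (g x) -
      complex.Im (f x) * complex.Im (g x))); last by apply/funext => ?; rewrite ReM.
  by apply: is_derive_eq; rewrite /GRing.scale/= ReD !ReM; ring.
rewrite (_ : (fun x => _) = (fun x => complex.Re (f x) * complex.Im (g x) +
    complex.Im (f x) * complex.Re (g x))); last by apply/funext => ?; rewrite ImM.
by apply: is_derive_eq; rewrite /GRing.scale/= ImD !ImM; ring.
Qed.

Lemma cderV f x df : f x != 0 -> is_cder f x df ->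
  is_cder (fun x => (f x)^-1) x (- (f x)^-1 ^+ 2 * df).
Proof.
move=> fx0 [f1 f2].
have n0 : complex.Re (f x) ^+ 2 + complex.Im (f x) ^+ 2 != 0.
  move: fx0; apply: contraNneq => h; rewrite -normc_eq0 normcE2 h sqrtr0//.
split.
  rewrite (_ : (fun x => _) = (fun x => complex.Re (f x) *
      (complex.Re (f x) ^+ 2 + complex.Im (f x) ^+ 2)^-1)); last first.
    by apply/funext => ?; rewrite ReV.
  have hV := @is_deriveV _ (fun x => complex.Re (f x) ^+ 2 + complex.Im (f x) ^+ 2) x _ 1 n0 _.
  apply: is_derive_eq.
  rewrite /GRing.scale/= expr2 !ReM !ReN !ImN !ReM !ImM !ReV !ImV.
  by move: n0; move: (complex.Re (f x)) (complex.Im (f x)) => a b n0; field.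
rewrite (_ : (fun x => _) = (fun x => - complex.Im (f x) *
    (complex.Re (f x) ^+ 2 + complex.Im (f x) ^+ 2)^-1)); last first.
  by apply/funext => ?; rewrite ImV.
have hV := @is_deriveV _ (fun x => complex.Re (f x) ^+ 2 + complex.Im (f x) ^+ 2) x _ 1 n0 _.
apply: is_derive_eq.
rewrite /GRing.scale/= expr2 !ImM !ReN !ImN !ReM !ImM !ReV !ImV.
by move: n0; move: (complex.Re (f x)) (complex.Im (f x)) => a b n0; field.
Qed.

Lemma cder_polar_phi p r phi :
  is_cder (polar p r) phi (Complex 0 p * polar p r phi).
Proof.
split.
  rewrite (_ : (fun x => _) = (fun x => r `^ p * cos (p * x))); last first.
    by apply/funext => ?; rewrite /polar ReM /= mul0r subr0.
  by apply: is_derive_eq; rewrite /polar !ReM !ImM /= /GRing.scale/=; ring.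
rewrite (_ : (fun x => _) = (fun x => r `^ p * sin (p * x))); last first.
  by apply/funext => ?; rewrite /polar ImM /= mul0r addr0.
by apply: is_derive_eq; rewrite /polar !ImM !ReM /= /GRing.scale/=; ring.
Qed.

Lemma cder_polar_r p r phi : 0 < r ->
  is_cder (fun r => polar p r phi) r (((p / r)%:C)%C * polar p r phi).
Proof.
move=> r0; have h := @is_derive1_powR _ p r r0.
have rp : r `^ (p - 1) = r `^ p / r by rewrite gt0_powRD// powR_inv1// ltW.
split.
  rewrite (_ : (fun x => _) = (fun x => x `^ p * cos (p * phi))); last first.
    by apply/funext => ?; rewrite /polar ReM /= mul0r subr0.
  by apply: is_derive_eq; rewrite /polar !ReM !ImM /= rp /GRing.scale/=; ring.
rewrite (_ : (fun x => _) = (fun x => x `^ p * sin (p * phi))); last first.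
  by apply/funext => ?; rewrite /polar ImM /= mul0r addr0.
by apply: is_derive_eq; rewrite /polar !ImM !ReM /= rp /GRing.scale/=; ring.
Qed.
End complex_tools.

Section complex_measurability.
Context d (T : measurableType d) (R : realType).
Implicit Types f g : T -> R[i].

Definition cmeas f : Prop :=
  measurable_fun setT (fun x => complex.Re (f x)) /\
  measurable_fun setT (fun x => complex.Im (f x)).

Lemma cmeasD f g : cmeas f -> cmeas g -> cmeas (fun x => f x + g x).
Proof.
move=> [f1 f2] [g1 g2]; split.
  by under eq_fun do rewrite ReD; exact: measurable_funD.
by under eq_fun do rewrite ImD; exact: measurable_funD.
Qed.

Lemma cmeasM f g : cmeas f -> cmeas g -> cmeas (fun x => f x * g x).
Proof.
move=> [f1 f2] [g1 g2]; split.
  by under eq_fun do rewrite ReM; apply: measurable_funB; exact: measurable_funM.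
by under eq_fun do rewrite ImM; apply: measurable_funD; exact: measurable_funM.
Qed.

Lemma cmeasV f : cmeas f -> cmeas (fun x => (f x)^-1).
Proof.
move=> [f1 f2]; split.
  by under eq_fun do rewrite ReV expr2 expr2; meas.
by under eq_fun do rewrite ImV expr2 expr2; meas.
Qed.

Lemma cmeas_real (h : T -> R) : measurable_fun setT h -> cmeas (fun x => ((h x)%:C)%C).
Proof. by move=> mh; split => //=; exact: measurable_cst. Qed.

Lemma cmeas_cst (z : R[i]) : cmeas (fun=> z).
Proof. by split; exact: measurable_cst. Qed.

Lemma cmeas_cis (h : T -> R) : measurable_fun setT h -> cmeas (fun x => cis (h x)).
Proof. by move=> mh; split => /=; meas. Qed.

Lemma cmeas_polar (p phi : R) (h : T -> R) : measurable_fun setT h ->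
  cmeas (fun x => polar p (h x) phi).
Proof.
move=> mh; apply: cmeasM; first by apply: cmeas_real; meas.
by apply: cmeas_cst.
Qed.
End complex_measurability.

Ltac cmeas_tac := repeat first
  [ assumption | apply: cmeas_cst | apply: cmeas_polar | apply: cmeasD
  | apply: cmeasV | apply: cmeasM | apply: cmeas_real | apply: cmeas_cis ].

Section under_integral.
Context {R : realType}.
Local Notation mu := (@lebesgue_measure R).
Local Notation RT := (measurableTypeR R).
Implicit Types (D : set RT).

Lemma is_derive_under D (f df : R -> R -> R) (G : R -> R) (a u v : R) :
  measurable D -> u < a < v ->
  (forall x, u < x < v -> mu.-integrable D (EFin \o f x)) ->
  (forall x y, u < x < v -> D y -> is_derive x 1 (f^~ y) (df x y)) ->
  (forall y, 0 <= G y) -> mu.-integrable D (EFin \o G) ->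
  (forall x y, u < x < v -> D y -> `|df x y| <= G y) ->
  is_derive a 1 (fun x => \int[mu]_(y in D) f x y) (\int[mu]_(y in D) df a y).
Proof.
move=> mD auv fi fd G0 Gi Gd.
have Ia : `]u, v[%classic a by rewrite /= in_itv.
have E x y : u < x < v -> D y -> partial1of2 f x y = df x y.
  by move=> xuv Dy; rewrite partial1of2E; have h := fd _ _ xuv Dy; rewrite derive_val.
have c1 x : `]u, v[%classic x -> mu.-integrable D (EFin \o f x).
  by rewrite /= in_itv; exact: fi.
have c2 x y : `]u, v[%classic x -> D y -> derivable (f^~ y) x 1.
  by rewrite /= in_itv => h Dy; have [] := fd _ _ h Dy.
have c3 x y : `]u, v[%classic x -> D y -> `|partial1of2 f x y| <= G y.
  by rewrite /= in_itv => h Dy; rewrite E// Gd.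
have d1 := differentiation_under_integral mD Ia c1 c2 G0 Gi c3.
have d2 := @derivable_under_integral R _ RT mu f D mD a u v Ia c1 c2 G G0 Gi c3.
apply: DeriveDef; first exact: d2.
rewrite -derive1E d1; apply: eq_Rintegral => y /set_mem Dy.
exact: E.
Qed.

Lemma is_derive_0_itv (f : R -> R) (a b x y : R) :
  (forall z, a < z < b -> is_derive z 1 f 0) -> a < x < b -> a < y < b -> f x = f y.
Proof.
move=> fd.
wlog xy : x y / x < y.
  move=> h hx hy; have [xy|xy|->//] := ltgtP x y; first exact: h.
  by apply/esym; exact: h.
move=> /andP[ax xb] /andP[ay yb].
have sub z : x <= z <= y -> a < z < b by move=> /andP[? ?]; apply/andP; split; lra.
have h1 z : z \in `]x, y[%R -> is_derive z 1 f 0.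
  by rewrite in_itv/= => /andP[? ?]; apply: fd; apply: sub; rewrite !ltW.
have h2 : {within `[x, y], continuous f}.
  apply: derivable_within_continuous => z; rewrite in_itv/= => h.
  by have [] := fd _ (sub _ h).
have [z _] := @MVT _ f (fun=> 0) x y xy h1 h2.
by rewrite mul0r => /eqP; rewrite subr_eq0 => /eqP.
Qed.
End under_integral.

Section rotation.
Context {R : realType}.
Local Notation mu := (@lebesgue_measure R).
Local Notation RT := (measurableTypeR R).

Lemma powR_div1D_integrable (q : R) : 0 < q -> q < 1 ->
  mu.-integrable `]0, +oo[ (EFin \o (fun r : R => r `^ (q - 1) / (1 + r))).
Proof.
move=> q0 q1.
have h := @ge0_integral_stieltjes R q 1 q0 q1 ltr01.
apply: (ge0_integrable_Rintegral _ _ _ h).1; first exact: measurable_itv.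
  by meas.
move=> x; rewrite /= in_itv/= andbT => x0.
by rewrite divr_ge0 ?powR_ge0// addr_ge0// ltW.
Qed.

Lemma powR_div1D_right0 (q : R) : 0 < q -> r `^ q / (1 + r) @[r --> 0^'+] --> (0 : R).
Proof.
move=> q0; apply: (@squeeze_cvgr _ _ _ _ (fun=> 0) (fun r => r `^ q)).
- near=> r; have r0 : 0 < r by near: r; exact: nbhs_right_gt.
  rewrite divr_ge0 ?powR_ge0 ?addr_ge0 ?(ltW r0)//=.
  by rewrite ler_pdivrMr ?ler_peMr ?powR_ge0 ?lerDl ?(ltW r0)// addr_gt0.
- exact: cvg_cst.
- exact: powR_cvg0.
Unshelve. all: end_near. Qed.

Lemma powRN_cvgy (p : R) : 0 < p -> r `^ (- p) @[r --> +oo] --> (0 : R).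
Proof.
move=> p0; apply/cvgr0Pnorm_le => e e0; near=> r.
have r0 : 0 < r by near: r; exact: nbhs_pinfty_gt.
rewrite ger0_norm ?powR_ge0// powRN invf_ple ?posrE ?powR_gt0//.
have E : e^-1 = ((e^-1) `^ p^-1) `^ p by rewrite -powRrM mulVf ?powRr1 ?gt_eqF// invr_ge0 ltW.
rewrite E; apply: ge0_ler_powR; rewrite ?nnegrE ?powR_ge0 ?(ltW p0) ?(ltW r0)//.
Unshelve. all: end_near. Qed.

Lemma powR_div1D_y (q : R) : q < 1 -> r `^ q / (1 + r) @[r --> +oo] --> (0 : R).
Proof.
move=> q1; apply: (@squeeze_cvgr _ _ _ _ (fun=> 0) (fun r => r `^ (- (1 - q)))).
- near=> r; have r0 : 0 < r by near: r; exact: nbhs_pinfty_gt.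
  have r10 : 0 < 1 + r by rewrite addr_gt0.
  rewrite divr_ge0 ?powR_ge0 ?(ltW r10)//= ler_pdivrMr//.
  have -> : r `^ q = r `^ (- (1 - q)) * r.
    by rewrite -{3}[r]powRr1 ?(ltW r0)// -gt0_powRD//; congr powR; ring.
  by rewrite ler_wpM2l ?powR_ge0// lerDr.
- exact: cvg_cst.
- by apply: powRN_cvgy; rewrite subr_gt0.
Unshelve. all: end_near. Qed.

Lemma le_normc_powR_div1D_cvg0 (F : set_system R) {FF : Filter F} (h : R -> R[i]) (g : R -> R) (C : R) :
  (\forall r \near F, Normc.normc (h r) <= C * g r) -> g r @[r --> F] --> 0 ->
  complex.Re (h r) @[r --> F] --> 0 /\ complex.Im (h r) @[r --> F] --> 0.
Proof.
move=> hC g0; have Cg0 : C * g r @[r --> F] --> 0.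
  by rewrite -[X in _ --> X](mulr0 C); apply: cvgMr.
have Cg0' : - (C * g r) @[r --> F] --> 0 by rewrite -[X in _ --> X]oppr0; apply: cvgN.
split; apply: squeeze_cvgr Cg0' Cg0; near=> r; rewrite -ler_norml.
  apply: le_trans (Re_le_normc _) _; near: r; exact: hC.
apply: le_trans (Im_le_normc _) _; near: r; exact: hC.
Unshelve. all: end_near. Qed.

Section family.
(** For h holomorphic in lambda = r e^(i phi), [dh] stands for lambda h'(lambda), and the two
    derivatives below are the Cauchy-Riemann equations in polar form. The majorant r^q / (1 + r)
    vanishes at both ends of the ray and is integrable against dr / r. *)
Variables (h dh : R -> R -> R[i]) (Th C q : R).
Hypotheses (q0 : 0 < q) (q1 : q < 1) (C0 : 0 <= C)
  (h_phi : forall r phi, 0 < r -> `|phi| < Th -> is_cder (h r) phi (Complex 0 1 * dh r phi))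
  (h_r : forall r phi, 0 < r -> `|phi| < Th -> is_cder (h^~ phi) r ((r^-1)%:C%C * dh r phi))
  (dh_r : forall r phi, 0 < r -> `|phi| < Th -> exists d, is_cder (dh^~ phi) r d)
  (mh : forall phi, cmeas (h^~ phi)) (mdh : forall phi, cmeas (dh^~ phi))
  (hC : forall r phi, 0 < r -> `|phi| < Th -> Normc.normc (h r phi) <= C * (r `^ q / (1 + r)))
  (dhC : forall r phi, 0 < r -> `|phi| < Th -> Normc.normc (dh r phi) <= C * (r `^ q / (1 + r))).

Let dom r : R := C * (r `^ (q - 1) / (1 + r)).

Let dom_integrable : mu.-integrable `]0, +oo[ (EFin \o dom).
Proof. by apply: integrableRZ; [exact: measurable_itv|exact: powR_div1D_integrable]. Qed.

Let le_dom r z : 0 < r -> Normc.normc z <= C * (r `^ q / (1 + r)) ->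
  `|complex.Re z / r| <= dom r /\ `|complex.Im z / r| <= dom r.
Proof.
move=> r0 hz.
have E : dom r = C * (r `^ q / (1 + r)) / r.
  rewrite /dom gt0_powRD// powR_inv1 ?(ltW r0)//.
  by move: (r `^ q) => u; ring.
by rewrite E !normrM (gtr0_norm (_ : 0 < r^-1)) ?invr_gt0// !ler_pM2r ?invr_gt0//;
  split; apply: le_trans hz; [exact: Re_le_normc|exact: Im_le_normc].
Qed.

(** The integrand is the radial derivative of Im h, which tends to 0 at both ends of the ray. *)
Let Im_dh_integral phi : `|phi| < Th ->
  \int[mu]_(r in `]0, +oo[) (complex.Im (dh r phi) / r) = 0.
Proof.
move=> phiT; rewrite -[RHS](subr0 0).
apply: (@FTC_0y R (fun r => complex.Im (dh r phi) / r) (fun r => complex.Im (h r phi)) 0 0).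
- move=> x x0; have [_ d2] := h_r x0 phiT.
  by apply: is_derive_eq; rewrite ImM /= mul0r addr0 mulrC.
- move=> x x0; have [d [_ d2]] := dh_r x0 phiT.
  apply: cvgM; first exact: is_derive_continuous d2.
  by apply: cvgV => //; rewrite gt_eqF.
- have [] // := @le_normc_powR_div1D_cvg0 (0^'+) _ (h^~ phi) (fun r => r `^ q / (1 + r)) C.
    by near=> r; apply: hC.
  exact: powR_div1D_right0.
- have [] // := @le_normc_powR_div1D_cvg0 (+oo) _ (h^~ phi) (fun r => r `^ q / (1 + r)) C.
    by near=> r; apply: hC.
  exact: powR_div1D_y.
- apply: le_integrableR dom_integrable; first exact: measurable_itv.
    by have [_ ?] := mdh phi; meas.
  by move=> r; rewrite /= in_itv/= andbT => r0; have [] := le_dom r0 (dhC r0 phiT).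
Unshelve. all: end_near. Qed.

Lemma rotation_Re phi : `|phi| < Th ->
  \int[mu]_(r in `]0, +oo[) (complex.Re (h r phi) / r) =
  \int[mu]_(r in `]0, +oo[) (complex.Re (h r 0) / r).
Proof.
move=> phiT; have Th0 : 0 < Th by apply: le_lt_trans phiT.
apply: (@is_derive_0_itv R (fun phi => \int[mu]_(r in `]0, +oo[) (complex.Re (h r phi) / r)) (- Th) Th);
  last 2 first.
- by rewrite -ltr_norml.
- by rewrite oppr_lt0 Th0.
move=> z zT.
have E : \int[mu]_(r in `]0, +oo[) (- complex.Im (dh r z) / r) = 0.
  under eq_Rintegral do rewrite -mulN1r -mulrA.
  rewrite RintegralZl ?Im_dh_integral ?mulr0 ?ltr_norml//.
  apply: le_integrableR dom_integrable; first exact: measurable_itv.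
    by have [_ ?] := mdh z; meas.
  move=> r; rewrite /= in_itv/= andbT => r0; rewrite -ltr_norml in zT.
  by have [] := le_dom r0 (dhC r0 zT).
suff : is_derive z 1 (fun phi => \int[mu]_(r in `]0, +oo[) (complex.Re (h r phi) / r))
  (\int[mu]_(r in `]0, +oo[) (- complex.Im (dh r z) / r)) by rewrite E.
apply: (@is_derive_under R `]0, +oo[ (fun phi r => complex.Re (h r phi) / r)
  (fun phi r => - complex.Im (dh r phi) / r) (fun r => `|dom r|) z (- Th) Th) => //.
- move=> x xT; rewrite -ltr_norml in xT.
  apply: le_integrableR dom_integrable; first exact: measurable_itv.
    by have [? _] := mh x; meas.
  by move=> r; rewrite /= in_itv/= andbT => r0; have [] := le_dom r0 (hC r0 xT).
- move=> x r; rewrite -ltr_norml /= in_itv/= andbT => xT r0.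
  have [d1 _] := h_phi r0 xT.
  apply: is_derive_eq.
  by rewrite ReM /= /GRing.scale/= mulr0 add0r mul0r sub0r mul1r mulrC.
- by apply: integrable_norm.
- move=> x r; rewrite -ltr_norml /= in_itv/= andbT => xT r0.
  have [_ h2] := le_dom r0 (dhC r0 xT).
  by rewrite mulNr normrN (le_trans h2)// ler_norm.
Qed.
End family.

(** Im z is the real part of - i z, and all hypotheses are stable under multiplication by - i. *)
Lemma rotation_Im (h dh : R -> R -> R[i]) (Th C q : R) : 0 < q -> q < 1 -> 0 <= C ->
  (forall r phi, 0 < r -> `|phi| < Th -> is_cder (h r) phi (Complex 0 1 * dh r phi)) ->
  (forall r phi, 0 < r -> `|phi| < Th -> is_cder (h^~ phi) r ((r^-1)%:C%C * dh r phi)) ->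
  (forall r phi, 0 < r -> `|phi| < Th -> exists d, is_cder (dh^~ phi) r d) ->
  (forall phi, cmeas (h^~ phi)) -> (forall phi, cmeas (dh^~ phi)) ->
  (forall r phi, 0 < r -> `|phi| < Th -> Normc.normc (h r phi) <= C * (r `^ q / (1 + r))) ->
  (forall r phi, 0 < r -> `|phi| < Th -> Normc.normc (dh r phi) <= C * (r `^ q / (1 + r))) ->
  forall phi, `|phi| < Th ->
  \int[mu]_(r in `]0, +oo[) (complex.Im (h r phi) / r) =
  \int[mu]_(r in `]0, +oo[) (complex.Im (h r 0) / r).
Proof.
move=> q0 q1 C0 hp hr dhr mh mdh hC dhC phi phiT.
have E (z : R[i]) : complex.Im z = complex.Re (Complex 0 (- 1) * z).
  by rewrite ReM /= mul0r mulN1r sub0r opprK.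
have N (z : R[i]) : Normc.normc (Complex 0 (- 1) * z) = Normc.normc z.
  by rewrite Normc.normcM normcE2 /= expr0n add0r sqrrN expr1n sqrtr1 mul1r.
under eq_Rintegral do rewrite E.
under [RHS]eq_Rintegral do rewrite E.
apply: (@rotation_Re (fun r phi => Complex 0 (- 1) * h r phi)
  (fun r phi => Complex 0 (- 1) * dh r phi) Th C q) => // {phi phiT}.
- move=> r phi r0 phiT; apply: cder_eq (cderM (cder_cst _ _) (hp _ _ r0 phiT)) _.
  by rewrite mul0r add0r mulrCA.
- move=> r phi r0 phiT; apply: cder_eq (cderM (cder_cst _ _) (hr _ _ r0 phiT)) _.
  by rewrite mul0r add0r mulrCA.
- move=> r phi r0 phiT; have [d hd] := dhr _ _ r0 phiT.
  by eexists; apply: cderM (cder_cst _ _) hd.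
- by move=> phi; apply: cmeasM; [exact: cmeas_cst|exact: mh].
- by move=> phi; apply: cmeasM; [exact: cmeas_cst|exact: mdh].
- by move=> r phi r0 phiT; rewrite N; exact: hC.
- by move=> r phi r0 phiT; rewrite N; exact: dhC.
Qed.

Lemma cderDcV (f : R -> R[i]) (z : R[i]) (x : R) df : is_cder f x df -> f x + z != 0 ->
  is_cder (fun x => (f x + z)^-1) x (- (f x + z)^-1 ^+ 2 * df).
Proof.
move=> hf n; apply: cder_eq (@cderV _ (fun x => f x + z) _ _ n (cderD hf (cder_cst z x))) _.
by rewrite addr0.
Qed.

Section rational.
Variables (p s c s' c' Th A K q : R).
Hypotheses (q0 : 0 < q) (q1 : q < 1) (K0 : 0 <= K) (p0 : 0 <= p)
  (s0 : 0 <= s) (s0' : 0 <= s') (c0 : 0 <= c) (c0' : 0 <= c')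
  (A0 : 0 <= A) (Api : A < pi) (sT : s * Th <= A) (sT' : s' * Th <= A)
  (hK : forall r, 0 < r ->
    r `^ p / ((r `^ s + c) * (r `^ s' + c')) <= K * (r `^ q / (1 + r))).

(** The function lambda^p / ((lambda^s + c) (lambda^s' + c')), a form shared by all the integrands
    to be rotated; the second denominator is 1 when s' = c' = 0. *)
Definition rat_fun r phi : R[i] :=
  polar p r phi * ((polar s r phi + c%:C%C)^-1 * (polar s' r phi + c'%:C%C)^-1).

(** lambda times the logarithmic derivative of [rat_fun]. It is bounded in the sector, so [dh]
    inherits the majorant of [rat_fun]. *)
Let dlog r phi : R[i] := p%:C%C - s%:C%C * (polar s r phi * (polar s r phi + c%:C%C)^-1)
  - s'%:C%C * (polar s' r phi * (polar s' r phi + c'%:C%C)^-1).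

Let dh r phi := rat_fun r phi * dlog r phi.

Let kap := Num.sqrt ((1 + cos A) / 2).

Let kap_gt0 : 0 < kap.
Proof.
have h : cos pi < cos A by rewrite ltr_cos ?in_itv/= ?A0 ?lexx ?(ltW Api) ?pi_ge0.
by rewrite sqrtr_gt0 divr_gt0//; move: h; rewrite cospi; lra.
Qed.

Let den_ge t a r phi : 0 <= t -> 0 <= a -> t * Th <= A -> `|phi| < Th ->
  kap * (r `^ t + a) <= Normc.normc (polar t r phi + a%:C%C).
Proof.
move=> t0 a0 tT phiT; apply: normc_polarD => //; first by rewrite A0 ltW.
rewrite normrM ger0_norm//; apply: le_trans tT.
by rewrite ler_wpM2l// ltW.
Qed.

Let den_neq0 t a r phi : 0 < r -> 0 <= t -> 0 <= a -> t * Th <= A -> `|phi| < Th ->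
  polar t r phi + a%:C%C != 0.
Proof.
move=> r0 t0 a0 tT phiT; rewrite -normc_gt0; apply: lt_le_trans (den_ge r t0 a0 tT phiT).
by rewrite mulr_gt0// ltr_pwDl// powR_gt0.
Qed.

Let ratio_le t a r phi : 0 < r -> 0 <= t -> 0 <= a -> t * Th <= A -> `|phi| < Th ->
  Normc.normc (polar t r phi * (polar t r phi + a%:C%C)^-1) <= kap^-1.
Proof.
move=> r0 t0 a0 tT phiT; rewrite Normc.normcM Normc.normcV normc_polar.
have h := den_ge r t0 a0 tT phiT.
have ra : 0 < r `^ t + a by rewrite ltr_pwDl// powR_gt0.
rewrite ler_pdivrMr; last by apply: lt_le_trans h; rewrite mulr_gt0.
rewrite -ler_pdivrMl ?invr_gt0// invrK; apply: le_trans h.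
by rewrite ler_wpM2l ?(ltW kap_gt0)// lerDl.
Qed.

Lemma normc_rat_fun r phi : 0 < r -> `|phi| < Th ->
  Normc.normc (rat_fun r phi) <= kap ^- 2 * K * (r `^ q / (1 + r)).
Proof.
move=> r0 phiT; rewrite /rat_fun Normc.normcM normc_polar Normc.normcM !Normc.normcV.
have h := den_ge r s0 c0 sT phiT; have h' := den_ge r s0' c0' sT' phiT.
have ra : 0 < r `^ s + c by rewrite ltr_pwDl// powR_gt0.
have ra' : 0 < r `^ s' + c' by rewrite ltr_pwDl// powR_gt0.
rewrite -mulrA; apply: le_trans (_ : kap ^- 2 * (r `^ p / ((r `^ s + c) * (r `^ s' + c'))) <= _).
  rewrite [leRHS]mulrCA ler_wpM2l ?powR_ge0// -!invfM.
  rewrite lef_pV2 ?posrE; last 2 first.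
  - by rewrite mulr_gt0//; [apply: lt_le_trans h|apply: lt_le_trans h']; rewrite mulr_gt0.
  - by rewrite !mulr_gt0// exprn_gt0.
  rewrite expr2 mulrACA ler_pM// ?mulr_ge0// ltW// mulr_gt0.
by rewrite ler_wpM2l ?hK// invr_ge0 exprn_ge0// ltW.
Qed.

Let cder_lam_phi (t r phi : R) : is_cder (polar t r) phi (Complex 0 1 * (t%:C%C * polar t r phi)).
Proof.
apply: cder_eq (cder_polar_phi _ _ _) _; rewrite mulrA; congr (_ * _).
by apply/eqP; rewrite eq_complex /=; apply/andP; split; apply/eqP; ring.
Qed.

Let cder_lam_r (t r phi : R) : 0 < r ->
  is_cder (polar t ^~ phi) r ((r^-1)%:C%C * (t%:C%C * polar t r phi)).
Proof.
move=> r0; apply: cder_eq (cder_polar_r _ _ r0) _; rewrite mulrA; congr (_ * _).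
by rewrite -rmorphM mulrC.
Qed.

(* Both the angular and the radial derivative are a constant multiple of the
   logarithmic derivative. *)
Let cder_rat_fun (P S S' : R -> R[i]) x (k : R[i]) :
  S x + c%:C%C != 0 -> S' x + c'%:C%C != 0 ->
  is_cder P x (k * (p%:C%C * P x)) -> is_cder S x (k * (s%:C%C * S x)) ->
  is_cder S' x (k * (s'%:C%C * S' x)) ->
  is_cder (fun x => P x * ((S x + c%:C%C)^-1 * (S' x + c'%:C%C)^-1)) x
   (k * (P x * ((S x + c%:C%C)^-1 * (S' x + c'%:C%C)^-1) *
     (p%:C%C - s%:C%C * (S x * (S x + c%:C%C)^-1) - s'%:C%C * (S' x * (S' x + c'%:C%C)^-1)))).
Proof.
move=> n1 n2 hP hS hS'.
have h1 := cderDcV hS n1; have h2 := cderDcV hS' n2.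
apply: cder_eq (cderM hP (cderM h1 h2)) _.
move: n1 n2; move: (p%:C%C) (s%:C%C) (s'%:C%C) (c%:C%C) (c'%:C%C) (P x) (S x) (S' x).
move=> u v v' d d' X Y Z n1 n2; field.
by rewrite n1 n2.
Qed.

Let h_phi (r phi : R) : 0 < r -> `|phi| < Th ->
  is_cder (rat_fun r) phi (Complex 0 1 * dh r phi).
Proof.
move=> r0 phiT.
apply: (@cder_rat_fun (polar p r) (polar s r) (polar s' r)); try exact: cder_lam_phi.
- exact: den_neq0.
- exact: den_neq0.
Qed.

Let h_r (r phi : R) : 0 < r -> `|phi| < Th ->
  is_cder (rat_fun ^~ phi) r ((r^-1)%:C%C * dh r phi).
Proof.
move=> r0 phiT.
apply: (@cder_rat_fun (polar p ^~ phi) (polar s ^~ phi) (polar s' ^~ phi)); try exact: cder_lam_r.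
- exact: den_neq0.
- exact: den_neq0.
Qed.

Let dh_r (r phi : R) : 0 < r -> `|phi| < Th -> exists d, is_cder (dh^~ phi) r d.
Proof.
move=> r0 phiT.
have n1 := den_neq0 r0 s0 c0 sT phiT; have n2 := den_neq0 r0 s0' c0' sT' phiT.
have h1 := cderDcV (cder_lam_r s phi r0) n1; have h2 := cderDcV (cder_lam_r s' phi r0) n2.
have h3 := cderM (cder_cst (- s%:C%C) r) (cderM (cder_lam_r s phi r0) h1).
have h4 := cderM (cder_cst (- s'%:C%C) r) (cderM (cder_lam_r s' phi r0) h2).
have h5 := cderM (h_r r0 phiT) (cderD (cderD (cder_cst p%:C%C r) h3) h4).
eexists; rewrite /dh /dlog; under eq_fun do rewrite -!mulNr; exact: h5.
Qed.

Let mh phi : cmeas (rat_fun ^~ phi).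
Proof. by rewrite /rat_fun; cmeas_tac; exact: measurable_id. Qed.

Let mdh phi : cmeas (dh ^~ phi).
Proof.
rewrite /dh /dlog; under eq_fun do rewrite -!mulNr.
by apply: cmeasM; [exact: mh|cmeas_tac; exact: measurable_id].
Qed.

Let dlog_le (r phi : R) : 0 < r -> `|phi| < Th ->
  Normc.normc (dlog r phi) <= p + s / kap + s' / kap.
Proof.
move=> r0 phiT; rewrite /dlog -!mulNr.
have q1' := ratio_le r0 s0 c0 sT phiT; have q2' := ratio_le r0 s0' c0' sT' phiT.
apply: le_trans (le_normcD _ _) _; apply: lerD; last first.
  by rewrite Normc.normcM normcN normc_real ger0_norm// ler_wpM2l.
apply: le_trans (le_normcD _ _) _; apply: lerD; last first.
  by rewrite Normc.normcM normcN normc_real ger0_norm// ler_wpM2l.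
by rewrite normc_real ger0_norm.
Qed.

(** The summand 1 lets a single constant serve for [rat_fun] as well as for [dh]. *)
Let B := 1 + (p + s / kap + s' / kap).
Let C := B * (kap ^- 2 * K).

Let B1 : 0 <= p + s / kap + s' / kap.
Proof. by rewrite !addr_ge0 ?divr_ge0// ltW. Qed.

Let D0 : 0 <= kap ^- 2 * K.
Proof. by rewrite mulr_ge0// invr_ge0 exprn_ge0// ltW. Qed.

Let C0 : 0 <= C. Proof. by rewrite mulr_ge0// addr_ge0. Qed.

Let hC (r phi : R) : 0 < r -> `|phi| < Th -> Normc.normc (rat_fun r phi) <= C * (r `^ q / (1 + r)).
Proof.
move=> r0 phiT; apply: le_trans (normc_rat_fun r0 phiT) _.
rewrite ler_wpM2r ?divr_ge0 ?powR_ge0 ?addr_ge0 ?(ltW r0)//.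
by rewrite ler_peMl// lerDl.
Qed.

Let dhC (r phi : R) : 0 < r -> `|phi| < Th -> Normc.normc (dh r phi) <= C * (r `^ q / (1 + r)).
Proof.
move=> r0 phiT; rewrite Normc.normcM mulrC /C -mulrA.
apply: ler_pM; rewrite ?normc_ge0 ?normc_rat_fun//.
by apply: le_trans (dlog_le r0 phiT) _; rewrite lerDr.
Qed.

(** On the ray phi = 0 the function is real, so the imaginary part of the integral vanishes there,
    hence at every admissible angle. *)
Lemma rotation phi : `|phi| < Th ->
  \int[mu]_(r in `]0, +oo[) (complex.Re (rat_fun r phi) / r) =
  \int[mu]_(r in `]0, +oo[) (complex.Re (rat_fun r 0) / r) /\
  \int[mu]_(r in `]0, +oo[) (complex.Im (rat_fun r phi) / r) = 0.
Proof.
move=> phiT; split.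
  exact: (@rotation_Re rat_fun dh Th C q).
rewrite (@rotation_Im rat_fun dh Th C q)//.
rewrite /Rintegral integral0_eq// => r _.
by rewrite /rat_fun !polar_phi0 -!rmorphD -!fmorphV -!rmorphM /= mul0r.
Qed.
End rational.
End rotation.

(* [e^(lambda t)] for [lambda = r (- a + i b)] *)
Definition ray_exp {R : realType} (a b r t : R) : R[i] :=
  (expR (- (a * t * r)))%:C%C * cis (b * t * r).

(** The two conjugate halves of a Hankel contour contribute a number and minus its conjugate, that
    is, 2 i times an imaginary part; only that part is kept. *)
HB.lock Definition ray_integral {R : realType} (a b : R) (f : R -> R[i]) (t : R) : R :=
  \int[@lebesgue_measure R]_(r in `]0, +oo[) complex.Im (ray_exp a b r t * f r).

Lemma ray_integralE (R : realType) (a b : R) (f : R -> R[i]) t : ray_integral a b f t =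
  \int[@lebesgue_measure R]_(r in `]0, +oo[) complex.Im (ray_exp a b r t * f r).
Proof. by rewrite unlock. Qed.

(** * Laplace-type integrals along a ray: size, derivative, limit at 0 *)

Section laplace_ray.
Context {R : realType}.
Local Notation mu := (@lebesgue_measure R).
Local Notation RT := (measurableTypeR R).
Variables (a b : R).
Hypothesis a0 : 0 < a.
Implicit Types (f g : R -> R[i]).

Local Notation rexp := (ray_exp a b).
Local Notation rint := (ray_integral a b).

Definition ray_point (r : R) : R[i] := Complex (- (a * r)) (b * r).

Lemma normc_ray_exp r t : Normc.normc (rexp r t) = expR (- (a * t * r)).
Proof. by rewrite Normc.normcM normc_real normc_cis mulr1 ger0_norm// expR_ge0. Qed.

Lemma ray_exp0 r : rexp r 0 = 1.
Proof. by rewrite /ray_exp !mulr0 mul0r oppr0 expR0 cis0 mulr1. Qed.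

Lemma cder_ray_exp r t : is_cder (rexp r) t (ray_point r * rexp r t).
Proof.
split.
  rewrite (_ : (fun x => _) = (fun x => expR (- (a * x * r)) * cos (b * x * r))); last first.
    by apply/funext => x; rewrite /ray_exp ReM /= mul0r subr0.
  apply: is_derive_eq; rewrite /ray_exp !ReM !ImM /= /GRing.scale/=.
  by move: (expR _) (cos _) (sin _) => x y z; ring.
rewrite (_ : (fun x => _) = (fun x => expR (- (a * x * r)) * sin (b * x * r))); last first.
  by apply/funext => x; rewrite /ray_exp ImM /= mul0r addr0.
apply: is_derive_eq; rewrite /ray_exp !ImM !ReM /= /GRing.scale/=.
by move: (expR _) (cos _) (sin _) => x y z; ring.
Qed.

Lemma cmeas_ray_exp t : cmeas (rexp ^~ t).
Proof. by apply: cmeasM; [apply: cmeas_real|apply: cmeas_cis]; meas. Qed.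

Lemma measurable_ray f t : cmeas f ->
  measurable_fun (`]0, +oo[ : set RT) (fun r => complex.Im (rexp r t * f r)).
Proof. by move=> mf; have [_ h] := cmeasM (cmeas_ray_exp t) mf; exact: measurable_funTS. Qed.

Definition ray_bounded f (K m : R) := forall r : R, 0 < r -> Normc.normc (f r) <= K * r `^ (m - 1).

Lemma ray_dominated f K m t r : ray_bounded f K m -> 0 < r ->
  `|complex.Im (rexp r t * f r)| <= K * (r `^ (m - 1) * expR (- (a * t * r))).
Proof.
move=> fK r0; apply: le_trans (Im_le_normc _) _.
rewrite Normc.normcM normc_ray_exp mulrA [leLHS]mulrC ler_wpM2r ?expR_ge0//.
exact: fK.
Qed.

Lemma ray_dom_integrable K m t : 0 < m -> 0 < t ->
  mu.-integrable `]0, +oo[ (EFin \o (fun r => K * (r `^ (m - 1) * expR (- (a * t * r))))) /\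
  \int[mu]_(r in `]0, +oo[) (K * (r `^ (m - 1) * expR (- (a * t * r)))) =
    K * (Gamma m * (a * t) `^ (- m)).
Proof.
move=> m0 t0; have at0 : 0 < a * t by rewrite mulr_gt0.
have [h1 h2] : mu.-integrable `]0, +oo[ (EFin \o (fun r => r `^ (m - 1) * expR (- (a * t * r)))) /\
    \int[mu]_(r in `]0, +oo[) (r `^ (m - 1) * expR (- (a * t * r))) = Gamma m * (a * t) `^ (- m).
  apply: ge0_integrable_Rintegral; [exact: measurable_itv|by meas| |exact: Gamma_scale].
  by move=> x _; rewrite mulr_ge0 ?powR_ge0 ?expR_ge0.
split; first by apply: integrableRZ h1; exact: measurable_itv.
by rewrite RintegralZl ?h2//.
Qed.

Lemma ray_integrable f K m t : cmeas f -> ray_bounded f K m -> 0 < m -> 0 < t ->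
  mu.-integrable `]0, +oo[ (EFin \o (fun r => complex.Im (rexp r t * f r))).
Proof.
move=> mf fK m0 t0; apply: le_integrableR (ray_dom_integrable K m0 t0).1.
- exact: measurable_itv.
- exact: measurable_ray.
- by move=> r; rewrite /= in_itv/= andbT; exact: ray_dominated.
Qed.

Lemma le_normr_RintegralR (D : set RT) (f g : R -> R) : measurable D ->
  measurable_fun D f -> mu.-integrable D (EFin \o g) ->
  (forall x, D x -> `|f x| <= g x) -> `|\int[mu]_(x in D) f x| <= \int[mu]_(x in D) g x.
Proof.
move=> mD mf ig fg; have jf := le_integrableR mD mf fg ig.
apply: le_trans (le_normr_Rintegral mD jf) _.
by apply: le_Rintegral => //; exact: integrable_norm.
Qed.

(** The source of all decay in t: a density of order r^(m - 1) gives an integral of order t^(- m).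
    It serves with m = beta for rho = 1 and with m = beta - 1 for rho = 2. *)
Lemma ray_integral_le f K m t : cmeas f -> ray_bounded f K m -> 0 < m -> 0 < t ->
  `|rint f t| <= K * (Gamma m * (a * t) `^ (- m)).
Proof.
move=> mf fK m0 t0; have [h1 <-] := ray_dom_integrable K m0 t0.
rewrite ray_integralE; apply: le_normr_RintegralR h1 _.
- exact: measurable_itv.
- exact: measurable_ray.
- by move=> r; rewrite /= in_itv/= andbT; exact: ray_dominated.
Qed.

(** |lambda| <= (a + |b|) r, so a derivative in t costs one power of r. *)
Lemma ray_bounded_point f K m : 0 <= K -> ray_bounded f K m ->
  ray_bounded (fun r => ray_point r * f r) ((a + `|b|) * K) (m + 1).
Proof.
move=> K0 fK r r0; rewrite Normc.normcM.
have -> : (a + `|b|) * K * r `^ (m + 1 - 1) = ((a + `|b|) * r) * (K * r `^ (m - 1)).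
  rewrite (_ : m + 1 - 1 = (m - 1) + 1); last by ring.
  rewrite (gt0_powRD _ _ r0) powRr1 ?(ltW r0)//.
  by move: (r `^ _) => u; ring.
apply: ler_pM; rewrite ?normc_ge0 ?fK//.
have -> : ray_point r = (- (a * r))%:C%C + Complex 0 1 * (b * r)%:C%C.
  by apply/eqP; rewrite eq_complex /=; apply/andP; split; apply/eqP; ring.
apply: le_trans (le_normcD _ _) _.
rewrite Normc.normcM !normc_real normcE2 /= expr0n add0r expr1n sqrtr1 mul1r.
by rewrite normrN !normrM (gtr0_norm a0) (gtr0_norm r0) mulrDl.
Qed.

Lemma is_derive_ray f (K m t : R) : 0 <= K -> cmeas f -> ray_bounded f K m -> 0 < m -> 0 < t ->
  is_derive t 1 (rint f) (rint (fun r => ray_point r * f r) t).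
Proof.
move=> K0 mf fK m0 t0; rewrite ray_integralE.
have -> : rint f = (fun t => \int[mu]_(r in `]0, +oo[) complex.Im (rexp r t * f r)).
  by apply/funext => ?; rewrite ray_integralE.
have fK' := ray_bounded_point K0 fK.
have t20 : 0 < t / 2 by rewrite divr_gt0.
have m10 : 0 < m + 1 by rewrite addr_gt0.
pose K' := (a + `|b|) * K; have K'0 : 0 <= K' by rewrite mulr_ge0// addr_ge0// ltW.
(* The majorant is taken at time t / 2, where the exponential bounds those of all times in []t / 2,
   2 t[]. *)
apply: (@is_derive_under R `]0, +oo[ (fun t r => complex.Im (rexp r t * f r))
  (fun t r => complex.Im (rexp r t * (ray_point r * f r)))
  (fun r => K' * (r `^ (m + 1 - 1) * expR (- (a * (t / 2) * r)))) t (t / 2) (2 * t)).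
- exact: measurable_itv.
- by apply/andP; split; lra.
- move=> x /andP[x1 x2]; apply: ray_integrable fK m0 _ => //.
  exact: lt_trans x1.
- move=> x r _ _; have [h1 h2] := cderM (cder_ray_exp r x) (cder_cst (f r) x).
  apply: is_derive_eq; congr complex.Im.
  by rewrite mulr0 addr0 [RHS]mulrCA mulrA.
- by move=> r; apply: mulr_ge0 => //; rewrite mulr_ge0 ?powR_ge0 ?expR_ge0.
- exact: (ray_dom_integrable _ _ _).1.
- move=> x r /andP[x1 x2]; rewrite /= in_itv/= andbT => r0.
  apply: le_trans (ray_dominated x fK' r0) _.
  rewrite ler_wpM2l// ler_wpM2l ?powR_ge0// ler_expR lerN2.
  by rewrite ler_wpM2r ?(ltW r0)// ler_wpM2l ?(ltW a0)// ltW.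
Qed.

Section integrable_density.
Variables (f : R -> R[i]) (K q : R).
Hypotheses (mf : cmeas f) (q0 : 0 < q) (q1 : q < 1) (K0 : 0 <= K)
  (fK : forall r, 0 < r -> Normc.normc (f r) <= K * (r `^ (q - 1) / (1 + r))).

Let dom r : R := K * (r `^ (q - 1) / (1 + r)).

Let dom_integrable : mu.-integrable `]0, +oo[ (EFin \o dom).
Proof. by apply: integrableRZ; [exact: measurable_itv|exact: powR_div1D_integrable]. Qed.

Let ray_le_dom t r : 0 <= t -> 0 < r -> `|complex.Im (rexp r t * f r)| <= dom r.
Proof.
move=> t0 r0; apply: le_trans (Im_le_normc _) _.
rewrite Normc.normcM normc_ray_exp; apply: le_trans (fK r0).
rewrite ler_piMl ?normc_ge0// -expR0 ler_expR oppr_le0.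
by rewrite !mulr_ge0 ?(ltW a0)// ltW.
Qed.

Lemma ray_integrable0 t : 0 <= t ->
  mu.-integrable `]0, +oo[ (EFin \o (fun r => complex.Im (rexp r t * f r))).
Proof.
move=> t0; apply: le_integrableR dom_integrable.
- exact: measurable_itv.
- exact: measurable_ray.
- by move=> r; rewrite /= in_itv/= andbT; exact: ray_le_dom.
Qed.

Lemma ray_integral_bounded : exists2 M, 0 <= M & forall t, 0 <= t -> `|rint f t| <= M.
Proof.
exists (\int[mu]_(r in `]0, +oo[) dom r).
  apply: Rintegral_ge0 => r; rewrite /= in_itv/= andbT => r0.
  by rewrite mulr_ge0// divr_ge0 ?powR_ge0// addr_ge0// ltW.
move=> t t0; rewrite ray_integralE; apply: le_normr_RintegralR dom_integrable _.
- exact: measurable_itv.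
- exact: measurable_ray.
- by move=> r; rewrite /= in_itv/= andbT; exact: ray_le_dom.
Qed.

(** The density is integrable without the help of the exponential, so dominated convergence reaches
    t = 0. *)
Lemma ray_integral_right0 : rint f t @[t --> 0^'+] --> rint f 0.
Proof.
(* At negative times the exponential grows along the ray; with |t| in place of t the majorant holds
   on a full neighbourhood of 0. *)
have H : rint f `|t| @[t --> (0 : R)] --> rint f 0.
  have := @continuity_under_integral R _ RT mu
    (fun t r => complex.Im (rexp r `|t| * f r)) `]0, +oo[ (measurable_itv _) (-1) 1.
  have c1 x : `]-1, 1[%classic x ->
      mu.-integrable `]0, +oo[ (EFin \o (fun r => complex.Im (rexp r `|x| * f r))).
    by move=> _; apply: ray_integrable0.
  move=> /(_ c1).
  have c2 (y x : R) : {for x, continuous (fun x : R => complex.Im (rexp y `|x| * f y))}.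
    have [_ d2] := cderM (cder_ray_exp y `|x|) (cder_cst (f y) `|x|).
    have h := is_derive_continuous d2.
    by apply: (continuous_comp _ h); exact: norm_continuous.
  move=> H0; have {}H0 := H0 ltac:(apply: aeW => y _ x _; exact: c2) dom dom_integrable.
  have {}H0 := H0 ltac:(move=> x _; apply: aeW => y; rewrite /= in_itv/= andbT; exact: ray_le_dom).
  move: H0 => /(_ 0); rewrite inE/= in_itv/= ltrN10 ltr01 => /(_ isT).
  rewrite /continuous_at normr0 -ray_integralE.
  by under eq_fun do rewrite -ray_integralE.
have : rint f `|t| @[t --> 0^'+] --> rint f 0.
  exact: cvg_at_right_filter.
apply: cvg_trans; apply: near_eq_cvg; near=> t.
have t0 : 0 < t by near: t; exact: nbhs_right_gt.
by rewrite gtr0_norm.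
Unshelve. all: end_near. Qed.
End integrable_density.
End laplace_ray.

(** * Integrable majorants along the ray *)

Section rational_bounds.
Context {R : realType}.
Variable beta : R.
Hypotheses (beta1 : 1 < beta) (beta2 : beta < 2).

Lemma powR_ge1 (r p : R) : 0 <= p -> 1 <= r -> 1 <= r `^ p.
Proof. by move=> p0 r1; rewrite -(powRr0 r) ler_powR. Qed.

(** Since r + x >= r, it is enough that 1 + r <= 2 (r^beta + 1), checked separately for r >= 1 and r
    < 1. The bound is uniform in x. *)
Lemma rat_domZ r x : 0 < r -> 0 <= x ->
  r `^ beta / ((r `^ beta + 1) * (r `^ 1 + x)) <= 2 * (r `^ (beta - 1) / (1 + r)).
Proof.
move=> r0 x0; rewrite powRr1 ?(ltW r0)//.
have E : r `^ beta = r `^ (beta - 1) * r by rewrite -{3}[r]powRr1 ?(ltW r0)// -gt0_powRD// subrK.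
have u0 : 0 < r `^ (beta - 1) by exact: powR_gt0.
have hw : 1 + r <= 2 * (r `^ beta + 1).
  have [r1|r1] := leP 1 r; last by have := powR_ge0 r beta; lra.
  have : r <= r `^ beta by rewrite E ler_peMl ?(ltW r0)// powR_ge1// subr_ge0 ltW.
  by have := ltW r0; lra.
have hp : 0 < r `^ beta + 1 by rewrite ltr_pwDr ?powR_ge0.
rewrite ler_pdivrMr; last by rewrite mulr_gt0// ltr_pwDl.
rewrite mulrA mulrAC ler_pdivlMr ?addr_gt0// {1}E.
have -> : 2 * r `^ (beta - 1) * ((r `^ beta + 1) * (r + x)) =
   r `^ (beta - 1) * ((r + x) * (2 * (r `^ beta + 1))) by ring.
rewrite -mulrA ler_wpM2l ?(ltW u0)// ler_pM ?(ltW r0)//; first by rewrite addr_ge0 ?(ltW r0).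
by rewrite lerDl.
Qed.

(** For r >= 1 use r <= r^beta; for r < 1 use r <= r^(beta - 1), as beta - 1 < 1. *)
Lemma rat_domH r : 0 < r ->
  r `^ 1 / ((r `^ beta + 1) * (r `^ 1 + 1)) <= 2 * (r `^ (beta - 1) / (1 + r)).
Proof.
move=> r0; apply: le_trans (_ : r `^ (beta - 1) / (1 + r) <= _); last first.
  rewrite ler_peMl ?divr_ge0 ?powR_ge0 ?addr_ge0 ?(ltW r0)// ler1n//.
have r10 : 0 < 1 + r by rewrite addr_gt0.
have hp : 0 < r `^ beta + 1 by rewrite ltr_pwDr ?powR_ge0.
rewrite powRr1 ?(ltW r0)// (addrC r) invfM mulrA ler_wpM2r ?invr_ge0 ?(ltW r10)//.
rewrite ler_pdivrMr//.
have [r1|r1] := leP 1 r.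
  have h1 : 1 <= r `^ (beta - 1) by rewrite powR_ge1// subr_ge0 ltW.
  have h2 : r <= r `^ beta.
    by rewrite -{1}[r]powRr1 ?(ltW r0)// ler_powR// ltW.
  by apply: le_trans h2 _; rewrite -[leLHS]mul1r ler_pM// ?powR_ge0// lerDl.
have : r <= r `^ (beta - 1).
  by apply: ger1_powR; rewrite ?r0 ?(ltW r1)//; move: beta2; lra.
move/le_trans; apply; rewrite ler_peMr ?powR_ge0// lerDr powR_ge0//.
Qed.
End rational_bounds.

Section fubini_dominated.
Context {R : realType}.
Local Notation mu := (@lebesgue_measure R).
Local Notation RT := (measurableTypeR R).

(** In the applications the inner integral c of the majorant is explicit, so the finiteness that
    Fubini's theorem requires reduces to integrability in one variable. *)
Lemma fubini_dominated (D E : set RT) (f g : R -> R -> R) (c : R -> R) :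
  measurable D -> measurable E ->
  measurable_fun [set: RT * RT] (fun z => f z.1 z.2) ->
  (forall x, D x -> measurable_fun E (g x)) ->
  (forall x y, D x -> E y -> `|f x y| <= g x y) ->
  (forall x, D x -> \int[mu]_(y in E) (g x y)%:E = (c x)%:E)%E ->
  mu.-integrable D (EFin \o c) ->
  mu.-integrable E (EFin \o (fun y => \int[mu]_(x in D) f x y)) /\
  \int[mu]_(x in D) \int[mu]_(y in E) f x y =
  \int[mu]_(y in E) \int[mu]_(x in D) f x y.
Proof.
move=> mD mE mf mg fg gc ic; apply: fubini_in => //.
have mc : measurable_fun D c by apply/measurable_EFinP; exact: measurable_int ic.
have mfx x : measurable_fun E (f x).
  apply: measurable_funTS.
  have h := @pair1_measurable _ _ RT RT x.
  exact: (measurableT_comp mf h).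
have le x : D x -> (\int[mu]_(y in E) `|f x y|%:E <= `|c x|%:E)%E.
  move=> Dx; apply: (@le_trans _ _ (c x)%:E); last by rewrite lee_fin ler_norm.
  rewrite -gc//; apply: ge0_le_integralR => //.
  - by apply: measurableT_comp => //; exact: mfx.
  - exact: mg.
  - by move=> y Ey; exact: fg.
apply: (@le_lt_trans _ _ (\int[mu]_(x in D) `|c x|%:E)%E); last first.
  by move/integrableP : ic => [_].
apply: ge0_le_integral => //.
- by move=> x _; apply: integral_ge0 => y _; rewrite lee_fin.
- apply: measurable_funTS.
  pose F (z : RT * RT) := ((fun z => `|f z.1 z.2|%:E) \_ ([set: RT] `*` E)) z.
  have mF : measurable_fun [set: RT * RT] F.
    apply/(measurable_restrictT _ _).1; first exact: measurableX.
    by apply: measurable_funTS; apply/measurable_EFinP; exact: measurableT_comp.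
  have F0 z : (0 <= F z)%E by apply: erestrict_ge0 => y _; rewrite lee_fin.
  have := @measurable_fun_fubini_tonelli_F _ _ _ _ R mu F mF F0.
  apply: eq_measurable_fun => x _; rewrite /fubini_F [RHS]integral_mkcond.
  by apply: eq_integral => y _; rewrite /F !patchE in_setX in_setT.
- by apply/measurable_EFinP; exact: measurableT_comp.
Qed.
End fubini_dominated.

(** * Decay of the Mittag-Leffler functions *)
Section decay.
Context {R : realType}.
Local Notation mu := (@lebesgue_measure R).
Local Notation RT := (measurableTypeR R).
Variable beta : R.
Hypotheses (beta1 : 1 < beta) (beta2 : beta < 2).

Let beta0 : 0 < beta. Proof. exact: lt_trans beta1. Qed.

(* Along the ray of angle [theta], both [lambda] has negative real part and
   [lambda^beta] stays away from the negative axis. *)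
Let theta : R := (pi / 2 + pi / beta) / 2.
(** [theta] has to lie strictly inside the range |phi| < [Th] of the rotation, while [A], the
    largest argument of lambda^beta there, stays below pi. *)
Let Th : R := (theta + pi / beta) / 2.
Let A : R := beta * Th.

Let theta_bnd : [/\ pi / 2 < theta, theta < Th & Th < pi / beta].
Proof.
have p0 := pi_gt0 R.
have h : pi / 2 < pi / beta by rewrite ltr_pM2l// ltf_pV2 ?posrE.
by rewrite /Th /theta; split; lra.
Qed.

Let theta_pi : theta < pi.
Proof.
have [_ h1 h2] := theta_bnd; apply: lt_trans h1 (lt_trans h2 _).
by rewrite ltr_pdivrMr// ltr_pMr// pi_gt0.
Qed.

Let theta_gt0 : 0 < theta.
Proof. by have [h _ _] := theta_bnd; apply: lt_trans h; rewrite divr_gt0// pi_gt0. Qed.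

Let Th0 : 0 < Th. Proof. by have [_ h _] := theta_bnd; exact: lt_trans h. Qed.

Let A0 : 0 <= A. Proof. by rewrite mulr_ge0 ?ltW. Qed.
Let Api : A < pi. Proof. by have [_ _ h] := theta_bnd; rewrite /A mulrC -ltr_pdivlMr. Qed.

Let ThA : 1 * Th <= A. Proof. by rewrite ler_wpM2r ?ltW. Qed.

Let theta_Th : `|theta| < Th.
Proof. by have [_ h _] := theta_bnd; rewrite gtr0_norm. Qed.

Let a := - cos theta.
Let b := sin theta.

Let a0 : 0 < a.
Proof.
rewrite oppr_gt0 -(@cos_pihalf R); have [h _ _] := theta_bnd.
have p0 := pi_gt0 R.
have i1 : theta \in `[0, pi]%R by rewrite in_itv/= (ltW theta_gt0) (ltW theta_pi).
have i2 : pi / 2 \in (`[0, pi]%R : interval R) by rewrite in_itv/=; apply/andP; split; lra.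
by rewrite (ltr_cos i2 i1).
Qed.

Let b0 : 0 < b.
Proof. by apply: sin_gt0_pi; rewrite theta_gt0 theta_pi. Qed.

Let kap := Num.sqrt ((1 + cos A) / 2).

Let kap_gt0 : 0 < kap.
Proof.
have h : cos pi < cos A by rewrite ltr_cos ?in_itv/= ?A0 ?lexx ?(ltW Api) ?pi_ge0.
by rewrite sqrtr_gt0 divr_gt0//; move: h; rewrite cospi; lra.
Qed.

Let lam r : R[i] := polar 1 r theta.
Let w r : R[i] := polar beta r theta.

Let lamE r : 0 < r -> ray_point a b r = lam r.
Proof.
move=> r0; rewrite /lam polar1 ?(ltW r0)//; apply/eqP; rewrite eq_complex ReM ImM /= /a /b.
by rewrite mulNr opprK !mul0r subr0 addr0 !(mulrC r) !eqxx.
Qed.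

Let lam_cis r : 0 < r -> lam r * (r^-1)%:C%C = cis theta.
Proof.
move=> r0; rewrite /lam polar1 ?(ltW r0)// mulrAC -rmorphM mulfV ?gt_eqF//.
by rewrite rmorph1 mul1r.
Qed.

Let den_ge t r c : 0 <= t -> t * Th <= A -> 0 <= c ->
  kap * (r `^ t + c) <= Normc.normc (polar t r theta + c%:C%C).
Proof.
move=> t0 tT c0; apply: normc_polarD => //; first by rewrite A0 ltW.
rewrite normrM ger0_norm//; apply: le_trans tT; rewrite ler_wpM2l// ltW//.
Qed.

Let den_neq0 t r c : 0 < r -> 0 <= t -> t * Th <= A -> 0 <= c ->
  polar t r theta + c%:C%C != 0.
Proof.
move=> r0 t0 tT c0; rewrite -normc_gt0; apply: lt_le_trans (den_ge r t0 tT c0).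
by rewrite mulr_gt0// ltr_pwDl// powR_gt0.
Qed.

Let denV_le t r c : 0 < r -> 0 <= t -> t * Th <= A -> 0 <= c ->
  Normc.normc (polar t r theta + c%:C%C)^-1 <= kap^-1 * (r `^ t + c)^-1.
Proof.
move=> r0 t0 tT c0; rewrite Normc.normcV -invfM lef_pV2 ?den_ge// posrE.
  by rewrite normc_gt0 den_neq0.
by rewrite mulr_gt0// ltr_pwDl// powR_gt0.
Qed.

Let w_neq0 r : 0 < r -> w r + 1 != 0.
Proof. by move=> r0; apply: (@den_neq0 beta r 1) => //; exact: ltW. Qed.

Let lam_neq0 r x : 0 < r -> 0 <= x -> lam r + x%:C%C != 0.
Proof. by move=> r0 x0; exact: den_neq0. Qed.

(* [phiF = phiG + phiZ 1 - phiH] splits off the part of [phiF] that is not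
   integrable at infinity; [phiP] only serves to prove that the constant [C] with
   [ray_integral phiG t = C e^(-t)] is nonzero. *)
Definition phiF r : R[i] := w r * (w r + 1)^-1 * (r^-1)%:C%C.
Definition phiZ x r : R[i] := w r * ((w r + 1)^-1 * (lam r + x%:C%C)^-1) * (r^-1)%:C%C.
Definition phiG r : R[i] := cis theta * (lam r + 1)^-1.
Definition phiH r : R[i] := lam r * ((w r + 1)^-1 * (lam r + 1)^-1) * (r^-1)%:C%C.
Definition phiP r : R[i] := cis theta * ((lam r + 1)^-1 * (lam r - 1)^-1).

Local Notation rint := (ray_integral a b).

Let mw : cmeas w. Proof. by apply: cmeas_polar; exact: measurable_id. Qed.
Let mlam : cmeas lam. Proof. by apply: cmeas_polar; exact: measurable_id. Qed.
Let minv : cmeas (fun r : R => (r^-1)%:C%C). Proof. by apply: cmeas_real; meas. Qed.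

Let mF : cmeas phiF. Proof. by rewrite /phiF; cmeas_tac. Qed.
Let mZ x : cmeas (phiZ x). Proof. by rewrite /phiZ; cmeas_tac. Qed.
Let mG : cmeas phiG. Proof. by rewrite /phiG; cmeas_tac. Qed.
Let mH : cmeas phiH. Proof. by rewrite /phiH; cmeas_tac. Qed.
Let mP : cmeas phiP. Proof. by rewrite /phiP; cmeas_tac. Qed.

Let q0 : 0 < beta - 1. Proof. by rewrite subr_gt0. Qed.
Let q1 : beta - 1 < 1. Proof. by move: beta2; lra. Qed.

Let kapV : 0 <= kap^-1. Proof. by rewrite invr_ge0 ltW. Qed.

Let bF : ray_bounded phiF kap^-1 beta.
Proof.
move=> r r0; rewrite /phiF Normc.normcM Normc.normcM normc_polar normc_real.
have h := @denV_le beta r 1 r0 (ltW beta0) (lexx _) ler01.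
rewrite gtr0_norm ?invr_gt0// (gt0_powRD _ _ r0) powR_inv1 ?(ltW r0)//.
rewrite mulrA ler_wpM2r ?invr_ge0 ?(ltW r0)// [leRHS]mulrC ler_wpM2l ?powR_ge0//.
apply: le_trans h _; rewrite ler_piMr//.
by rewrite invf_le1 ?lerDr ?powR_ge0// ltr_pwDr// powR_ge0.
Qed.

Let bG : ray_bounded phiG kap^-1 1.
Proof.
move=> r r0; rewrite /phiG Normc.normcM normc_cis mul1r subrr powRr0 mulr1.
have h := @denV_le 1 r 1 r0 ler01 ThA ler01.
apply: le_trans h _; rewrite ler_piMr//.
by rewrite invf_le1 ?lerDr ?powR_ge0// ltr_pwDr// powR_ge0.
Qed.

Let K := kap ^- 2 * 2.
Let K0 : 0 <= K. Proof. by rewrite mulr_ge0// invr_ge0 exprn_ge0// ltW. Qed.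

Let powR_predD r : 0 < r ->
  K * (r `^ (beta - 1 - 1) / (1 + r)) = K * (r `^ (beta - 1) / (1 + r)) / r.
Proof.
move=> r0; rewrite (gt0_powRD _ (- 1) r0) powR_inv1 ?(ltW r0)//.
by move: (r `^ _) (K) => u k; rewrite -!mulrA; congr (_ * (_ * _)); exact: mulrC.
Qed.

Let normZ x r : 0 <= x -> 0 < r ->
  Normc.normc (phiZ x r) <= K * (r `^ (beta - 1 - 1) / (1 + r)).
Proof.
move=> x0 r0.
have h := @normc_rat_fun R beta beta 1 1 x Th A 2 (beta - 1) (ltW beta0) ler01 ler01 x0
  A0 Api (lexx _) ThA (fun r r0 => rat_domZ beta1 r0 x0) r theta r0 theta_Th.
rewrite /phiZ Normc.normcM normc_real gtr0_norm ?invr_gt0//.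
by rewrite powR_predD// ler_wpM2r// invr_ge0 ltW.
Qed.

Let normH r : 0 < r -> Normc.normc (phiH r) <= K * (r `^ (beta - 1 - 1) / (1 + r)).
Proof.
move=> r0.
have h := @normc_rat_fun R 1 beta 1 1 1 Th A 2 (beta - 1) (ltW beta0) ler01 ler01 ler01
  A0 Api (lexx _) ThA (fun r r0 => rat_domH beta1 beta2 r0) r theta r0 theta_Th.
rewrite /phiH Normc.normcM normc_real gtr0_norm ?invr_gt0//.
by rewrite powR_predD// ler_wpM2r// invr_ge0 ltW.
Qed.

Let rint_rat0 (f g : R -> R[i]) :
  \int[mu]_(r in `]0, +oo[) (complex.Im (g r) / r) = 0 ->
  (forall r, f r = g r * (r^-1)%:C%C) -> rint f 0 = 0.
Proof.
move=> h fg; rewrite ray_integralE -[RHS]h; apply: eq_Rintegral => r _.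
by rewrite ray_exp0 mul1r fg ImM /= mulr0 add0r.
Qed.

(** At t = 0 the exponential is 1, and the integral is the imaginary part of that of a [rat_fun]
    against dr / r, which vanishes by [rotation]. *)
Let Z_at0 x : 0 <= x -> rint (phiZ x) 0 = 0.
Proof.
move=> x0.
have [_ h] := @rotation R beta beta 1 1 x Th A 2 (beta - 1) q0 q1 (ler0n _ 2) (ltW beta0)
  (ltW beta0) ler01 ler01 x0 A0 Api (lexx _) ThA (fun r r0 => rat_domZ beta1 r0 x0) theta theta_Th.
exact: rint_rat0 h _.
Qed.

Let H_at0 : rint phiH 0 = 0.
Proof.
have [_ h] := @rotation R 1 beta 1 1 1 Th A 2 (beta - 1) q0 q1 (ler0n _ 2) ler01
  (ltW beta0) ler01 ler01 ler01 A0 Api (lexx _) ThA (fun r r0 => rat_domH beta1 beta2 r0) theta theta_Th.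
exact: rint_rat0 h _.
Qed.
Let bZ x : 0 <= x -> ray_bounded (phiZ x) K (beta - 1).
Proof.
move=> x0 r r0; apply: le_trans (normZ x0 r0) _; rewrite ler_wpM2l ?K0//.
by rewrite ler_pdivrMr ?addr_gt0// ler_peMr ?powR_ge0// lerDl ltW.
Qed.

Let rint_sub (f g h : R -> R[i]) (c t : R) :
  mu.-integrable `]0, +oo[ (EFin \o (fun r => complex.Im (ray_exp a b r t * f r))) ->
  mu.-integrable `]0, +oo[ (EFin \o (fun r => complex.Im (ray_exp a b r t * g r))) ->
  (forall r, 0 < r -> h r = f r - c%:C%C * g r) ->
  rint h t = rint f t - c * rint g t.
Proof.
move=> fi gi hfg; rewrite !ray_integralE.
have mD : measurable (`]0, +oo[ : set RT) by exact: measurable_itv.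
rewrite -(RintegralZl c mD gi) -(RintegralB mD fi); last by apply: integrableRZ.
apply: eq_Rintegral => r; rewrite inE/= in_itv/= andbT => r0; rewrite hfg//.
by rewrite mulrBr ImD ImN mulrCA Im_realM.
Qed.

Let iF t : 0 < t ->
  mu.-integrable `]0, +oo[ (EFin \o (fun r => complex.Im (ray_exp a b r t * phiF r))).
Proof. by move=> t0; exact: (ray_integrable b a0 mF bF beta0 t0). Qed.

Let iG t : 0 < t ->
  mu.-integrable `]0, +oo[ (EFin \o (fun r => complex.Im (ray_exp a b r t * phiG r))).
Proof. by move=> t0; exact: (ray_integrable b a0 mG bG ltr01 t0). Qed.

Let iZ x t : 0 <= x -> 0 <= t ->
  mu.-integrable `]0, +oo[ (EFin \o (fun r => complex.Im (ray_exp a b r t * phiZ x r))).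
Proof.
move=> x0 t0.
exact: (ray_integrable0 b a0 (mZ x) q0 q1 (K := K) (fun r r0 => normZ x0 r0) t0).
Qed.

Let iH t : 0 <= t ->
  mu.-integrable `]0, +oo[ (EFin \o (fun r => complex.Im (ray_exp a b r t * phiH r))).
Proof.
move=> t0.
exact: (ray_integrable0 b a0 mH q0 q1 (K := K) normH t0).
Qed.

Let Z_right0 x : 0 <= x -> rint (phiZ x) t @[t --> 0^'+] --> 0.
Proof.
move=> x0; rewrite -[X in _ --> X](Z_at0 x0).
exact: (@ray_integral_right0 R a b a0 (phiZ x) K (beta - 1) (mZ x) q0 q1 (fun r r0 => normZ x0 r0)).
Qed.

Let H_right0 : rint phiH t @[t --> 0^'+] --> 0.
Proof.
rewrite -[X in _ --> X]H_at0.
exact: (@ray_integral_right0 R a b a0 phiH K (beta - 1) mH q0 q1 normH).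
Qed.

(** Differentiation in t multiplies the density by lambda, and lambda / (lambda + x) = 1 - x /
    (lambda + x). *)
Let dZ (x t : R) : 0 <= x -> 0 < t ->
  is_derive t 1 (rint (phiZ x)) (rint phiF t - x * rint (phiZ x) t).
Proof.
move=> x0 t0.
rewrite -(@rint_sub phiF (phiZ x) (fun r => ray_point a b r * phiZ x r) x t (iF t0) (iZ x0 (ltW t0))).
  exact: (is_derive_ray b a0 K0 (mZ x) (bZ x0) q0 t0).
move=> r r0; rewrite lamE// /phiZ /phiF.
have n1 := w_neq0 r0; have n2 := lam_neq0 r0 x0.
move: n1 n2; move: (lam r) (w r) (x%:C%C) ((r^-1)%:C%C) => l v y u n1 n2.
by field; rewrite n1 n2.
Qed.

Let cis_ray : cis theta = ray_point a b 1.
Proof. by rewrite /ray_point !mulr1 /a opprK. Qed.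

Let bcis : ray_bounded (fun=> cis theta) 1 1.
Proof. by move=> r r0; rewrite normc_cis subrr powRr0 mul1r. Qed.

Let icis t : 0 < t ->
  mu.-integrable `]0, +oo[ (EFin \o (fun r => complex.Im (ray_exp a b r t * cis theta))).
Proof.
by move=> t0; exact: (@ray_integrable R a b a0 (fun=> cis theta) 1 1 t (cmeas_cst _ _) bcis ltr01 t0).
Qed.

(** The density e^(i theta) is d lambda / dr, so the integrand is the r-derivative of Im e^(lambda
    t) / t, which is 0 at both ends. This constant splits off when the densities of G and F are
    multiplied by lambda. *)
Let rint_cis t : 0 < t -> rint (fun=> cis theta) t = 0.
Proof.
move=> t0; rewrite ray_integralE -[RHS](subr0 0) -{2}(mulr0 t^-1).
(* lambda t is symmetric in r and t, so the known derivative in t also serves as the derivative in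
   r. *)
have sym r : ray_exp a b r t = ray_exp a b t r by rewrite /ray_exp (mulrAC a) (mulrAC b).
have E r : complex.Im (ray_exp a b r t * cis theta) =
    t^-1 * complex.Im (ray_point a b t * ray_exp a b t r).
  rewrite sym cis_ray mulrC [in RHS](_ : ray_point a b t = t%:C%C * ray_point a b 1).
    by rewrite -mulrA Im_realM mulKf// gt_eqF.
  by apply/eqP; rewrite eq_complex /=; apply/andP; split; apply/eqP; ring.
have lim0 : expR (- (a * t * r)) @[r --> +oo] --> (0 : R).
  have h : a * t * s @[s --> +oo] --> +oo.
    by under eq_cvg do rewrite mulrC; apply: gt0_cvgMly; [rewrite mulr_gt0|exact: cvg_id].
  exact: (cvg_comp _ _ h (@cvgr_expR R)).
apply: (@FTC_0y R (fun r => complex.Im (ray_exp a b r t * cis theta))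
   (fun r => t^-1 * complex.Im (ray_exp a b t r)) 0 (t^-1 * 0)).
- move=> r r0; rewrite E; have [_ d] := cder_ray_exp a b t r.
  exact: is_deriveZ.
- move=> r r0; rewrite (_ : (fun r => _) = (fun r => complex.Im (ray_exp a b t r * cis theta))).
    have [_ d] := cderM (cder_ray_exp a b t r) (cder_cst (cis theta) r).
    exact: is_derive_continuous d.
  by apply/funext => s; rewrite sym.
- rewrite -[X in _ --> X](mulr0 t^-1); apply: cvgMr.
  apply: cvg_at_right_filter.
  have [_ d] := cder_ray_exp a b t 0; have := is_derive_continuous d.
  by move=> h; rewrite -[X in _ --> X]/(complex.Im (1 : R[i])) -(ray_exp0 a b t); exact: h.
- apply: cvgMr.
  have [] // := @le_normc_powR_div1D_cvg0 R (+oo) _ (ray_exp a b t) (fun r => expR (- (a * t * r))) 1.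
  by near=> r; rewrite mul1r -sym normc_ray_exp.
- exact: icis.
Unshelve. all: end_near. Qed.
Let dG (t : R) : 0 < t -> is_derive t 1 (rint phiG) (- rint phiG t).
Proof.
move=> t0.
have E : - rint phiG t = rint (fun r => ray_point a b r * phiG r) t.
  rewrite [RHS](@rint_sub (fun=> cis theta) phiG _ 1 t (icis t0) (iG t0)) ?rint_cis// ?sub0r ?mul1r//.
  move=> r r0; rewrite lamE// /phiG rmorph1 mul1r; have := lam_neq0 r0 ler01.
  by rewrite rmorph1; move: (lam r) (cis theta) => l u n; field.
rewrite E; exact: (is_derive_ray b a0 kapV mG bG ltr01 t0).
Qed.

Let C := rint phiG 1 * expR 1.

Let G_exp t : 0 < t -> rint phiG t = C * expR (- t).
Proof.
move=> t0; rewrite expRN; apply: (canRL (mulfK (lt0r_neq0 (expR_gt0 t)))).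
apply: (@is_derive_0_itv R (fun t => rint phiG t * expR t) 0 (Num.max 1 t + 1)).
- move=> z /andP[z0 _]; have h := dG z0.
  apply: is_derive_eq; rewrite /GRing.scale/=.
  by move: (expR z) (rint phiG z) => u v; ring.
- by rewrite t0/= ltr_pwDr// le_max lexx orbT.
- by rewrite ltr01/= ltr_pwDr// le_max lexx.
Qed.

(** Over the common denominator this is lambda (w + 1) + w - lambda = w (lambda + 1). [phiG] carries
    the 1 / r behaviour at infinity; the other two densities are integrable even at t = 0. *)
Let F_split t : 0 < t -> rint phiF t = rint phiG t + (rint (phiZ 1) t - rint phiH t).
Proof.
move=> t0; have t00 := ltW t0.
have iZH : mu.-integrable `]0, +oo[ (EFin \o (fun r =>
    complex.Im (ray_exp a b r t * (phiZ 1 r - phiH r)))).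
  apply: eq_integrableR (integrableRD _ (iZ ler01 t00) (integrableRZ (-1) _ (iH t00))).
  - exact: measurable_itv.
  - by move=> r _; rewrite mulrBr ImD ImN mulN1r.
  - exact: measurable_itv.
  - exact: measurable_itv.
rewrite [LHS](@rint_sub phiG (fun r => phiZ 1 r - phiH r) phiF (-1) t (iG t0) iZH); last first.
  move=> r r0; rewrite /phiG /phiZ /phiH /phiF -(lam_cis r0).
  have n1 := w_neq0 r0; have := lam_neq0 r0 ler01; rewrite rmorphN rmorph1 => n2.
  move: n1 n2; move: (lam r) (w r) ((r^-1)%:C%C) => l v u n1 n2.
  by field; rewrite n1 n2.
rewrite (@rint_sub (phiZ 1) phiH (fun r => phiZ 1 r - phiH r) 1 t (iZ ler01 t00) (iH t00)); last first.
  by move=> r r0; rewrite rmorph1 mul1r.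
by rewrite mulN1r opprK mul1r.
Qed.

Let F_right0 : rint phiF t @[t --> 0^'+] --> C.
Proof.
have h1 : C * expR (- t) @[t --> 0^'+] --> C * expR (- 0).
  apply: cvgMr; apply: cvg_at_right_filter.
  apply: (@continuous_comp _ _ _ -%R expR); first exact: opp_continuous.
  exact: continuous_expR.
have h : C * expR (- t) + (rint (phiZ 1) t - rint phiH t) @[t --> 0^'+] -->
    C * expR (- 0) + (0 - 0).
  by apply: cvgD h1 _; apply: cvgB; [apply: (Z_right0 ler01)|exact: H_right0].
rewrite oppr0 expR0 !addr0 mulr1 in h.
apply: cvg_trans h; apply: near_eq_cvg; near=> t.
have t0 : 0 < t by near: t; exact: nbhs_right_gt.
by rewrite F_split// G_exp.
Unshelve. all: end_near. Qed.

(** I^(beta - 1) should multiply the density by lambda^(1 - beta). [RL_F] proves that it does, and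
    [dF] that - F' has this same density. *)
Definition phiR r : R[i] := polar (1 - beta) r theta * phiF r.

Let bR : ray_bounded phiR kap^-1 1.
Proof.
move=> r r0; rewrite /phiR Normc.normcM normc_polar subrr powRr0 mulr1.
have -> : kap^-1 = r `^ (1 - beta) * (kap^-1 * r `^ (beta - 1)).
  rewrite mulrCA -(gt0_powRD _ _ r0) (_ : 1 - beta + (beta - 1) = 0); last by ring.
  by rewrite powRr0 mulr1.
by rewrite ler_wpM2l ?powR_ge0//; exact: bF.
Qed.

Let mR : cmeas phiR.
Proof. by apply: cmeasM mF; apply: cmeas_polar; exact: measurable_id. Qed.

(** lambda times [phiF] is the constant density e^(i theta), whose integral is 0, minus lambda / (r
    (w + 1)); and lambda = lambda^(1 - beta) w makes the latter [phiR]. *)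
Let dF (t : R) : 0 < t -> is_derive t 1 (rint phiF) (- rint phiR t).
Proof.
move=> t0.
have iR := @ray_integrable R a b a0 phiR kap^-1 1 t mR bR ltr01 t0.
have E : - rint phiR t = rint (fun r => ray_point a b r * phiF r) t.
  rewrite [RHS](@rint_sub (fun=> cis theta) phiR _ 1 t (icis t0) iR) ?rint_cis// ?sub0r ?mul1r//.
  move=> r r0; rewrite lamE// /phiR /phiF rmorph1 mul1r -(lam_cis r0).
  have n1 := w_neq0 r0.
  have -> : polar (1 - beta) r theta * (w r * (w r + 1)^-1 * (r^-1)%:C%C) =
      lam r * ((w r + 1)^-1 * (r^-1)%:C%C).
    have -> : lam r = polar (1 - beta) r theta * w r.
      by rewrite /w -(polarD _ _ _ r0) subrK.
    by move: (polar _ _ _) (w r) ((r^-1)%:C%C) => x y z; rewrite -!mulrA.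
  by move: n1; move: (lam r) (w r) ((r^-1)%:C%C) => l v u n1; field.
rewrite E; exact: (is_derive_ray b a0 kapV mF bF beta0 t0).
Qed.
(** At 0 the value is the limit C and not the integral: [phiF] is not integrable at infinity, so the
    integral at t = 0 need not be the limit. *)
Let Fc t := if 0 < t then rint phiF t else C.

Let Fc_cvg0 : Fc t @[t --> 0^'+] --> Fc 0.
Proof.
rewrite /Fc ltxx; apply: cvg_trans F_right0; apply: near_eq_cvg; near=> t.
have t0 : 0 < t by near: t; exact: nbhs_right_gt.
by rewrite t0.
Unshelve. all: end_near. Qed.

Let dFc (t : R) : 0 < t -> is_derive t 1 Fc (- rint phiR t).
Proof.
move=> t0; have h := dF t0.
apply: near_eq_is_derive h; near=> s.
have s0 : 0 < s by near: s; exact: lt_nbhsr.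
by rewrite /Fc s0.
Unshelve. all: end_near. Qed.

Let cFc : {within `[0, +oo[, continuous Fc}.
Proof. exact: (within_0y_continuous dFc Fc_cvg0). Qed.

Let mFc : measurable_fun [set: RT] Fc.
Proof.
have -> : Fc = (fun t => if (0 : R) < t then (rint phiF \_ (`]0, +oo[ : set RT)) t else C).
  apply/funext => t; rewrite /Fc; case: ifPn => // t0.
  by rewrite patchE ifT// inE/= in_itv/= t0.
apply: measurable_fun_ifT; [by apply: measurable_fun_ltr| |exact: measurable_cst].
apply/(measurable_restrictT _ _).1; first exact: measurable_itv.
apply: (eq_measurable_fun Fc); first by move=> t; rewrite inE/= in_itv/= andbT /Fc => ->.
apply: measurable_funS (continuous_0y_measurable cFc); first exact: measurable_itv.
by [].
Qed.

Let duhamel_integrable x t : 0 <= x -> 0 < t ->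
  mu.-integrable `]0, t[ (EFin \o (fun s => expR (- ((t - s) * x)) * Fc s)).
Proof.
move=> x00 t0; have i1 := RL1_integrable (RL_integrable_continuous ltr01 t0 cFc).
apply: (@le_integrableR R _ _ (fun s => `|Fc s|)).
- exact: measurable_itv0.
- by apply: measurable_funTS; apply: measurable_funM mFc; meas.
- move=> s; rewrite /= in_itv/= => /andP[s0 st].
  rewrite normrM ger0_norm ?expR_ge0// -[leRHS]mul1r ler_wpM2r//.
  by rewrite -expR0 ler_expR oppr_le0 mulr_ge0// subr_ge0 ltW.
- exact: (integrable_norm i1).
Qed.

(* Duhamel's formula for [Z' = F - x Z], [Z (0) = 0]. *)
Let Z_duhamel x t : 0 < x -> 0 < t ->
  \int[mu]_(s in `]0, t[) (expR (- ((t - s) * x)) * Fc s) = rint (phiZ x) t.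
Proof.
move=> x0 t0; rewrite -[RHS]subr0.
have x00 := ltW x0.
have eE (s : R) : is_derive s 1 (fun s => expR (- ((t - s) * x))) (x * expR (- ((t - s) * x))).
  by apply: is_derive_eq; rewrite /GRing.scale/=; move: (expR _) => u; ring.
apply: (@FTC_oo R (fun s => expR (- ((t - s) * x)) * Fc s)
  (fun s => expR (- ((t - s) * x)) * rint (phiZ x) s)).
- exact: t0.
- move=> s /andP[s0 _]; have h := dZ x00 s0; have h2 := eE s.
  apply: is_derive_eq; rewrite /GRing.scale/= /Fc s0.
  by move: (expR _) (rint _ _) (rint _ _) => u v z; ring.
- move=> s /andP[s0 _]; apply: cvgM; first exact: is_derive_continuous (eE s).
  exact: is_derive_continuous (dFc s0).
- rewrite -[X in _ --> X](mulr0 (expR (- ((t - 0) * x)))).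
  apply: cvgM; last exact: Z_right0.
  by apply: cvg_at_right_filter; exact: is_derive_continuous (eE 0).
- have := is_derive_continuous (dZ x00 t0) => hc.
  rewrite -[X in _ --> X]mul1r -expR0 -[X in expR X]oppr0 -[X in - X](mul0r x) -(subrr t).
  apply: cvgM; apply: cvg_at_left_filter; last exact: hc.
  exact: is_derive_continuous (eE t).
- exact: duhamel_integrable.
Qed.
Let mD0 : measurable (`]0, +oo[ : set RT). Proof. exact: measurable_itv. Qed.

Let p0 : 0 < 2 - beta. Proof. by rewrite subr_gt0. Qed.
Let p1 : 2 - beta < 1. Proof. by move: beta1; lra. Qed.

Let Gp := Gamma (2 - beta).
Let Gq := Gamma (beta - 1).

(** [Gp] (t - s)^(beta - 2) is the integral of x^(1 - beta) e^(- x (t - s)) over x > 0. After the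
    exchange, the inner integral over s is given by [Z_duhamel], without boundary term since Z
    vanishes at 0. *)
Let RL_laplace t : 0 < t ->
  Gp * Gq * RL (beta - 1) Fc t =
  \int[mu]_(x in `]0, +oo[) (x `^ (2 - beta - 1) * rint (phiZ x) t).
Proof.
move=> t0.
have Gq0 : Gq != 0 by rewrite gt_eqF// Gamma_gt0.
have iFc : RL_integrable (beta - 1) Fc t by exact: RL_integrable_continuous.
pose k s x : R := x `^ (2 - beta - 1) * expR (- ((t - s) * x)).
have k_ge0 s x : 0 <= k s x by rewrite mulr_ge0 ?powR_ge0 ?expR_ge0.
have mk s : measurable_fun (`]0, +oo[ : set RT) (k s) by rewrite /k; meas.
have kE s : s < t -> (\int[mu]_(x in `]0%R, +oo[) (k s x)%:E =
    (Gp * (t - s) `^ (beta - 1 - 1))%:E)%E.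
  move=> st; rewrite Gamma_scale ?subr_gt0//; congr (_ * _ `^ _)%:E; ring.
have [] := @fubini_dominated R `]0, t[ `]0, +oo[ (fun s x => k s x * Fc s)
  (fun s x => `|Fc s| * k s x) (fun s => Gp * `|(t - s) `^ (beta - 1 - 1) * Fc s|) (measurable_itv0 t) mD0.
- apply: measurable_funM.
    rewrite /k; apply: measurable_funM.
      by apply: measurable_powR_comp; exact: measurable_snd.
    apply: measurable_expR_comp; apply: measurable_opp_comp; apply: measurable_funM.
      by apply: measurable_funB; [exact: measurable_cst|exact: measurable_fst].
    exact: measurable_snd.
  by apply: measurableT_comp mFc _; exact: measurable_fst.
- by move=> s _; apply: measurable_funM; [exact: measurable_cst|exact: mk].
- by move=> s x _ _; rewrite normrM (ger0_norm (k_ge0 s x)) mulrC.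
- move=> s; rewrite /= in_itv/= => /andP[s0 st].
  rewrite ge0_integralZ//.
  rewrite kE// -EFinM normrM (ger0_norm (powR_ge0 _ _)).
  by congr (_%:E); move: (_ `^ _) (Gp) `|_| => u v z; ring.
- by apply: integrableRZ (integrable_norm iFc); exact: measurable_itv0.
move=> _ E.
transitivity (\int[mu]_(s in `]0, t[) \int[mu]_(x in `]0, +oo[) (k s x * Fc s)).
  rewrite RLE mulrA mulfK// -(RintegralZl _ (measurable_itv0 t) iFc).
  apply: eq_Rintegral => s; rewrite inE/= in_itv/= => /andP[s0 st].
  have [ik Ik] := ge0_integrable_Rintegral mD0 (mk s) (fun x _ => k_ge0 s x) (kE s st).
  under [RHS]eq_Rintegral do rewrite mulrC.
  by rewrite (RintegralZl _ mD0 ik) Ik mulrA mulrC.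
rewrite E; apply: eq_Rintegral => x; rewrite inE/= in_itv/= andbT => x0.
rewrite -(Z_duhamel x0 t0) -RintegralZl//; last first.
  by apply: duhamel_integrable => //; exact: ltW.
by apply: eq_Rintegral => s _; rewrite /k mulrA.
Qed.

Let stieltjes_dom r x : 0 < r -> 0 < x ->
  x `^ (2 - beta) / ((x `^ 1 + r) * (x `^ 0 + 0)) <= (1 + r^-1) * (x `^ (2 - beta) / (1 + x)).
Proof.
move=> r0 x0; rewrite powRr1 ?(ltW x0)// powRr0 addr0 mulr1 mulrCA ler_wpM2l ?powR_ge0//.
have xr : 0 < x + r by rewrite addr_gt0.
rewrite -[leLHS]mul1r ler_pdivrMr// mulrAC ler_pdivlMr ?addr_gt0// mul1r.
have -> : (1 + r^-1) * (x + r) = 1 + x + (r + x / r) by field; rewrite gt_eqF.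
by rewrite lerDl addr_ge0 ?divr_ge0 ?ltW.
Qed.

(** Since lambda + x = e^(i theta) (r + x e^(- i theta)), an angle theta in lambda amounts to an
    angle - theta in x. The Stieltjes integral at lambda thus becomes, up to a phase, the one at r >
    0 taken over a rotated ray. *)
Let Q r x : R[i] := rat_fun (2 - beta) 1 r 0 0 x (- theta).

Let Qbnd r x : 0 < r -> 0 < x ->
  Normc.normc (Q r x * (x^-1)%:C%C) <= kap ^- 2 * (1 + r^-1) * (x `^ (2 - beta - 1) / (1 + x)).
Proof.
move=> r0 x0; have nT : `|- theta| < Th by rewrite normrN.
have T0 : 0 * Th <= A by rewrite mul0r.
have rV : 0 <= 1 + r^-1 by rewrite addr_ge0 // invr_ge0 ltW.
have h := @normc_rat_fun R (2 - beta) 1 r 0 0 Th A (1 + r^-1) (2 - beta) ler01 (lexx 0) (ltW r0)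
  (lexx 0) A0 Api ThA T0 (fun x x0 => stieltjes_dom r0 x0) x (- theta) x0 nT.
rewrite Normc.normcM normc_real gtr0_norm ?invr_gt0//.
rewrite (gt0_powRD _ (- 1) x0) powR_inv1 ?(ltW x0)//.
apply: le_trans (ler_wpM2r _ h) _; first by rewrite invr_ge0 ltW.
by rewrite le_eqVlt -/kap; apply/orP; left; apply/eqP; move: (_ `^ _) (kap ^- 2) => u v; ring.
Qed.

Let mQ r : cmeas (fun x => Q r x * (x^-1)%:C%C).
Proof.
apply: cmeasM => //; rewrite /Q /rat_fun; cmeas_tac; exact: measurable_id.
Qed.

Let Q_point r x : 0 < r -> 0 < x ->
  (x `^ (2 - beta - 1))%:C%C * (lam r + x%:C%C)^-1 =
  cis ((1 - beta) * theta) * (Q r x * (x^-1)%:C%C).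
Proof.
move=> r0 x0; rewrite /Q /rat_fun.
have -> : polar 0 x (- theta) + 0%:C%C = 1 by rewrite polar0 rmorph0 addr0.
have -> : polar 1 x (- theta) + r%:C%C = cis (- theta) * (lam r + x%:C%C).
  rewrite /lam !polar1 ?ltW// mulrDr (addrC (_ * (_ * _))) (mulrC (cis (- theta)) x%:C%C).
  by rewrite mulrCA -cisD addNr cis0 mulr1.
have c0 t : cis t != 0 :> R[i] by rewrite -normc_gt0 normc_cis.
have -> : (x `^ (2 - beta - 1))%:C%C = (x `^ (2 - beta))%:C%C * (x^-1)%:C%C.
  by rewrite (gt0_powRD _ (- 1) x0) powR_inv1 ?(ltW x0)// rmorphM.
rewrite /polar invr1 mulr1 invfM.
have -> : cis ((2 - beta) * - theta) = (cis ((1 - beta) * theta))^-1 * cis (- theta).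
  apply: (mulfI (c0 ((1 - beta) * theta))); rewrite mulVKf// -cisD; congr cis; ring.
have := lam_neq0 r0 (ltW x0).
move: (c0 (- theta)) (c0 ((1 - beta) * theta)).
move: (cis (- theta)) (cis ((1 - beta) * theta)) (lam r + x%:C%C) ((x `^ (2 - beta))%:C%C)
  ((x^-1)%:C%C) => u v l y z u0 v0 l0.
by field; rewrite u0 v0 l0.
Qed.

Let stieltjes_real r x : 0 < x ->
  rat_fun (2 - beta) 1 r 0 0 x 0 = (x `^ (2 - beta) / (r + x))%:C%C.
Proof.
move=> x0; rewrite /rat_fun !polar_phi0 powRr0 powRr1 ?(ltW x0)//.
rewrite rmorph0 addr0 rmorph1 invr1 mulr1 -rmorphD -fmorphV -rmorphM.
by rewrite (addrC x).
Qed.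

(* [int_0^oo x^(1 - beta) / (lambda + x) dx = Gamma (2 - beta) Gamma (beta - 1) lambda^(1 - beta)] *)
Let stieltjes_ray (W : R[i]) r : 0 < r ->
  \int[mu]_(x in `]0, +oo[)
    complex.Im (W * ((x `^ (2 - beta - 1))%:C%C * (lam r + x%:C%C)^-1)) =
  Gp * Gq * complex.Im (W * polar (1 - beta) r theta).
Proof.
move=> r0; have nT : `|- theta| < Th by rewrite normrN.
have T0 : 0 * Th <= A by rewrite mul0r.
have rV : 0 <= 1 + r^-1 by rewrite addr_ge0 // invr_ge0 ltW.
have [hRe hIm] := @rotation R (2 - beta) 1 r 0 0 Th A (1 + r^-1) (2 - beta) p0 p1 rV
  (ltW p0) ler01 (lexx 0) (ltW r0) (lexx 0) A0 Api ThA T0 (fun x x0 => stieltjes_dom r0 x0) (- theta) nT.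
have dom : mu.-integrable `]0, +oo[ (EFin \o (fun x =>
    kap ^- 2 * (1 + r^-1) * (x `^ (2 - beta - 1) / (1 + x)))).
  by apply: integrableRZ => //; exact: powR_div1D_integrable.
have [mq1 mq2] := mQ r.
have iRe : mu.-integrable `]0, +oo[ (EFin \o (fun x => complex.Re (Q r x * (x^-1)%:C%C))).
  apply: le_integrableR dom => //; first exact: measurable_funTS.
  move=> x; rewrite /= in_itv/= andbT => x0.
  exact: le_trans (Re_le_normc _) (Qbnd r0 x0).
have iIm : mu.-integrable `]0, +oo[ (EFin \o (fun x => complex.Im (Q r x * (x^-1)%:C%C))).
  apply: le_integrableR dom => //; first exact: measurable_funTS.
  move=> x; rewrite /= in_itv/= andbT => x0.
  exact: le_trans (Im_le_normc _) (Qbnd r0 x0).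
(* The constant phase is moved to W. By rotation the remaining integral is real and equal to the
   classical one, so only Im V enters. *)
pose V := W * cis ((1 - beta) * theta).
transitivity (\int[mu]_(x in `]0, +oo[) (complex.Re V * complex.Im (Q r x * (x^-1)%:C%C) +
    complex.Im V * complex.Re (Q r x * (x^-1)%:C%C))).
  apply: eq_Rintegral => x; rewrite inE/= in_itv/= andbT => x0.
  by rewrite Q_point// mulrA ImM.
rewrite RintegralD// ?RintegralZl//; try exact: integrableRZ.
have -> : \int[mu]_(x in `]0, +oo[) complex.Im (Q r x * (x^-1)%:C%C) = 0.
  rewrite -[RHS]hIm; apply: eq_Rintegral => x _.
  by rewrite mulrC Im_realM mulrC.
have -> : \int[mu]_(x in `]0, +oo[) complex.Re (Q r x * (x^-1)%:C%C) =
    Gp * Gq * r `^ (1 - beta).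
  have E : Gp * Gq * r `^ (1 - beta) =
      \int[mu]_(x in `]0, +oo[) (x `^ (2 - beta - 1) / (r + x)).
    have h := @ge0_integral_stieltjes R (2 - beta) r p0 p1 r0.
    have e1 : 1 - (2 - beta) = beta - 1 by ring.
    have e2 : 2 - beta - 1 = 1 - beta by ring.
    rewrite e1 {2}e2 in h.
    by rewrite /Rintegral h.
  rewrite E; transitivity (\int[mu]_(x in `]0, +oo[)
      (complex.Re (rat_fun (2 - beta) 1 r 0 0 x (- theta)) / x)).
    by apply: eq_Rintegral => x _; rewrite mulrC Re_realM mulrC.
  rewrite hRe; apply: eq_Rintegral => x xD.
  have x0 : 0 < x by move: xD; rewrite inE/= in_itv/= andbT.
  by rewrite stieltjes_real//= (gt0_powRD _ (- 1) x0) powR_inv1 ?(ltW x0)// mulrAC.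
rewrite mulr0 add0r; have -> : W * polar (1 - beta) r theta = (r `^ (1 - beta))%:C%C * V.
  by rewrite /V /polar; move: (cis _) (_%:C%C) => u v; ring.
by rewrite Im_realM; move: (Gp) (Gq) (complex.Im V) (_ `^ _) => u v y z; ring.
Qed.
(** By [RL_laplace] this is an integral over x of ray integrals with density [phiF] / (lambda + x).
    Integrating over x first, [stieltjes_ray] produces the density [phiR]. *)
Let RL_F t : 0 < t -> RL (beta - 1) Fc t = rint phiR t.
Proof.
move=> t0.
have Gp0 : 0 < Gp by exact: Gamma_gt0.
have Gq0 : 0 < Gq by exact: Gamma_gt0.
have GG : Gp * Gq != 0 by rewrite mulf_neq0// gt_eqF.
apply: (mulfI GG); rewrite RL_laplace//.
pose f r x : R := complex.Im (ray_exp a b r t * phiF r *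
  ((x `^ (2 - beta - 1))%:C%C * (lam r + x%:C%C)^-1)).
pose k r : R := kap ^- 2 * (expR (- (a * t * r)) * r `^ (beta - 1)).
have k0 r : 0 <= k r by rewrite !mulr_ge0 ?expR_ge0 ?powR_ge0// invr_ge0 exprn_ge0// ltW.
have mf : measurable_fun [set: RT * RT] (fun z => f z.1 z.2).
  have m1 : measurable_fun [set: RT * RT] (fun z : RT * RT => z.1 : R) by exact: measurable_fst.
  have m2 : measurable_fun [set: RT * RT] (fun z : RT * RT => z.2 : R) by exact: measurable_snd.
  suff [_ ?] : cmeas (fun z : RT * RT => ray_exp a b z.1 t * phiF z.1 *
    ((z.2 `^ (2 - beta - 1))%:C%C * (lam z.1 + z.2%:C%C)^-1)) by [].
  by rewrite /ray_exp /phiF /lam /w; cmeas_tac; meas.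
(* After integration of the majorant over x, the powers r^(beta - 1) and r^(1 - beta) cancel; r^(1 -
   1) is kept to match [ray_dom_integrable] at m = 1. *)
have [] := @fubini_dominated R `]0, +oo[ `]0, +oo[ f
  (fun r x => k r * (x `^ (2 - beta - 1) / (r + x)))
  (fun r => kap ^- 2 * (Gp * Gq) * (r `^ (1 - 1) * expR (- (a * t * r)))) mD0 mD0 mf.
- by move=> r _; meas.
- move=> r x; rewrite /= !in_itv/= !andbT => r0 x0.
  apply: le_trans (Im_le_normc _) _.
  rewrite Normc.normcM [X in X * _]Normc.normcM [X in _ * X]Normc.normcM normc_ray_exp.
  rewrite normc_real ger0_norm ?powR_ge0//.
  have h1 := bF r0; have h2 := denV_le r0 ler01 ThA (ltW x0).
  rewrite powRr1 ?(ltW r0)// in h2.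
  rewrite (_ : k r * _ = (expR (- (a * t * r)) * (kap^-1 * r `^ (beta - 1))) *
    (x `^ (2 - beta - 1) * (kap^-1 * (r + x)^-1))).
    by apply: ler_pM; rewrite ?mulr_ge0 ?expR_ge0 ?normc_ge0 ?powR_ge0//;
      apply: ler_wpM2l; rewrite ?expR_ge0 ?powR_ge0.
  by rewrite /k; move: (expR _) (_ `^ _) (_ `^ _) => u v z; rewrite -exprVn; ring.
- move=> r; rewrite /= in_itv/= andbT => r0.
  rewrite ge0_integralZ//; last first.
  + by move=> x; rewrite /= in_itv/= andbT => x0; rewrite divr_ge0 ?powR_ge0 ?addr_ge0 ?ltW.
  + by meas.
  have h := @ge0_integral_stieltjes R (2 - beta) r p0 p1 r0.
  rewrite h (_ : 1 - (2 - beta) = beta - 1); last by ring.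
  rewrite -EFinM -/Gp -/Gq subrr powRr0 mul1r /k; congr (_%:E).
  have : r `^ (beta - 1) * r `^ (2 - beta - 1) = 1.
    by rewrite -(gt0_powRD _ _ r0) (_ : beta - 1 + (2 - beta - 1) = 0) ?powRr0//; ring.
  move: (expR _) (_ `^ _) (_ `^ _) (Gp) (Gq) => u v z y y' vz.
  by rewrite -[RHS]mulr1 -vz; ring.
- exact: (ray_dom_integrable a0 _ ltr01 t0).1.
move=> _ E.
have iR := @ray_integrable R a b a0 phiR kap^-1 1 t mR bR ltr01 t0.
rewrite ray_integralE -(RintegralZl _ mD0 iR).
transitivity (\int[mu]_(x in `]0, +oo[) \int[mu]_(r in `]0, +oo[) f r x).
  apply: eq_Rintegral => x; rewrite inE/= in_itv/= andbT => x0.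
  rewrite ray_integralE -(RintegralZl _ mD0 (iZ (ltW x0) (ltW t0))).
  apply: eq_Rintegral => r _; rewrite -Im_realM; congr complex.Im.
  rewrite /phiZ /phiF; move: (ray_exp _ _ _ _) (w r) (w r + 1) (_^-1) (_%:C%C) (_%:C%C).
  by move=> u v v' l y z; ring.
rewrite -E; apply: eq_Rintegral => r rD.
have r0 : 0 < r by move: rD; rewrite inE/= in_itv/= andbT.
rewrite (stieltjes_ray _ r0) /phiR.
by rewrite -(mulrA (ray_exp _ _ _ _)) (mulrC (phiF r)).
Qed.
(** Re lambda < 0 gives |lambda - 1| >= max (1, r), which bounds r^(2 - beta) because 0 < 2 - beta <
    1. *)
Let lam1_ge r : 0 < r -> r `^ (2 - beta) <= Normc.normc (lam r - 1).
Proof.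
move=> r0; have r00 := ltW r0.
have h : Num.max 1 (r ^+ 2) <= complex.Re (lam r - 1) ^+ 2 + complex.Im (lam r - 1) ^+ 2.
  rewrite -lamE// ReD ImD ReN ImN /= oppr0 addr0.
  have ab : a ^+ 2 + b ^+ 2 = 1 by rewrite /a sqrrN cos2Dsin2.
  have -> : (- (a * r) - 1) ^+ 2 + (b * r) ^+ 2 = 1 + 2 * (a * r) + (a ^+ 2 + b ^+ 2) * r ^+ 2.
    by move: (a) (b) => u v; ring.
  have ar : 0 <= a * r by rewrite mulr_ge0// ltW.
  have r2 : 0 <= r ^+ 2 by exact: sqr_ge0.
  by rewrite ab mul1r ge_max; apply/andP; split; lra.
rewrite normcE2; have [r1|r1] := leP 1 r.
  apply: (@le_trans _ _ (r `^ 1)); first by rewrite ler_powR// ltW.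
  rewrite powRr1// -[leLHS]ger0_norm// -sqrtr_sqr ler_wsqrtr//.
  by apply: le_trans h; rewrite le_max lexx orbT.
apply: (@le_trans _ _ 1).
  by rewrite -[leRHS](powRr0 r); apply: ger_powR; rewrite ?r0 ?(ltW r1) ?(ltW p0).
by rewrite -[leLHS]sqrtr1 ler_wsqrtr//; apply: le_trans h; rewrite le_max lexx.
Qed.

Let lam1_neq0 r : 0 < r -> lam r - 1 != 0.
Proof.
by move=> r0; rewrite -normc_gt0; apply: lt_le_trans (lam1_ge r0); exact: powR_gt0.
Qed.

Let normP r : 0 < r -> Normc.normc (phiP r) <= kap^-1 * (r `^ (beta - 1 - 1) / (1 + r)).
Proof.
move=> r0; rewrite /phiP Normc.normcM normc_cis mul1r Normc.normcM.
have h := @denV_le 1 r 1 r0 ler01 ThA ler01; rewrite powRr1 ?(ltW r0)// (addrC r) in h.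
rewrite (mulrC (r `^ _)) mulrA; apply: ler_pM; rewrite ?normc_ge0//.
rewrite Normc.normcV (_ : beta - 1 - 1 = - (2 - beta)); last by ring.
rewrite powRN lef_pV2 ?lam1_ge// posrE; last exact: powR_gt0.
by rewrite normc_gt0 lam1_neq0.
Qed.

Let bP : ray_bounded phiP kap^-1 (beta - 1).
Proof.
move=> r r0; apply: le_trans (normP r0) _; rewrite ler_wpM2l//.
by rewrite ler_pdivrMr ?addr_gt0// ler_peMr ?powR_ge0// lerDl ltW.
Qed.

Let iP t : 0 <= t ->
  mu.-integrable `]0, +oo[ (EFin \o (fun r => complex.Im (ray_exp a b r t * phiP r))).
Proof. by move=> t0; exact: (ray_integrable0 b a0 mP q0 q1 (K := kap^-1) normP t0). Qed.

Let dP (t : R) : 0 < t -> is_derive t 1 (rint phiP) (rint phiG t + rint phiP t).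
Proof.
move=> t0.
have E : rint phiG t + rint phiP t = rint (fun r => ray_point a b r * phiP r) t.
  rewrite [RHS](@rint_sub phiG phiP _ (-1) t (iG t0) (iP (ltW t0))) ?mulN1r ?opprK//.
  move=> r r0; rewrite lamE// /phiG /phiP rmorphN rmorph1.
  have := lam_neq0 r0 ler01; rewrite rmorph1 => n1; have n2 := lam1_neq0 r0.
  by move: n1 n2; move: (lam r) (cis theta) => l u n1 n2; field; rewrite n1 n2.
rewrite E; exact: (is_derive_ray b a0 kapV mP bP q0 t0).
Qed.

(** Explicitly Im [phiP] = - b (1 + r^2) / |lambda^2 - 1|^2, and |lambda^2 - 1| <= 1 + r^2. *)
Let P_neg r : 0 < r -> complex.Im (phiP r) <= - (b / (1 + r ^+ 2)).
Proof.
move=> r0; have r2 : 0 <= r ^+ 2 by exact: sqr_ge0.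
rewrite /phiP -invfM -lamE// (_ : (ray_point a b r + 1) * (ray_point a b r - 1) =
    Complex ((a ^+ 2 - b ^+ 2) * r ^+ 2 - 1) (- (2 * a * b * r ^+ 2))); last first.
  apply/eqP; rewrite eq_complex ReM ImM /=; apply/andP; split; apply/eqP;
    by move: (a) (b) => u v; ring.
rewrite ImM ReV ImV /= -/b opprK; have ct : cos theta = - a by rewrite /a opprK.
have ab : a ^+ 2 + b ^+ 2 = 1 by rewrite /a sqrrN cos2Dsin2.
set N := (_ ^+ 2 + _ ^+ 2).
have NE : N = (1 + r ^+ 2) ^+ 2 - 4 * a ^+ 2 * r ^+ 2.
  have e : b ^+ 2 = 1 - a ^+ 2 by rewrite -ab addrC addKr.
  rewrite /N; transitivity (((a ^+ 2 - b ^+ 2) * r ^+ 2 - 1) ^+ 2 +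
    4 * a ^+ 2 * b ^+ 2 * (r ^+ 2) ^+ 2); first by move: (a) (b) => u v; ring.
  by rewrite e; move: (a) => u; ring.
have r1 : 0 < 1 + r ^+ 2 by rewrite ltr_pwDl.
have Nle : N <= (1 + r ^+ 2) ^+ 2.
  by rewrite NE gerBl mulr_ge0// mulr_ge0// sqr_ge0.
have N0 : 0 < N.
  have -> : N = (1 - r ^+ 2) ^+ 2 + 4 * b ^+ 2 * r ^+ 2.
    have e : a ^+ 2 = 1 - b ^+ 2 by rewrite -ab addrK.
    by rewrite NE e; move: (b) => u; ring.
  by rewrite ltr_wpDl ?sqr_ge0// !mulr_gt0// exprn_gt0.
have -> : cos theta * (2 * a * b * r ^+ 2 / N) + b * (((a ^+ 2 - b ^+ 2) * r ^+ 2 - 1) / N) =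
    - (b * (1 + (a ^+ 2 + b ^+ 2) * r ^+ 2) / N).
  by rewrite ct; move: (a) (b) (N) => u v n; ring.
rewrite ab mul1r lerN2 -mulrA ler_wpM2l ?(ltW b0)//.
rewrite ler_pdivlMr// mulrC ler_pdivrMr// -expr2//.
Qed.

Let P_at0 : rint phiP 0 < 0.
Proof.
rewrite ray_integralE; have i0 := iP (lexx 0).
have i1 : mu.-integrable `]0, +oo[ (EFin \o (fun r => complex.Im (phiP r))).
  by apply: eq_integrableR i0 => // r _; rewrite ray_exp0 mul1r.
rewrite (_ : \int[mu]_(r in `]0, +oo[) _ = \int[mu]_(r in `]0, +oo[) complex.Im (phiP r)); last first.
  by apply: eq_Rintegral => r _; rewrite ray_exp0 mul1r.
rewrite -oppr_gt0 -mulN1r -RintegralZl//.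
apply: (@lt_le_trans _ _ (b / 2)); first by rewrite divr_gt0.
rewrite -lee_fin /Rintegral fineK; last first.
  by apply: integrable_fin_num => //; exact: (integrableRZ (-1) mD0 i1).
have mI : measurable_fun (`]0, +oo[ : set RT) (fun r => - 1 * complex.Im (phiP r)).
  by apply: measurable_funM => //; have [_ h] := mP; exact: measurable_funTS.
have sub : (`]0, 1[ : set RT) `<=` `]0, +oo[.
  by move=> x; rewrite /= !in_itv/= andbT => /andP[].
apply: le_trans (ge0_subset_integralR (measurable_itv0 1) mD0 mI _ sub); last first.
  move=> r; rewrite /= in_itv/= andbT => r0; rewrite mulN1r oppr_ge0.
  by apply: le_trans (P_neg r0) _; rewrite oppr_le0 divr_ge0 ?(ltW b0)// addr_ge0 ?sqr_ge0.
apply: (@le_trans _ _ (\int[mu]_(x in `]0%R, 1%R[) (b / 2)%:E)%E).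
  by rewrite integral_cst//= lebesgue_measure_itv/= lte_fin ltr01 oppr0 adde0 mule1.
apply: ge0_le_integralR => //.
- exact: measurable_funS mI.
- by move=> _ _; rewrite divr_ge0// ltW.
move=> r; rewrite /= in_itv/= => /andP[r0 r1]; rewrite mulN1r lerNr.
apply: le_trans (P_neg r0) _; rewrite lerN2 ler_wpM2l ?(ltW b0)//.
by rewrite lef_pV2 ?posrE// ?ltr_pwDl ?sqr_ge0// -[2]/(1 + 1) lerD2l expr_le1// ltW.
Qed.

(** If C = 0 then G = 0 and P' = P, so P = D e^t for t > 0; boundedness forces D = 0, and then P(0)
    = 0 by continuity at 0, although P(0) < 0. *)
Let C_neq0 : C != 0.
Proof.
apply/eqP => C0; have := P_at0; apply/negP; rewrite -leNgt.
have dP' (t : R) : 0 < t -> is_derive t 1 (rint phiP) (rint phiP t).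
  by move=> t0; have := dP t0; rewrite G_exp// C0 mul0r add0r.
pose D := rint phiP 1 * expR (- 1).
have PE t : 0 < t -> rint phiP t = D * expR t.
  move=> t0; rewrite -[X in expR X]opprK expRN; apply: (canRL (mulfK (lt0r_neq0 (expR_gt0 _)))).
  apply: (@is_derive_0_itv R (fun t => rint phiP t * expR (- t)) 0 (Num.max 1 t + 1)).
  - move=> z /andP[z0 _]; have h := dP' z z0.
    apply: is_derive_eq; rewrite /GRing.scale/=.
    by move: (expR _) (rint phiP z) => u v; ring.
  - by rewrite t0/= ltr_pwDr// le_max lexx orbT.
  - by rewrite ltr01/= ltr_pwDr// le_max lexx.
have [M M0 hM] := @ray_integral_bounded R a b a0 phiP kap^-1 (beta - 1) mP q0 q1 kapV normP.
have D0 : D = 0.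
  apply/eqP; apply: contraT => Dn; have nD : 0 < `|D| by rewrite normr_gt0.
  have t0 : 0 < M / `|D| + 1 by rewrite ltr_wpDl// divr_ge0.
  have := hM _ (ltW t0); rewrite PE// normrM (ger0_norm (expR_ge0 _)) leNgt => /negP[].
  rewrite mulrC -ltr_pdivrMr//; apply: lt_le_trans (expR_ge1Dx _).
  by rewrite addrA (addrC 1) -addrA ltrDl.
have h : rint phiP t @[t --> 0^'+] --> (0 : R).
  apply: cvg_near_cst; near=> t.
  have t0 : 0 < t by near: t; exact: nbhs_right_gt.
  by rewrite PE// D0 mul0r.
have h2 := @ray_integral_right0 R a b a0 phiP kap^-1 (beta - 1) mP q0 q1 normP.
by rewrite -(cvg_unique _ h h2).
Unshelve. all: end_near. Qed.
(** F and C E_beta(- t^beta) take the same value C at 0 and satisfy the same Volterra equation. *)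
Let F_mlf t : 0 < t -> rint phiF t = C * mlf beta 1 1 t.
Proof.
move=> t0.
pose f s := C * mlf beta 1 1 s + 0 * mlf beta 2 1 s.
have hf : real_scalar_solution beta 1 C 0 f by exact: mlf_real_scalar_solution.
have df := real_scalar_solution_volterra beta1 beta2 hf.
have [[cf _ _ _ _] f0 _ _] := hf.
have cd : {within `[0, +oo[, continuous (fun t => Fc t - f t)}.
  by move=> x; apply: cvgB; [exact: cFc|exact: cf].
have h : Fc t - f t = 0.
  apply: (volterra_unique beta1 ler01 cd) (ltW t0).
    by rewrite f0 /Fc ltxx subrr.
  move=> s s0; have h1 := dFc s0; have h2 := df s s0.
  have i1 := RL_integrable_continuous q0 s0 cFc.
  have i2 := RL_integrable_continuous q0 s0 cf.
  have E : RL (beta - 1) (fun t => Fc t - f t) s = RL (beta - 1) Fc s - RL (beta - 1) f s.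
    rewrite -(mulN1r (RL (beta - 1) f s)) -(RLZ _ i2) -(RLD i1); last exact: RL_integrableZ.
    by congr (RL _ _ _); apply/funext => u; rewrite mulN1r.
  apply: is_derive_eq; rewrite E RL_F//.
  by move: (RL _ _ _) (rint _ _) => u v; ring.
move/eqP : h; rewrite subr_eq0 /Fc t0 /f mul0r addr0 => /eqP.
by [].
Qed.

(** [phiZ 0] is [phiF] / lambda, so Z is a primitive of F; both sides vanish at 0 and have
    derivative C [mlf beta 1 1]. *)
Let Z_mlf t : 0 < t -> rint (phiZ 0) t = C * mlf beta 2 1 t.
Proof.
move=> t0; pose f s := rint (phiZ 0) s - C * mlf beta 2 1 s.
have cst s : 0 < s -> f s = f t.
  move=> s0; apply: (@is_derive_0_itv R f 0 (Num.max s t + 1)).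
  - move=> z /andP[z0 _]; have h1 := dZ (lexx 0) z0.
    have h2 := is_derive_mlf beta1 (ltr1n _ 2) ler01 z0.
    apply: is_derive_eq; rewrite F_mlf// /GRing.scale/= (_ : 2 - 1 = 1 :> R); last by ring.
    by rewrite mul0r subr0 subrr.
  - by rewrite s0/= ltr_pwDr// le_max lexx.
  - by rewrite t0/= ltr_pwDr// le_max lexx orbT.
have h1 : f s @[s --> 0^'+] --> 0 - C * 0.
  apply: cvgB; first exact: (Z_right0 (lexx 0)).
  by apply: cvgMr; apply: cvg_mlf_right0 => //; rewrite ltr1n.
have h2 : f s @[s --> 0^'+] --> f t.
  apply: cvg_near_cst; near=> s.
  by rewrite cst//; near: s; exact: nbhs_right_gt.
have h3 : 0 - C * 0 = f t by rewrite (cvg_unique _ h1 h2).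
by apply/eqP; rewrite -subr_eq0 -/(f t) -h3 mulr0 subr0.
Unshelve. all: end_near. Qed.

Let powR_root x : 0 < x -> (x `^ beta^-1) `^ beta = x.
Proof. by move=> x0; rewrite -powRrM mulVf ?gt_eqF// powRr1// ltW. Qed.

(** With t = x^(1 / beta) the hypothesis reads |E(- x)| <= K1 / x, which serves for x > 1. For x <=
    1 the time t is at most 1 and the series at 2^beta is a bound. *)
Let ml_inv_bound (rho K1 : R) : 0 <= K1 -> 0 < rho ->
  (forall t, 0 < t -> `|mlf beta rho 1 t| <= K1 * t `^ (rho - 1 - beta)) ->
  exists2 K, 0 < K & forall x, 0 <= x -> `|ml beta rho (- x)| <= K / (1 + x).
Proof.
move=> K10 r0 hK.
pose B := `|ml beta rho 0| + `|ml beta rho (1 * 2 `^ beta)|.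
have B0 : 0 <= B by rewrite addr_ge0.
(* The factor 2 comes from 1 + x <= 2 for x <= 1 and 1 + x <= 2 x for x > 1; the summand 1 makes the
   constant positive. *)
exists (2 * (B + K1) + 1); first by rewrite ltr_wpDl// mulr_ge0// addr_ge0.
move=> x; rewrite le_eqVlt => /predU1P[<-|x0].
  rewrite oppr0 addr0 divr1 /B; have := normr_ge0 (ml beta rho (1 * 2 `^ beta)).
  have := normr_ge0 (ml beta rho 0); move: (`|_|) (`|_|) => u v u0 v0; lra.
have x10 : 0 < 1 + x by rewrite addr_gt0.
rewrite ler_pdivlMr//; set t := x `^ beta^-1; have t0 : 0 < t by exact: powR_gt0.
have xE : - x = - (1 * t `^ beta) by rewrite mul1r powR_root.
have [x1|x1] := leP x 1.
  have h : `|ml beta rho (- x)| <= B.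
    have t2 : 0 < t < 2.
      rewrite t0/=; apply: (@le_lt_trans _ _ 1); last by rewrite ltr1n.
      by rewrite -[leRHS](powRr0 x); apply: ger_powR; rewrite ?x0 ?x1// invr_ge0 ltW.
    have := mlf_bound beta1 r0 ler01 t2; rewrite mlfE normrM ger0_norm ?powR_ge0//.
    rewrite ler_pM2l ?powR_gt0// -xE => /le_trans; apply.
    by apply: le_trans (ler_norm _) _; rewrite lerDr.
  have := normr_ge0 (ml beta rho (- x)).
  move: h; move: (`|ml beta rho (- x)|) => u h u0.
  have : u * (1 + x) <= B * 2 by apply: ler_pM => //; lra.
  lra.
have h : `|ml beta rho (- x)| <= K1 / x.
  have := hK _ t0; rewrite mlfE -xE normrM ger0_norm ?powR_ge0// (gt0_powRD (rho - 1) (- beta) t0).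
  rewrite mulrCA ler_pM2l ?powR_gt0// powRN powR_root//.
have := normr_ge0 (ml beta rho (- x)).
move: h; rewrite ler_pdivlMr//; move: (`|ml beta rho (- x)|) => u h u0.
have : u * 1 <= u * x by apply: ler_wpM2l => //; exact: ltW.
rewrite mulr1 mulrDr mulr1; lra.
Qed.

Lemma ml1_decay : exists2 K, 0 < K & forall x, 0 <= x -> `|ml beta 1 (- x)| <= K / (1 + x).
Proof.
have nC : 0 < `|C| by rewrite normr_gt0.
apply: (@ml_inv_bound 1 (`|C|^-1 * (kap^-1 * (Gamma beta * a `^ (- beta))))) => //.
  by rewrite mulr_ge0// ?invr_ge0// mulr_ge0// mulr_ge0 ?powR_ge0// ltW// Gamma_gt0.
move=> t t0; have := ray_integral_le b a0 mF bF beta0 t0.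
rewrite F_mlf// normrM -ler_pdivlMl// => /le_trans; apply.
rewrite powRM ?(ltW a0) ?(ltW t0)// subrr sub0r.
by rewrite le_eqVlt; apply/orP; left; apply/eqP; rewrite -!mulrA.
Qed.

Lemma ml2_decay : exists2 K, 0 < K & forall x, 0 <= x -> `|ml beta 2 (- x)| <= K / (1 + x).
Proof.
have nC : 0 < `|C| by rewrite normr_gt0.
apply: (@ml_inv_bound 2 (`|C|^-1 * (K * (Gamma (beta - 1) * a `^ (- (beta - 1)))))) => //.
  by rewrite mulr_ge0// ?invr_ge0// mulr_ge0// mulr_ge0 ?powR_ge0// ltW// Gamma_gt0.
move=> t t0; have := ray_integral_le b a0 (mZ 0) (bZ (lexx 0)) q0 t0.
rewrite Z_mlf// normrM -ler_pdivlMl// => /le_trans; apply.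
rewrite powRM ?(ltW a0) ?(ltW t0)// (_ : 2 - 1 - beta = - (beta - 1)); last by ring.
by rewrite le_eqVlt; apply/orP; left; apply/eqP; rewrite -!mulrA.
Qed.
End decay.

(** * Orthonormal expansions *)
Section summable_families.
Context {R : realType} {I : choiceType}.
Implicit Types (a : I -> R) (B : R) (s : seq I).

Definition sums_le a B : Prop := forall s, uniq s -> \sum_(i <- s) a i <= B.

Lemma ler_sum_uniq a s1 s2 : (forall i, 0 <= a i) -> uniq s1 -> {subset s1 <= s2} ->
  \sum_(i <- s1) a i <= \sum_(i <- s2) a i.
Proof.
move=> a0; elim: s1 s2 => [|x s1 IH] s2 /=.
  by move=> _ _; rewrite big_nil sumr_ge0.
move=> /andP[xs1 us1] sub; have xs2 : x \in s2 by apply: sub; rewrite inE eqxx.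
rewrite big_cons (perm_big _ (perm_to_rem xs2)) big_cons lerD2l; apply: IH => // y ys1.
have := sub y; rewrite inE ys1 orbT => /(_ isT); rewrite (perm_mem (perm_to_rem xs2)) inE.
by case/predU1P => [yx|//]; rewrite yx (negbTE xs1) in ys1.
Qed.

(** A finite partial sum within eps of the supremum of all of them leaves less than eps for any
    disjoint list. *)
Lemma sums_le_tail a B (eps : R) : (forall i, 0 <= a i) -> sums_le a B -> 0 < eps ->
  exists2 s, uniq s & forall s', uniq s' -> (forall i, i \in s' -> i \notin s) ->
    \sum_(i <- s') a i < eps.
Proof.
move=> a0 aB e0; pose E := [set x | exists2 s, uniq s & x = \sum_(i <- s) a i].
have sE : has_sup E.
  by split; [exists 0, [::]; rewrite ?big_nil|exists B => _ [s us ->]; exact: aB].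
have [_ [s us ->] hs] := sup_adherent e0 sE.
exists s => // s' us' dis.
have : \sum_(i <- s ++ s') a i <= sup E.
  apply: ub_le_sup; first by case: sE.
  exists (s ++ s') => //; rewrite cat_uniq us us' andbT/=; apply/hasPn => i.
  exact: dis.
by rewrite big_cat /=; move: hs; move: (\sum_(i <- s) _) (\sum_(i <- s') _) => u v; lra.
Qed.

Lemma esum_leP a B : (forall i, 0 <= a i) ->
  (\esum_(i in [set: I]) (a i)%:E <= B%:E)%E <-> sums_le a B.
Proof.
move=> a0; split => [h s us|h].
  rewrite -lee_fin; apply: le_trans h; apply: esum_ge.
  exists [set` s]; first by split; [exact: finite_seq|].
  by rewrite -fsbig_seq// -sumEFin.
apply: ub_ereal_sup => _ [A [fA _] <-].
rewrite fsbig_finite//= sumEFin lee_fin; apply: h.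
exact: finmap.fset_uniq.
Qed.
End summable_families.

Section hilbert_tools.
Context {R : realType} {H : completeNormedModType R[i]}.
Variable dot : {dot H for @conjc R}.
Hypothesis hdot : hilbert_space dot.
Variables (I : countType) (e : I -> H).
Hypothesis onb : orthonormal_basis dot e.
Implicit Types (x y : H) (c : I -> R[i]) (s : seq I).

(** The norm of H takes values in R[i], with imaginary part 0; this is the same norm as a real
    number. *)
Definition nrm x : R := complex.Re `|x|.

Lemma nrmE x : `|x| = (nrm x)%:C%C.
Proof. by rewrite RRe_real// ger0_real. Qed.

Lemma nrm_ge0 x : 0 <= nrm x.
Proof. by rewrite -ler0c -nrmE. Qed.

Lemma nrmD x y : nrm (x + y) <= nrm x + nrm y.
Proof. by rewrite -lecR rmorphD /= -!nrmE ler_normD. Qed.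

Lemma nrmN x : nrm (- x) = nrm x.
Proof. by rewrite /nrm normrN. Qed.

Lemma nrm0 : nrm 0 = 0. Proof. by rewrite /nrm normr0. Qed.

Lemma nrm_dot x : ((nrm x) ^+ 2)%:C%C = dot x x.
Proof. by rewrite rmorphXn /= -nrmE hdot. Qed.

Lemma nrmDd x y : dot x y = 0 -> nrm (x + y) ^+ 2 = nrm x ^+ 2 + nrm y ^+ 2.
Proof. by move=> xy; apply: complexI; rewrite rmorphD /= !nrm_dot hnormDd. Qed.

Lemma nrmZe (z : R[i]) i : nrm (z *: e i) ^+ 2 = Normc.normc z ^+ 2.
Proof.
apply: complexI; rewrite nrm_dot linearZl_LR linearZr_LR /= onb.1 eqxx mulr1.
by rewrite -sqr_normc normc_def normcE2 rmorphXn.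
Qed.

Lemma dot_sum c s j : uniq s ->
  dot (\sum_(i <- s) c i *: e i) (e j) = if j \in s then c j else 0.
Proof.
move=> us; rewrite linear_sumlz.
under eq_bigr do rewrite linearZl_LR /= onb.1.
case: ifPn => js.
  rewrite (bigD1_seq j)//= eqxx mulr1 big1 ?addr0// => i ij.
  by rewrite (negbTE ij) mulr0.
rewrite big_seq big1// => i is'; case: eqVneq => [ij|]; last by rewrite mulr0.
by rewrite ij (negbTE js) in is'.
Qed.

Lemma nrm_sum c s : uniq s ->
  nrm (\sum_(i <- s) c i *: e i) ^+ 2 = \sum_(i <- s) Normc.normc (c i) ^+ 2.
Proof.
elim: s => [|j s IH] /=; first by rewrite !big_nil nrm0 expr0n.
move=> /andP[js us]; rewrite !big_cons nrmDd ?nrmZe ?IH//.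
rewrite linearZl_LR /= hermC /= expr0 mul1r dot_sum// (negbTE js).
by rewrite conjc0 mulr0.
Qed.

Lemma bessel x s : uniq s -> \sum_(i <- s) Normc.normc (dot x (e i)) ^+ 2 <= nrm x ^+ 2.
Proof.
move=> us; set S := \sum_(i <- s) dot x (e i) *: e i.
rewrite -nrm_sum// -/S -[in leRHS](subrK S x) nrmDd ?lerDr ?sqr_ge0//.
rewrite {2}/S linear_sumr /= big_seq big1// => i is'.
by rewrite linearZr_LR /= linearBl /= (dot_sum (fun i => dot x (e i)))// is' subrr mulr0.
Qed.

Lemma partial_sumE (f : I -> H) (A : finmap.finset_of (Phant I)) :
  summability.partial_sum f A = \sum_(i <- finmap.enum_fset A) f i.
Proof. by rewrite finmap.big_seq_fsetE. Qed.

Lemma nrm_cvgP (T : Type) (F : set_system T) {FF : Filter F} (f : T -> H) x :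
  f @ F --> x <-> forall eps : R, 0 < eps -> \forall t \near F, nrm (x - f t) < eps.
Proof.
rewrite cvgrPdist_lt; split => h eps e0.
  have := h (eps%:C)%C; rewrite ltcR => /(_ e0); apply: filterS => t.
  by rewrite nrmE ltcR.
have := e0; rewrite ltcE /= => /andP[/eqP Ie Re0].
have := h (complex.Re eps) Re0; apply: filterS => t ht.
by rewrite nrmE ltcE /= Ie eqxx.
Qed.

Lemma has_sumP (f : I -> H) x : has_sum f x <-> forall eps : R, 0 < eps ->
  exists2 s, uniq s & forall s', uniq s' -> {subset s <= s'} ->
    nrm (x - \sum_(i <- s') f i) < eps.
Proof.
have FF : ProperFilter (@summability.totally I) by exact: summability.totally_filter.
rewrite /has_sum nrm_cvgP; split => h eps e0; have := h eps e0.
  move=> [A _ hA]; exists (finmap.enum_fset A); first exact: finmap.fset_uniq.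
  move=> s' us' sub.
  have pe : perm_eq (finmap.enum_fset (finmap.seq_fset tt s')) s'.
    apply: (uniq_perm (finmap.fset_uniq _) us') => i; exact: finmap.seq_fsetE.
  have hB : finmap.fsubset A (finmap.seq_fset tt s').
    by apply/finmap.fsubsetP => i iA; rewrite finmap.seq_fsetE; exact: sub.
  by have := hA _ hB; rewrite /mkset partial_sumE (perm_big _ pe).
move=> [s us hs]; exists (finmap.seq_fset tt s) => // B /finmap.fsubsetP sB.
rewrite /= partial_sumE; apply: hs; first exact: finmap.fset_uniq.
by move=> i is'; apply: sB; rewrite finmap.seq_fsetE.
Qed.

Lemma has_sum_unique (f : I -> H) x y : has_sum f x -> has_sum f y -> x = y.
Proof.
have FF : ProperFilter (@summability.totally I) by exact: summability.totally_filter.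
by move=> hx hy; apply: cvg_unique hx hy; exact: norm_hausdorff.
Qed.

Lemma sum_split (f : I -> H) s s' : uniq s -> uniq s' -> {subset s <= s'} ->
  \sum_(i <- s') f i = \sum_(i <- s) f i + \sum_(i <- [seq i <- s' | i \notin s]) f i.
Proof.
move=> us us' sub; rewrite (bigID (mem s)) /= -big_filter -[X in _ + X]big_filter; congr (_ + _).
apply: perm_big; apply: uniq_perm => //; first exact: filter_uniq.
by move=> i; rewrite mem_filter; case: (boolP (i \in s)) => //= /sub.
Qed.

(** By Pythagoras the norm of a partial sum is governed by the squares of its coefficients, so
    [sums_le_tail] makes the net Cauchy. *)
Lemma l2_has_sum c B : sums_le (fun i => Normc.normc (c i) ^+ 2) B ->
  exists x, has_sum (fun i => c i *: e i) x.
Proof.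
have FF : ProperFilter (@summability.totally I) by exact: summability.totally_filter.
move=> cB; pose F := summability.partial_sum (fun i => c i *: e i) @ summability.totally.
suff /cauchy_cvg : cauchy F by move=> /(_ _) h; exists (lim F); exact: h.
apply: cauchy_exP => eps; rewrite ltcE /= => /andP[/eqP Ie e0].
have e20 : 0 < complex.Re eps ^+ 2 by rewrite exprn_gt0.
have [s us hs] := sums_le_tail (fun i => sqr_ge0 _) cB e20.
exists (\sum_(i <- s) c i *: e i).
exists (finmap.seq_fset tt s) => // A /finmap.fsubsetP sA.
have sub : {subset s <= finmap.enum_fset A}.
  by move=> i is'; apply: sA; rewrite finmap.seq_fsetE.
rewrite /= -ball_normE /ball_ /= partial_sumE distrC.
rewrite (sum_split _ us (finmap.fset_uniq A) sub) addrAC subrr add0r nrmE ltcE /= Ie eqxx /=.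
rewrite -(ltr_pXn2r (ltn0Sn 1)) ?nnegrE ?nrm_ge0 ?(ltW e0)//.
have uf : uniq [seq i <- finmap.enum_fset A | i \notin s].
  by apply: filter_uniq; exact: finmap.fset_uniq.
by rewrite nrm_sum//; apply: hs => // i; rewrite mem_filter => /andP[].
Qed.

Lemma has_sum_nrm_le (f : I -> H) x (b : R) : has_sum f x ->
  (forall s, uniq s -> nrm (\sum_(i <- s) f i) <= b) -> nrm x <= b.
Proof.
move=> /has_sumP fx fb; apply/ler_addgt0Pr => eps e0.
have [s us /(_ s us (fun _ => id)) hs] := fx eps e0.
rewrite -[x](subrK (\sum_(i <- s) f i)) addrC.
by apply: le_trans (nrmD _ _) _; rewrite lerD ?fb// ltW.
Qed.

(** Bessel's inequality for the single vector [e j] takes the place of Cauchy-Schwarz: applied to x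
    minus a partial sum containing j, it bounds the modulus of [dot x (e j) - c j] by an arbitrarily
    small norm. *)
Lemma has_sum_dot c x j : has_sum (fun i => c i *: e i) x -> dot x (e j) = c j.
Proof.
move=> /has_sumP h; apply/eqP; rewrite -subr_eq0 -normc_eq0 eq_le normc_ge0 andbT.
apply/ler_addgt0Pr => eps e0; rewrite add0r.
have [s us hs] := h eps e0.
have us' : uniq (undup (j :: s)) by exact: undup_uniq.
have sub : {subset s <= undup (j :: s)} by move=> i; rewrite mem_undup inE orbC => ->.
apply: le_trans (ltW (hs _ us' sub)).
rewrite -(ler_pXn2r (ltn0Sn 1)) ?nnegrE ?nrm_ge0 ?normc_ge0//.
have := @bessel (x - \sum_(i <- undup (j :: s)) c i *: e i) [:: j] isT.
have js : j \in undup (j :: s) by rewrite mem_undup inE eqxx.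
by rewrite big_seq1 linearBl [X in _ - X](dot_sum c) // js.
Qed.

Lemma has_sumB (f g : I -> H) x y : has_sum f x -> has_sum g y ->
  has_sum (fun i => f i - g i) (x - y).
Proof.
move=> /has_sumP fx /has_sumP gy; apply/has_sumP => eps e0.
have e20 : 0 < eps / 2 by rewrite divr_gt0.
have [s us hs] := fx _ e20; have [s' us' hs'] := gy _ e20.
exists (undup (s ++ s')); first exact: undup_uniq.
move=> s2 us2 sub; have s1 : {subset s <= s2}.
  by move=> i is1; apply: sub; rewrite mem_undup mem_cat is1.
have s1' : {subset s' <= s2}.
  by move=> i is1; apply: sub; rewrite mem_undup mem_cat is1 orbT.
have h := hs s2 us2 s1; have h' := hs' s2 us2 s1'.
have -> : x - y - \sum_(i <- s2) (f i - g i) =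
    (x - \sum_(i <- s2) f i) - (y - \sum_(i <- s2) g i).
  by rewrite sumrB !opprB addrACA [RHS]addrACA; congr (_ + _); exact: addrC.
apply: le_lt_trans (nrmD _ _) _.
by rewrite nrmN [eps]splitr ltrD.
Qed.

(** Dominated convergence in l2: termwise convergence settles finitely many indices, the summable
    majorant M the others. It yields the continuity in t of the solution. *)
Lemma has_sum_cvg (T : Type) (F : set_system T) {FF : Filter F} (c : T -> I -> R[i])
    (c0 : I -> R[i]) (M : I -> R) B (x : T -> H) x0 :
  (forall i, Normc.normc (c0 i - c t i) ^+ 2 @[t --> F] --> (0 : R)) ->
  (\forall t \near F, forall i, Normc.normc (c t i) ^+ 2 <= M i) ->
  (forall i, Normc.normc (c0 i) ^+ 2 <= M i) -> sums_le M B ->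
  (\forall t \near F, has_sum (fun i => c t i *: e i) (x t)) ->
  has_sum (fun i => c0 i *: e i) x0 -> x t @[t --> F] --> x0.
Proof.
move=> cc0 cM c0M MB cx cx0; apply/nrm_cvgP => eps e0.
(* (eps / 2)^2 is shared equally by the two sets of indices; the 8 below allows for |c0 - c|^2 <= 4
   M on the tail. *)
have e20 : 0 < (eps / 2) ^+ 2 / 2 by rewrite divr_gt0// exprn_gt0// divr_gt0.
have e80 : 0 < (eps / 2) ^+ 2 / 8 by rewrite divr_gt0// exprn_gt0// divr_gt0.
have M0 i : 0 <= M i by apply: le_trans (c0M i); exact: sqr_ge0.
have [s us hs] := sums_le_tail M0 MB e80.
have lim : \sum_(i <- s) Normc.normc (c0 i - c t i) ^+ 2 @[t --> F] --> (0 : R).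
  elim: (s) => [|j s' IH].
    by under eq_fun do rewrite big_nil; exact: cvg_cst.
  have h := cvgD (cc0 j) IH; rewrite addr0 in h.
  by under eq_fun do rewrite big_cons; exact: h.
move/cvgr0_norm_lt : lim => /(_ _ e20) lim.
near=> t.
have ht : \sum_(i <- s) Normc.normc (c0 i - c t i) ^+ 2 < (eps / 2) ^+ 2 / 2.
  by apply: le_lt_trans (ler_norm _) _; near: t.
have hM i : Normc.normc (c t i) ^+ 2 <= M i.
  have : forall i, Normc.normc (c t i) ^+ 2 <= M i by near: t.
  exact.
have hx : has_sum (fun i => c t i *: e i) (x t) by near: t.
have hd : has_sum (fun i => (c0 i - c t i) *: e i) (x0 - x t).
  have := has_sumB cx0 hx; congr (has_sum _ _); apply/funext => i.
  by rewrite scalerBl.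
apply: (@le_lt_trans _ _ (eps / 2)); last by rewrite ltr_pdivrMr// ltr_pMr// ltr1n.
apply: has_sum_nrm_le hd _ => s' us'.
rewrite -(ler_pXn2r (ltn0Sn 1)) ?nnegrE ?nrm_ge0 ?divr_ge0 ?(ltW e0)// nrm_sum//.
rewrite (bigID (mem s)) /= -big_filter -[X in _ + X]big_filter [leRHS]splitr lerD//.
  apply: le_trans (ltW ht); apply: ler_sum_uniq => [i||i]; first exact: sqr_ge0.
    exact: filter_uniq.
  by rewrite mem_filter => /andP[].
have uf : uniq [seq i <- s' | i \notin s] by exact: filter_uniq.
have hf := hs _ uf ltac:(by move=> i; rewrite mem_filter => /andP[]).
apply: (@le_trans _ _ (4 * \sum_(i <- [seq i <- s' | i \notin s]) M i)); last first.
  by move: hf; move: (\sum_(i <- _) M i) => u; lra.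
rewrite mulr_sumr; apply: ler_sum => i _.
have nD : Normc.normc (c0 i - c t i) <= Normc.normc (c0 i) + Normc.normc (c t i).
  by apply: le_trans (le_normcD _ _) _; rewrite normcN.
apply: (@le_trans _ _ ((Normc.normc (c0 i) + Normc.normc (c t i)) ^+ 2)).
  by rewrite ler_pXn2r// nnegrE ?addr_ge0 ?normc_ge0.
have := c0M i; have := hM i; move: (Normc.normc (c0 i)) (Normc.normc (c t i)) (M i) => u v m.
by move=> um vm; have := sqr_ge0 (u - v); rewrite sqrrB sqrrD; lra.
Unshelve. all: end_near. Qed.
End hilbert_tools.

Lemma mittag_leffler_real (R : realType) (beta rho x : R) : 1 < beta -> 0 < rho ->
  mittag_leffler beta rho x%:C%C = (ml beta rho x)%:C%C.
Proof.
move=> b1 r0; rewrite /mittag_leffler; apply: (@cvg_lim (R[i]^o)); first exact: norm_hausdorff.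
have h := @cvg_ml R beta b1 rho x r0.
apply/cvgrPdist_lt => eps; rewrite ltcE /= => /andP[/eqP Ie e0].
move/cvgrPdist_lt : h => /(_ _ e0); apply: filterS => n hn.
rewrite (_ : series _ n = (pseries (ml_coef beta rho) x n)%:C%C).
  by rewrite -rmorphB /= normc_def /= expr0n addr0 sqrtr_sqr ltcE /= Ie eqxx.
rewrite /pseries /series /= rmorph_sum /=; apply: eq_bigr => k _.
by rewrite /ml_coef rmorphM rmorphXn /= fmorphV mulrC.
Qed.

(** * The wave equation *)
Section sobolev_bound.
Context {R : realType} {I : countType}.
Variables (gamma : I -> R).
Implicit Types (u v c : I -> R[i]) (d : R).

Let weight_ge0 d c i : 0 <= (1 + gamma i) `^ d * Normc.normc (c i) ^+ 2.
Proof. by rewrite mulr_ge0 ?powR_ge0 ?sqr_ge0. Qed.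

Lemma in_sobolevE d c : in_sobolev gamma d c ->
  sobolev_sqnorm gamma d c = (sobolev_norm gamma d c ^+ 2)%:E.
Proof.
move=> dc; have ge0 : (0 <= sobolev_sqnorm gamma d c)%E.
  by apply: esum_ge0 => i _; rewrite lee_fin weight_ge0.
rewrite /sobolev_norm sqr_sqrtr ?fine_ge0// fineK// ge0_fin_numE//.
Qed.

(** The hypothesis has the shape left by (x + y)^2 <= 2 x^2 + 2 y^2; the factor 2 of the conclusion
    comes from 2 x^2 + 2 y^2 <= (2 (x + y))^2 for x, y >= 0. *)
Lemma sobolev_bound d d1 u v c (al ta : R) : 0 <= al -> 0 <= ta ->
  in_sobolev gamma d u -> in_sobolev gamma d1 v ->
  (forall i, (1 + gamma i) `^ d * Normc.normc (c i) ^+ 2 <=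
    2 * al ^+ 2 * ((1 + gamma i) `^ d * Normc.normc (u i) ^+ 2) +
    2 * ta ^+ 2 * ((1 + gamma i) `^ d1 * Normc.normc (v i) ^+ 2)) ->
  in_sobolev gamma d c /\ sobolev_norm gamma d c <=
    2 * (al * sobolev_norm gamma d u + ta * sobolev_norm gamma d1 v).
Proof.
move=> al0 ta0 du dv h; set U := sobolev_norm gamma d u; set V := sobolev_norm gamma d1 v.
have U0 : 0 <= U by exact: sqrtr_ge0.
have V0 : 0 <= V by exact: sqrtr_ge0.
have sq d' c' : in_sobolev gamma d' c' -> sums_le
    (fun i => (1 + gamma i) `^ d' * Normc.normc (c' i) ^+ 2) (sobolev_norm gamma d' c' ^+ 2).
  move=> dc; apply/esum_leP; first exact: weight_ge0.
  by rewrite -/(sobolev_sqnorm gamma d' c') in_sobolevE.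
have sU := sq _ _ du; have sV := sq _ _ dv.
have le2 : 2 * al ^+ 2 * U ^+ 2 + 2 * ta ^+ 2 * V ^+ 2 <= (2 * (al * U + ta * V)) ^+ 2.
  have xy : 0 <= (al * U) * (ta * V) by rewrite !mulr_ge0.
  rewrite (_ : 2 * al ^+ 2 * U ^+ 2 + 2 * ta ^+ 2 * V ^+ 2 =
    2 * (al * U) ^+ 2 + 2 * (ta * V) ^+ 2); last by rewrite !exprMn !mulrA.
  move: xy (sqr_ge0 (al * U)) (sqr_ge0 (ta * V)); move: (al * U) (ta * V) => x y xy x2 y2.
  by rewrite exprMn sqrrD; lra.
have hc : (sobolev_sqnorm gamma d c <= ((2 * (al * U + ta * V)) ^+ 2)%:E)%E.
  apply/esum_leP; first exact: weight_ge0.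
  move=> s us; apply: le_trans le2; apply: le_trans (ler_sum _ (fun i _ => h i)) _.
  by rewrite big_split /= -!mulr_sumr lerD// ler_wpM2l ?mulr_ge0 ?sqr_ge0//; [exact: sU|exact: sV].
have dc : in_sobolev gamma d c by apply: le_lt_trans hc _; rewrite ltry.
split => //; have := in_sobolevE dc => E; rewrite E lee_fin in hc.
by move: hc; rewrite ler_pXn2r// nnegrE ?sqrtr_ge0// mulr_ge0// addr_ge0// mulr_ge0.
Qed.
End sobolev_bound.

Section wave.
Context {R : realType} {H : completeNormedModType R[i]}.
Variable dot : {dot H for @conjc R}.
Hypothesis hdot : hilbert_space dot.
Variables (I : countType) (e : I -> H) (gamma : I -> R) (beta : R).
Hypotheses (onb : orthonormal_basis dot e) (gamma0 : forall i, 0 <= gamma i)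
  (beta1 : 1 < beta) (beta2 : beta < 2).
Variables (w0 w1 : H).

Local Notation u := (fourier dot e w0).
Local Notation v := (fourier dot e w1).

Definition wave_coef t i : R[i] :=
  (mlf beta 1 (gamma i) t)%:C%C * u i + (mlf beta 2 (gamma i) t)%:C%C * v i.

Lemma wave_coefficientE t i : 0 <= t ->
  wave_coefficient dot gamma e beta w0 w1 t i = wave_coef t i.
Proof.
move=> t0; rewrite /wave_coefficient /wave_coef !mittag_leffler_real// !mlfE.
rewrite subrr powRr0 mul1r (_ : 2 - 1 = 1 :> R); last by ring.
rewrite powRr1// rmorphM (mulrC (gamma i)); congr (_ + _); first exact: mulrC.
exact: mulrAC.
Qed.

Lemma normc_wave_coef t i : Normc.normc (wave_coef t i) ^+ 2 <=
  2 * (mlf beta 1 (gamma i) t ^+ 2 * Normc.normc (u i) ^+ 2 +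
       mlf beta 2 (gamma i) t ^+ 2 * Normc.normc (v i) ^+ 2).
Proof.
apply: (@le_trans _ _ ((`|mlf beta 1 (gamma i) t| * Normc.normc (u i) +
    `|mlf beta 2 (gamma i) t| * Normc.normc (v i)) ^+ 2)).
  rewrite ler_pXn2r// ?nnegrE ?normc_ge0 ?addr_ge0 ?mulr_ge0 ?normc_ge0//.
  by apply: le_trans (le_normcD _ _) _; rewrite !Normc.normcM !normc_real.
rewrite -(real_normK (num_real (mlf beta 1 _ _))) -(real_normK (num_real (mlf beta 2 _ _))).
rewrite -!exprMn; move: (_ * _) (_ * _) => x y.
by have := sqr_ge0 (x - y); rewrite sqrrB sqrrD; lra.
Qed.

Lemma mlf_decay : exists2 K, 0 < K & forall (t : R) i, 0 <= t ->
  `|mlf beta 1 (gamma i) t| <= K / (1 + t `^ beta * gamma i) /\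
  `|mlf beta 2 (gamma i) t| <= K * t / (1 + t `^ beta * gamma i).
Proof.
have [K1 K10 h1] := ml1_decay beta1 beta2; have [K2 K20 h2] := ml2_decay beta1 beta2.
exists (K1 + K2); first exact: addr_gt0.
move=> t i t0; have x0 : 0 <= gamma i * t `^ beta by rewrite mulr_ge0 ?powR_ge0.
have d0 : 0 <= (1 + t `^ beta * gamma i)^-1.
  by rewrite invr_ge0 addr_ge0// mulr_ge0 ?powR_ge0.
rewrite !mlfE subrr powRr0 mul1r (_ : 2 - 1 = 1 :> R); last by ring.
rewrite powRr1// normrM (ger0_norm t0); split.
  apply: le_trans (h1 _ x0) _; rewrite (mulrC (gamma i)) ler_wpM2r// lerDl ltW//.
rewrite (mulrC (K1 + K2)) -mulrA ler_wpM2l//.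
by apply: le_trans (h2 _ x0) _; rewrite (mulrC (gamma i)) ler_wpM2r// lerDr ltW.
Qed.

Let mlf_decay_le : exists2 K, 0 < K & forall t i, 0 <= t ->
  `|mlf beta 1 (gamma i) t| <= K /\ `|mlf beta 2 (gamma i) t| <= K * t.
Proof.
have [K K0 hK] := mlf_decay; exists K => // t i t0; have [h1 h2] := hK t i t0.
have d1 : 1 <= 1 + t `^ beta * gamma i by rewrite lerDl mulr_ge0 ?powR_ge0.
split; [apply: le_trans h1 _|apply: le_trans h2 _];
  rewrite ler_pdivrMr ?(lt_le_trans _ d1)// ler_peMr ?mulr_ge0// ltW//.
Qed.

(** Bessel's inequality for w0 and w1 makes the majorant summable, so convergence and continuity in
    H involve no Sobolev order. It is uniform up to time T since the second multiplier is at most K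
    t. *)
Let dominant (T : R) : exists M B, sums_le M B /\
  forall t i, 0 <= t <= T -> Normc.normc (wave_coef t i) ^+ 2 <= M i.
Proof.
have [K K0 hK] := mlf_decay_le.
exists (fun i => 2 * (K ^+ 2 * Normc.normc (u i) ^+ 2 + (K * T) ^+ 2 * Normc.normc (v i) ^+ 2)).
exists (2 * (K ^+ 2 * nrm w0 ^+ 2 + (K * T) ^+ 2 * nrm w1 ^+ 2)); split.
  move=> s us; rewrite -mulr_sumr big_split /= -!mulr_sumr ler_wpM2l// lerD//.
    by rewrite ler_wpM2l ?sqr_ge0//; exact: bessel.
  by rewrite ler_wpM2l ?sqr_ge0//; exact: bessel.
move=> t i /andP[t0 tT]; apply: le_trans (normc_wave_coef t i) _.
have [h1 h2] := hK t i t0; rewrite ler_wpM2l// lerD// ler_wpM2r ?sqr_ge0//.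
  by rewrite -[leLHS]real_normK ?num_real// ler_pXn2r// nnegrE// ltW.
have T0 : 0 <= T := le_trans t0 tT.
rewrite -[leLHS]real_normK ?num_real// ler_pXn2r ?nnegrE ?mulr_ge0 ?(ltW K0)//.
by apply: le_trans h2 _; rewrite ler_wpM2l// ltW.
Qed.

Let wave_coef_cvg (F : set_system R) {FF : Filter F} t0 i :
  mlf beta 1 (gamma i) t @[t --> F] --> mlf beta 1 (gamma i) t0 ->
  mlf beta 2 (gamma i) t @[t --> F] --> mlf beta 2 (gamma i) t0 ->
  Normc.normc (wave_coef t0 i - wave_coef t i) ^+ 2 @[t --> F] --> (0 : R).
Proof.
move=> h1 h2.
pose m t := `|mlf beta 1 (gamma i) t0 - mlf beta 1 (gamma i) t| * Normc.normc (u i) +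
  `|mlf beta 2 (gamma i) t0 - mlf beta 2 (gamma i) t| * Normc.normc (v i).
have hm : m t ^+ 2 @[t --> F] --> (0 : R).
  have d1 : `|mlf beta 1 (gamma i) t0 - mlf beta 1 (gamma i) t| @[t --> F] --> `|0 : R|.
    by apply: cvg_norm; rewrite -(subrr (mlf beta 1 (gamma i) t0)); apply: cvgB => //; exact: cvg_cst.
  have d2 : `|mlf beta 2 (gamma i) t0 - mlf beta 2 (gamma i) t| @[t --> F] --> `|0 : R|.
    by apply: cvg_norm; rewrite -(subrr (mlf beta 2 (gamma i) t0)); apply: cvgB => //; exact: cvg_cst.
  rewrite normr0 in d1 d2.
  have hm : m t @[t --> F] --> 0 * Normc.normc (u i) + 0 * Normc.normc (v i).
    by apply: cvgD; apply: cvgMl.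
  rewrite !mul0r addr0 in hm.
  by have hmm := cvgM hm hm; rewrite mul0r in hmm; exact: hmm.
apply: squeeze_cvgr (cvg_cst 0) hm; apply: nearW => t; rewrite sqr_ge0/=.
rewrite ler_pXn2r ?nnegrE ?normc_ge0 ?addr_ge0 ?mulr_ge0 ?normc_ge0//.
rewrite (_ : wave_coef t0 i - wave_coef t i =
  (mlf beta 1 (gamma i) t0 - mlf beta 1 (gamma i) t)%:C%C * u i +
  (mlf beta 2 (gamma i) t0 - mlf beta 2 (gamma i) t)%:C%C * v i); last first.
  by rewrite /wave_coef !rmorphB /= !mulrBl opprD addrACA.
by apply: le_trans (le_normcD _ _) _; rewrite !Normc.normcM !normc_real.
Qed.

Lemma wave_exists : exists w : R -> H,
  (forall t, 0 <= t -> has_sum (fun i => wave_coef t i *: e i) (w t)) /\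
  {within `[0, +oo[, continuous w}.
Proof.
have ex t : exists x, 0 <= t -> has_sum (fun i => wave_coef t i *: e i) x.
  have [t0|t0] := leP 0 t; last by exists 0.
  have [M [B [MB hM]]] := dominant t.
  have [] := @l2_has_sum _ _ dot hdot _ e onb (wave_coef t) B.
    move=> s us; apply: le_trans (MB s us); apply: ler_sum => i _; apply: hM.
    by rewrite t0 lexx.
  by move=> x hx; exists x.
have [w hw] := choice ex; exists w; split => //.
(* The filter is left open so as to cover two-sided neighbourhoods of t0 > 0 and right
   neighbourhoods of 0. *)
have key t0 (F : set_system R) (FF : Filter F) : 0 <= t0 ->
    (\forall t \near F, 0 <= t <= t0 + 1) ->
    (forall i, mlf beta 1 (gamma i) t @[t --> F] --> mlf beta 1 (gamma i) t0) ->
    (forall i, mlf beta 2 (gamma i) t @[t --> F] --> mlf beta 2 (gamma i) t0) ->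
    w t @[t --> F] --> w t0.
  move=> t00 nF c1 c2; have [M [B [MB hM]]] := dominant (t0 + 1).
  apply: (@has_sum_cvg _ _ dot hdot _ e onb R F FF wave_coef (wave_coef t0) M B) => //.
  - by move=> i; apply: wave_coef_cvg; [exact: c1|exact: c2].
  - by apply: filterS nF => t tT i; exact: hM.
  - by move=> i; apply: hM; rewrite t00 lerDl ler01.
  - by apply: filterS nF => t /andP[t1 _]; exact: hw.
  - exact: hw.
apply/continuous_within_itvcyP; split.
  move=> t0; rewrite in_itv/= andbT => t00; apply: key; first exact: ltW.
  - near=> t; apply/andP; split.
      by apply: ltW; near: t; exact: lt_nbhsr.
    apply: ltW; near: t; apply: (@lt_nbhsl R t0 (t0 + 1)).
    by rewrite ltrDl.
  - by move=> i; exact: continuous_mlf.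
  - by move=> i; apply: continuous_mlf.
apply: key => //.
- near=> t; apply/andP; split; first by near: t; exact: nbhs_right_ge.
  by near: t; apply: nbhs_right_le; rewrite add0r.
- by move=> i; rewrite mlf1_at0//; exact: cvg_mlf1_right0.
- by move=> i; rewrite mlf_at0 ?ltr1n//; apply: cvg_mlf_right0 => //; rewrite ltr1n.
Unshelve. all: end_near. Qed.

Let wave_coef_parts t i :
  complex.Re (wave_coef t i) = complex.Re (u i) * mlf beta 1 (gamma i) t +
    complex.Re (v i) * mlf beta 2 (gamma i) t /\
  complex.Im (wave_coef t i) = complex.Im (u i) * mlf beta 1 (gamma i) t +
    complex.Im (v i) * mlf beta 2 (gamma i) t.
Proof.
rewrite /wave_coef ReD ImD !Re_realM !Im_realM.
by rewrite -!(mulrC (mlf beta 1 (gamma i) t)) -!(mulrC (mlf beta 2 (gamma i) t)).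
Qed.

Lemma wave_coef_solution (f : R -> R[i]) i : (forall t, 0 <= t -> f t = wave_coef t i) ->
  scalar_solution beta (gamma i) (u i) (v i) f.
Proof.
move=> fE; split; apply: mlf_real_scalar_solution => // t t0; rewrite fE//.
  exact: (wave_coef_parts t i).1.
exact: (wave_coef_parts t i).2.
Qed.

(** For uniqueness: a competitor has the same coefficients by [real_scalar_solution_unique], hence
    the same expansion in the basis. *)
Lemma unique_represented_wave (d : R) (w : R -> H) :
  (forall t, 0 <= t -> has_sum (fun i => wave_coef t i *: e i) (w t)) ->
  {within `[0, +oo[, continuous w} ->
  (forall t, 0 < t -> in_sobolev gamma d (wave_coef t)) ->
  unique_represented_solution dot gamma e beta d w0 w1 w.
Proof.
move=> hw cw dw.
have wE t i : 0 <= t -> fourier dot e (w t) i = wave_coef t i.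
  by move=> t0; exact: (has_sum_dot hdot onb i (hw t t0)).
have sw : wave_solution dot gamma e beta w0 w1 w.
  by move=> i; apply: wave_coef_solution => t t0; exact: wE.
split.
- split => // t t0; rewrite (_ : fourier dot e (w t) = wave_coef t); first exact: dw.
  by apply/funext => i; rewrite wE// ltW.
- move=> z [sz _ _] t t0.
  have zw i : dot (z t) (e i) = dot (w t) (e i).
    have [zr zi] := sz i; have [wr wi] := sw i.
    have hr := real_scalar_solution_unique beta1 beta2 (gamma0 i) zr wr t0.
    have hi := real_scalar_solution_unique beta1 beta2 (gamma0 i) zi wi t0.
    by apply/eqP; rewrite eq_complex -/(fourier dot e (z t) i) -/(fourier dot e (w t) i) hr hi !eqxx.
  apply: (has_sum_unique (onb.2 (z t))).
  by rewrite (_ : (fun i => _) = (fun i => dot (w t) (e i) *: e i));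
    [exact: onb.2|apply/funext => i; rewrite zw].
- move=> t t0; rewrite (_ : (fun i => _) = (fun i => wave_coef t i *: e i)); first exact: hw.
  by apply/funext => i; rewrite wave_coefficientE.
Qed.

(** Half the difference of the orders enters because the Sobolev weights multiply squared
    coefficients. *)
Lemma wave_coef_sobolev (d d1 t al ta : R) : 0 <= al -> 0 <= ta ->
  in_sobolev gamma d u -> in_sobolev gamma d1 v ->
  (forall i, `|mlf beta 1 (gamma i) t| <= al) ->
  (forall i, `|mlf beta 2 (gamma i) t| * (1 + gamma i) `^ ((d - d1) / 2) <= ta) ->
  in_sobolev gamma d (wave_coef t) /\
  sobolev_norm gamma d (wave_coef t) <=
    2 * (al * sobolev_norm gamma d u + ta * sobolev_norm gamma d1 v).
Proof.
move=> al0 ta0 du dv h1 h2; apply: sobolev_bound => // i.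
have g1 : 0 < 1 + gamma i by rewrite ltr_pwDl.
apply: le_trans (ler_wpM2l (powR_ge0 _ _) (normc_wave_coef t i)) _.
have H1 : mlf beta 1 (gamma i) t ^+ 2 <= al ^+ 2.
  by rewrite -[leLHS]real_normK ?num_real// ler_pXn2r.
have H2 : (1 + gamma i) `^ d * mlf beta 2 (gamma i) t ^+ 2 <= ta ^+ 2 * (1 + gamma i) `^ d1.
  have -> : (1 + gamma i) `^ d = ((1 + gamma i) `^ ((d - d1) / 2)) ^+ 2 * (1 + gamma i) `^ d1.
    by rewrite expr2 -!(gt0_powRD _ _ g1); congr (_ `^ _); field.
  rewrite mulrAC ler_wpM2r ?powR_ge0// -exprMn mulrC -[leLHS]real_normK ?num_real//.
  rewrite ler_pXn2r ?nnegrE ?normr_ge0// normrM (ger0_norm (powR_ge0 _ _)).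
  exact: h2.
move: H1 H2; move: (_ `^ d) (_ `^ d1) (powR_ge0 (1 + gamma i) d) => x y x0.
move: (mlf _ _ _ _ ^+ 2) (mlf _ _ _ _ ^+ 2) => m2 m1 H1 H2.
have U0 := sqr_ge0 (Normc.normc (u i)); have V0 := sqr_ge0 (Normc.normc (v i)).
move: U0 V0; move: (Normc.normc (u i) ^+ 2) (Normc.normc (v i) ^+ 2) => U V U0 V0.
rewrite (_ : x * (2 * (m1 * U + m2 * V)) = 2 * (m1 * (x * U)) + 2 * (x * m2 * V)); last by ring.
rewrite -!(mulrA 2) lerD// ler_wpM2l//; first by rewrite ler_wpM2r// mulr_ge0.
by rewrite mulrA ler_wpM2r.
Qed.

(** Common form of the four estimates: d1 is the order of w1, [al] and [ta] are the time factors,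
    and P is the range of times, which excludes 0 when [ta] is singular there. *)
Definition controlled (d d1 : R) (C : R) (al ta : R -> R) (P : R -> Prop) : Prop :=
  in_sobolev gamma d u -> in_sobolev gamma d1 v ->
  exists2 w : R -> H,
    unique_represented_solution dot gamma e beta d w0 w1 w &
    forall t, P t -> sobolev_norm gamma d (fourier dot e (w t)) <=
      C * (al t * sobolev_norm gamma d u + ta t * sobolev_norm gamma d1 v).

Lemma wave_controlled (d d1 C : R) (al ta : R -> R) (P : R -> Prop) : 0 <= C ->
  (forall t, 0 < t -> P t) -> (forall t, P t -> 0 <= t) ->
  (forall t, P t -> 0 <= al t) -> (forall t, P t -> 0 <= ta t) ->
  (forall t i, P t -> `|mlf beta 1 (gamma i) t| <= C * al t) ->
  (forall t i, P t ->
    `|mlf beta 2 (gamma i) t| * (1 + gamma i) `^ ((d - d1) / 2) <= C * ta t) ->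
  controlled d d1 (2 * C) al ta P.
Proof.
move=> C0 Ppos Pnn al0 ta0 h1 h2 du dv.
have [w [hw cw]] := wave_exists.
have key t : P t -> in_sobolev gamma d (wave_coef t) /\ sobolev_norm gamma d (wave_coef t) <=
    2 * (C * al t * sobolev_norm gamma d u + C * ta t * sobolev_norm gamma d1 v).
  move=> Pt; apply: wave_coef_sobolev => //.
  - by rewrite mulr_ge0// al0.
  - by rewrite mulr_ge0// ta0.
  - by move=> i; exact: h1.
  - by move=> i; exact: h2.
exists w.
  by apply: unique_represented_wave => // t /Ppos /key[].
move=> t Pt; have [_] := key t Pt.
rewrite (_ : fourier dot e (w t) = wave_coef t); last first.
  by apply/funext => i; exact: (has_sum_dot hdot onb i (hw t (Pnn t Pt))).
by rewrite -!(mulrA C) -mulrDr mulrA.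
Qed.
End wave.

(** If 0 is a resolvent point, a bounded B satisfies B (- gamma_i e_i) = e_i. Taking norms gives 1
    <= gamma_i r for a bound r of B, so 1 / r is a gap. *)
Lemma spectral_gap (R : realType) (H : completeNormedModType R[i])
    (dot : {dot H for @conjc R}) (I : countType) (D : set H) (L : H -> H)
    (gamma : I -> R) (e : I -> H) :
  hilbert_space dot -> positive_discrete_operator dot D L gamma e ->
  ~ spectrum D L 0 -> exists2 m, 0 < m & forall i, m <= gamma i.
Proof.
move=> hH [_ g0 eig _ onb]; rewrite /spectrum /setC /= => /contrapT[B [cB _ hB]].
have : \forall r \near +oo, forall x, `|B x| <= r * `|x|.
  by apply/linear_boundedP; apply/linear_bounded_continuous.
move=> hr; near (pinfty_nbhs R[i]) => r.
have r0 : 0 < r by near: r; exact: nbhs_pinfty_gt.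
have Bb : forall x, `|B x| <= r * `|x| by near: r.
have [/eqP Ir Rr] := andP (etrans (esym (ltcE 0 r)) r0); rewrite /= in Rr.
have rE : r = (complex.Re r)%:C%C by rewrite RRe_real// gtr0_real.
exists (complex.Re r)^-1; first by rewrite invr_gt0.
move=> i; have [Di Li] := eig i.
have n1 : `|e i| = 1.
  apply/eqP; rewrite -(eqrXn2 (ltn0Sn 1))// expr1n hH onb.1 eqxx//.
have := congr1 (fun x => `|x|) (hB _ Di).
rewrite Li scale0r sub0r linearN linearZ normrN normrZ n1 normc_def /= expr0n addr0 sqrtr_sqr.
rewrite (ger0_norm (g0 i)) => E.
have := ler_wpM2l (_ : 0 <= (gamma i)%:C%C) (Bb (e i)); rewrite E n1 mulr1 ler0c => /(_ (g0 i)).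
by rewrite rE -rmorphM /= lecR => h; rewrite -div1r ler_pdivrMr.
Unshelve. all: end_near. Qed.

(** * Elementary inequalities for the multipliers 1 / (1 + t^beta g) *)

Section symbol_bounds.
Context {R : realType}.
Variables (beta : R).
Hypotheses (beta1 : 1 < beta).
Implicit Types (t g m : R).

Let beta0 : 0 < beta. Proof. exact: lt_trans beta1. Qed.

Let den_gt0 t g : 0 <= g -> 0 < 1 + t `^ beta * g.
Proof. by move=> g0; rewrite ltr_pwDl// mulr_ge0// powR_ge0. Qed.

Lemma symbol_le1 t g : 0 <= g -> (1 + t `^ beta * g)^-1 <= 1.
Proof. by move=> g0; rewrite invf_le1 ?den_gt0// lerDl mulr_ge0// powR_ge0. Qed.

(** As g / m >= 1, the factor 1 + 1 / m pays for the replacement of g by 1, whether m is small or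
    large. *)
Lemma symbol_gap t g m : 0 < m -> m <= g ->
  (1 + t `^ beta * g)^-1 <= (1 + m^-1) * (1 + t `^ beta)^-1.
Proof.
move=> m0 mg; have g0 : 0 <= g by rewrite (le_trans _ mg)// ltW.
have p0 := powR_ge0 t beta; have d0 : 0 < 1 + t `^ beta by rewrite ltr_pwDl.
rewrite ler_pdivlMr// ler_pdivrMl ?den_gt0//.
have -> : (1 + t `^ beta * g) * (1 + m^-1) = 1 + t `^ beta * (g / m) + (m^-1 + t `^ beta * g) by ring.
have gm : 1 <= g / m by rewrite ler_pdivlMr ?mul1r.
apply: (@le_trans _ _ (1 + t `^ beta * (g / m))).
  by rewrite lerD2l ler_peMr.
by rewrite lerDl addr_ge0 ?invr_ge0 ?(ltW m0)// mulr_ge0.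
Qed.

(** For g <= 1 the weight is at most 2. For g > 1 it is at most 2 g^(1 / beta), and t g^(1 / beta) =
    y^(1 / beta) <= 1 + y with y = t^beta g, which the denominator absorbs. This fixes the order
    delta - 2 / beta of w1. *)
Lemma symbol_root t g : 0 <= t -> 0 <= g ->
  t * (1 + g) `^ beta^-1 / (1 + t `^ beta * g) <= 2 * (1 + t).
Proof.
move=> t0 g0; have bV : 0 <= beta^-1 by rewrite invr_ge0 ltW.
have bV1 : beta^-1 <= 1 by rewrite invf_le1// ltW.
have two : 2 `^ beta^-1 <= 2 :> R.
  by rewrite -[leRHS]powRr1// ler_powR// ler1n.
rewrite ler_pdivrMr ?den_gt0//.
have tg : 0 <= t `^ beta * g by rewrite mulr_ge0// powR_ge0.
have [g1|g1] := leP g 1.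
  have h : (1 + g) `^ beta^-1 <= 2.
    apply: le_trans two; apply: ge0_ler_powR => //; rewrite ?nnegrE ?addr_ge0//.
    by rewrite -[2]/(1 + 1) lerD2l.
  apply: (@le_trans _ _ (t * 2)); first by rewrite ler_wpM2l.
  rewrite mulrC -mulrA ler_wpM2l// -[leLHS]mulr1 ler_pM ?lerDl//.
  by rewrite lerDr.
have h : (1 + g) `^ beta^-1 <= 2 * g `^ beta^-1.
  apply: (@le_trans _ _ ((2 * g) `^ beta^-1)).
    apply: ge0_ler_powR => //; rewrite ?nnegrE ?addr_ge0 ?mulr_ge0//.
    by move: g1; lra.
  by rewrite powRM// ler_wpM2r ?powR_ge0.
have ht : t * g `^ beta^-1 <= 1 + t `^ beta * g.
  have -> : t * g `^ beta^-1 = (t `^ beta * g) `^ beta^-1.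
    by rewrite powRM ?powR_ge0// -powRrM mulfV ?gt_eqF// powRr1.
  have [y1|y1] := leP (t `^ beta * g) 1.
    apply: (@le_trans _ _ 1); last by rewrite lerDl.
    have e1 : 1 `^ beta^-1 = 1 :> R by rewrite powR1.
    by rewrite -[leRHS]e1; apply: ge0_ler_powR; rewrite ?nnegrE.
  apply: (@le_trans _ _ (t `^ beta * g)); last by rewrite lerDr.
  by rewrite -[leRHS]powRr1// ler_powR// ltW.
apply: (@le_trans _ _ (2 * (t * g `^ beta^-1))); first by rewrite mulrCA ler_wpM2l.
rewrite -mulrA ler_wpM2l//; apply: le_trans ht _.
by rewrite ler_peMl ?lerDl// ltW// den_gt0.
Qed.

(** Multiplied out, the right side exceeds 1 + g by t^beta g + t^(- beta). *)
Lemma symbol_inv t g : 0 < t -> 0 <= g ->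
  (1 + g) / (1 + t `^ beta * g) <= 1 + t `^ (- beta).
Proof.
move=> t0 g0; rewrite ler_pdivrMr ?den_gt0// powRN.
have p0 : 0 < t `^ beta by exact: powR_gt0.
have -> : (1 + (t `^ beta)^-1) * (1 + t `^ beta * g) =
    1 + g + (t `^ beta * g + (t `^ beta)^-1) by field; rewrite gt_eqF.
by rewrite lerDl addr_ge0 ?mulr_ge0 ?invr_ge0 ?(ltW p0).
Qed.
End symbol_bounds.

Theorem theorem1p2 (R : realType) (beta delta : R)
    (H : completeNormedModType R[i]) (dot : {dot H for @conjc R})
    (I : countType) (D : set H) (L : H -> H) (gamma : I -> R) (e : I -> H) :
  1 < beta -> beta < 2 ->
  hilbert_space dot -> separable_space H ->
  positive_discrete_operator dot D L gamma e ->
  let hat := fourier dot e in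
  let inHs s f := in_sobolev gamma s (hat f) in
  let normHs s f := sobolev_norm gamma s (hat f) in
  [/\ (spectrum D L 0 ->
       exists2 C : R, 0 < C & forall w0 w1 : H,
         inHs delta w0 -> inHs delta w1 ->
         exists2 w : R -> H,
           unique_represented_solution dot gamma e beta delta w0 w1 w &
           forall t, 0 <= t ->
             normHs delta (w t)
             <= C * (normHs delta w0 + t * normHs delta w1)),
      (~ spectrum D L 0 ->
       exists2 C : R, 0 < C & forall w0 w1 : H,
         inHs delta w0 -> inHs delta w1 ->
         exists2 w : R -> H,
           unique_represented_solution dot gamma e beta delta w0 w1 w &
           forall t, 0 <= t ->
             normHs delta (w t)
             <= C * ((1 + t `^ beta)^-1 * normHs delta w0
                     + t * (1 + t `^ beta)^-1 * normHs delta w1)),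
      (exists2 C : R, 0 < C & forall w0 w1 : H,
         inHs delta w0 -> inHs (delta - 2 / beta) w1 ->
         exists2 w : R -> H,
           unique_represented_solution dot gamma e beta delta w0 w1 w &
           forall t, 0 <= t ->
             normHs delta (w t)
             <= C * (normHs delta w0
                     + (1 + t) * normHs (delta - 2 / beta) w1)) &
      (exists2 C : R, 0 < C & forall w0 w1 : H,
         inHs delta w0 -> inHs (delta - 2) w1 ->
         exists2 w : R -> H,
           unique_represented_solution dot gamma e beta delta w0 w1 w &
           forall t, 0 < t ->
             normHs delta (w t)
             <= C * (normHs delta w0
                     + t * (1 + t `^ (- beta)) * normHs (delta - 2) w1))].

Proof.
move=> b1 b2 hH _ pdo hat inHs normHs.
have [_ g0 _ _ onb] := pdo.
have b0 : 0 < beta by exact: lt_trans b1.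
have [K K0 hK] := mlf_decay g0 b1 b2; have K00 := ltW K0.
have K20 : 0 < 2 * K by rewrite mulr_gt0.
have K40 : 0 < 2 * (2 * K) by rewrite mulr_gt0.
have le1 t i : 0 <= t -> `|mlf beta 1 (gamma i) t| <= K * 1.
  by move=> t0; apply: le_trans (hK t i t0).1 _; rewrite ler_wpM2l// symbol_le1.
(* With x the Sobolev weight, every bound on the second multiplier reduces to an inequality between
   t and gamma alone. *)
have le2 t i (x c : R) : 0 <= t -> 0 <= x -> t * x / (1 + t `^ beta * gamma i) <= c ->
    `|mlf beta 2 (gamma i) t| * x <= K * c.
  move=> t0 x0 h; apply: le_trans (ler_wpM2r x0 (hK t i t0).2) _.
  by rewrite -!(mulrA K) ler_wpM2l// mulrAC.
have pos (t : R) : 0 < t -> 0 <= t by exact: ltW.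
have one (t : R) : 0 <= t -> 0 <= 1 :> R by move=> _; exact: ler01.
split.
- move=> _; exists (2 * K) => // w0 w1 h0 h1.
  have p2 t i : 0 <= t ->
      `|mlf beta 2 (gamma i) t| * (1 + gamma i) `^ ((delta - delta) / 2) <= K * t.
    move=> t0; apply: le2 => //; rewrite ?powR_ge0// subrr mul0r powRr0 mulr1.
    by rewrite ler_piMr// symbol_le1.
  have [w hw bw] := wave_controlled hH onb g0 b1 b2 K00 pos (fun _ => id) one (fun _ => id)
    le1 p2 h0 h1.
  exists w => // t t0; have := bw t t0; rewrite mul1r; exact.
(* The gap m turns decay in t^beta gamma into decay in t^beta, uniformly in the eigenvalue. *)
- move=> /(spectral_gap hH pdo)[m m0 mg].
  have c0 : 0 < 1 + m^-1 by rewrite addr_gt0// invr_gt0.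
  have d0 t : 0 <= (1 + t `^ beta)^-1 by rewrite invr_ge0 addr_ge0// powR_ge0.
  have sg t i := symbol_gap beta t m0 (mg i).
  exists (2 * (K * (1 + m^-1))); first by rewrite !mulr_gt0.
  move=> w0 w1 h0 h1.
  have Kc : 0 <= K * (1 + m^-1) by rewrite mulr_ge0// ltW.
  have a0 t : 0 <= t -> 0 <= (1 + t `^ beta)^-1 by [].
  have a1 t : 0 <= t -> 0 <= t * (1 + t `^ beta)^-1 by move=> t0; rewrite mulr_ge0.
  have p1 t i : 0 <= t ->
      `|mlf beta 1 (gamma i) t| <= K * (1 + m^-1) * (1 + t `^ beta)^-1.
    by move=> t0; apply: le_trans (hK t i t0).1 _; rewrite -mulrA ler_wpM2l// sg.
  have p2 t i : 0 <= t -> `|mlf beta 2 (gamma i) t| *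
      (1 + gamma i) `^ ((delta - delta) / 2) <= K * (1 + m^-1) * (t * (1 + t `^ beta)^-1).
    move=> t0; rewrite -mulrA; apply: le2; rewrite ?powR_ge0// subrr mul0r powRr0 mulr1.
    by rewrite mulrCA ler_wpM2l// sg.
  have [w hw bw] := wave_controlled hH onb g0 b1 b2 Kc pos (fun _ => id) a0 a1 p1 p2 h0 h1.
  by exists w.
(* The additional factor 2 is that of [symbol_root]. *)
- exists (2 * (2 * K)) => // w0 w1 h0 h1.
  have a1 (t : R) : 0 <= t -> 0 <= 1 + t by move=> t0; rewrite addr_ge0.
  have p1 t i : 0 <= t -> `|mlf beta 1 (gamma i) t| <= 2 * K * 1.
    by move=> t0; apply: le_trans (le1 t i t0) _; rewrite ler_wpM2r// ler_peMl// ler1n.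
  have p2 t i : 0 <= t -> `|mlf beta 2 (gamma i) t| *
      (1 + gamma i) `^ ((delta - (delta - 2 / beta)) / 2) <= 2 * K * (1 + t).
    move=> t0; rewrite (mulrC 2 K) -(mulrA K); apply: le2; rewrite ?powR_ge0//.
    rewrite (_ : (delta - (delta - 2 / beta)) / 2 = beta^-1); last by field; rewrite gt_eqF.
    exact: symbol_root.
  have [w hw bw] := wave_controlled hH onb g0 b1 b2 (ltW K20) pos (fun _ => id) one a1
    p1 p2 h0 h1.
  exists w => // t t0; have := bw t t0; rewrite mul1r; exact.
- exists (2 * K) => // w0 w1 h0 h1.
  have a0 (t : R) : 0 < t -> 0 <= 1 :> R by move=> _; exact: ler01.
  have a1 (t : R) : 0 < t -> 0 <= t * (1 + t `^ (- beta)).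
    by move=> t0; rewrite mulr_ge0 ?(ltW t0)// addr_ge0// powR_ge0.
  have p1 t i : 0 < t -> `|mlf beta 1 (gamma i) t| <= K * 1 by move=> /ltW; exact: le1.
  have p2 t i : 0 < t -> `|mlf beta 2 (gamma i) t| *
      (1 + gamma i) `^ ((delta - (delta - 2)) / 2) <= K * (t * (1 + t `^ (- beta))).
    move=> t0; apply: le2; rewrite ?(ltW t0) ?powR_ge0//.
    rewrite (_ : (delta - (delta - 2)) / 2 = 1); last by field.
    rewrite powRr1 ?addr_ge0// -mulrA ler_wpM2l ?(ltW t0)//.
    exact: symbol_inv.
  have [w hw bw] := wave_controlled hH onb g0 b1 b2 K00 (fun _ => id) pos a0 a1 p1 p2 h0 h1.
  exists w => // t t0; have := bw t t0; rewrite mul1r; exact.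
Qed.
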